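(* Let $m,p\geq 1$ be integers and let $\gamma$ be a (real) rational normal curve in $\mathbb{R}^{m+p}$. Let $a_1,\ldots,a_n$ be positive integers with $a_1+\cdots+a_n=mp$. For each $i=1,\ldots,n$ let $\sigma_i(s)$ be (a fixed choice of) either the special Schubert cycle $\tau^{a_i}(s)$ or the special Schubert cycle $\tau_{a_i}(s)$. Then there exist real points $0,\infty,s_1,\ldots,s_n\in\gamma$ such that for any Schubert conditions $w,v$ and any integer $k$ with $1\le k\le n$ and $|w|+|v|+a_k+\cdots+a_n=mp$, the intersection $$\sigma_w(0)\cap \sigma_v(\infty)\cap \sigma_k(s_k)\cap\cdots\cap\sigma_n(s_n)$$ in the Grassmannian of $p$-planes in $\mathbb{C}^{m+p}$ is transverse with all points of intersection real.
   Context: The rational normal curve $\gamma$: up to a real linear change of coordinates on $\mathbb{R}^{m+p}$, it is the curve parametrized by $\gamma(s)=(1,s,s^2,\ldots,s^{m+p-1})$, $s\in\mathbb{R}$, completed by the point at $s=\infty$ (so $\gamma\cong\mathbb{P}^1(\mathbb{R})$, viewed in $\mathbb{P}(\mathbb{R}^{m+p})$). The symbols $0$ and $\infty$ denote two points of $\gamma$. For $k>0$ and $s\in\gamma$, $K_k(s)$ is the $k$-dimensional linear subspace osculating $\gamma$ at $s$: for finite $s$ it is the span of $\gamma(s),\gamma'(s),\ldots,\gamma^{(k-1)}(s)$, and for $s=\infty$ it is the span of the last $k$ standard basis vectors (in the coordinates on $\mathbb{R}^{m+p}$ for which $\gamma(s)=(1,s,s^2,\ldots,s^{m+p-1})$).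 We also write $K_k(s)$ for its complexification in $\mathbb{C}^{m+p}$. The subspaces $K_1(s)\subset K_2(s)\subset\cdots\subset K_{m+p}(s)$ form the flag osculating $\gamma$ at $s$. By convention $K_k(s)=\{0\}$ for $k\le 0$ and $K_k(s)$ is the whole space for $k\ge m+p$. Let $G$ be the Grassmannian of $p$-dimensional linear subspaces ($p$-planes) of $\mathbb{C}^{m+p}$; it has dimension $mp$. For an integer $a>0$: - $\tau_a(s)$ is the set of $H\in G$ with $H\cap K_{m+1-a}(s)\neq\{0\}$; - $\tau^a(s)$ is the set of $H\in G$ with $\dim (H\cap K_{m-1+a}(s))> a-1$. These have codimension $a$ in $G$ when $a\le m$, respectively $a\le p$, and are empty otherwise. A Schubert condition $w$ is a partition $m\ge w_1\ge w_2\ge\cdots\ge w_p\ge 0$, and the Schubert cycle of type $w$ given by the flag osculating $\gamma$ at $s$ is $$\sigma_w(s)=\{H\in G : \dim (H\cap K_{m+j-w_j}(s))\ge j \text{ for } j=1,\ldots,p\},$$ a subvariety of codimension $|w|=w_1+\cdots+w_p$. A $p$-plane $H\subset\mathbb{C}^{m+p}$ is real if it is the complexification of a $p$-dimensional subspace of $\mathbb{R}^{m+p}$. An intersection of subvarieties is transverse if at each point of the intersection every subvariety is smooth and their tangent spaces meet transversally; for the zero-dimensional expected dimension here this means the intersection is finite and reduced as a scheme (an empty intersection is allowed). *)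

(* Defs.v *)
From HB Require Import structures.
From mathcomp Require Import all_boot all_order all_algebra.
From mathcomp Require Import reals complex.
(* Not imported: the notations of mpoly clash with those of MathComp-Analysis. *)
From mathcomp Require mpoly.

Set Implicit Arguments.
Unset Strict Implicit.
Unset Printing Implicit Defensive.
Import Order.TTheory GRing.Theory Num.Theory.
Local Open Scope ring_scope.

(* Subspaces of a coordinate space are row spaces of matrices (scope %MS).
   The Grassmannian of p-planes in C^(m+p) consists of the row-free
   H : 'M[C]_(p, m + p), two such matrices giving the same point when
   (H :=: H')%MS; a subset of it is a predicate on these matrices. *)

Section Osculating.
Variables (R : realType) (m p : nat).

(* A point of the rational normal curve is given by its parameter in P^1(R):
   Some s is gamma(s), None is the point gamma(oo). *)
Definition curve_point := option R.

(* The subspace K_k at x, for the curve (1, s, ..., s^(m+p-1)): the i-th row of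
   the matrix at Some s is the i-th derivative of that curve at s. *)
Definition std_osculating (k : nat) (x : curve_point) : 'M[R]_(m + p) :=
  match x with
  | Some s => <<\matrix_(i < k, j < m + p) ('X^j : {poly R})^`(i).[s]>>%MS
  | None => copid_mx (m + p - k)
  end.

Definition complexify n1 n2 (A : 'M[R]_(n1, n2)) : 'M[R[i]]_(n1, n2) :=
  map_mx (real_complex R) A.

(* g is the real linear change of coordinates carrying (1, s, ..., s^(m+p-1))
   to the rational normal curve under consideration. *)
Definition osculating (g : 'M[R]_(m + p)) (k : nat) (x : curve_point) :
  'M[R[i]]_(m + p) := complexify (std_osculating k x *m g).

Definition real_plane (H : 'M[R[i]]_(p, m + p)) : Prop :=
  exists H0 : 'M[R]_(p, m + p), (H :=: complexify H0)%MS.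

(* The truncated subtractions agree with the convention K_k = 0 for k <= 0;
   m - 1 and a - 1 are only meant for m, a >= 1. *)
Definition tau_lower (g : 'M[R]_(m + p)) (a : nat) (x : curve_point)
    (H : 'M[R[i]]_(p, m + p)) : Prop :=
  (H :&: osculating g (m + 1 - a) x)%MS != 0.

Definition tau_upper (g : 'M[R]_(m + p)) (a : nat) (x : curve_point)
    (H : 'M[R[i]]_(p, m + p)) : Prop :=
  (a - 1 < \rank (H :&: osculating g (m - 1 + a) x)%MS)%N.

(* w_(j+1) is written w j, for j : 'I_p. *)
Definition schubert_condition (w : 'I_p -> nat) : Prop :=
  (forall j, (w j <= m)%N) /\ (forall i j : 'I_p, (i <= j)%N -> (w j <= w i)%N).

Definition schubert_cycle (g : 'M[R]_(m + p)) (w : 'I_p -> nat)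
    (x : curve_point) (H : 'M[R[i]]_(p, m + p)) : Prop :=
  forall j : 'I_p,
    (j.+1 <= \rank (H :&: osculating g (m + j.+1 - w j) x)%MS)%N.

End Osculating.

Section Transversality.
Variables (C : fieldType) (m p : nat).
Implicit Types (Z : 'M[C]_(p, m + p) -> Prop) (H : 'M[C]_(p, m + p)).
Implicit Types (N : 'M[C]_(m, m + p)) (X : 'M[C]_(p, m)).

(* For N spanning a complement of H, X |-> H + X *m N parametrizes the affine
   chart of the Grassmannian centred at H consisting of the complements of N,
   and identifies the tangent space Hom(H, C^(m+p) / H) with the 'M_(p, m),
   here flattened to 'rV_(p * m). *)
Definition complementary H N : Prop := row_full (col_mx H N).

Definition in_chart Z H N X : Prop := Z (H + X *m N).

Definition peval (f : mpoly.mpoly (p * m) C) X : C :=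
  mpoly.meval (fun k => mxvec X 0 k) f.

Definition gradient0 (f : mpoly.mpoly (p * m) C) : 'rV[C]_(p * m) :=
  \row_k peval (mpoly.mderiv k f) 0.

(* The Zariski tangent space at H of the closed subset Z is (the row space of)
   T: the common kernel of the differentials of the functions vanishing on Z. *)
Definition is_tangent_space Z H N (T : 'M[C]_(p * m)) : Prop :=
  forall xi : 'rV[C]_(p * m),
    (xi <= T)%MS <->
    (forall f, (forall X, in_chart Z H N X -> peval f X = 0) ->
       gradient0 f *m xi^T = 0).

(* Jacobian criterion: on a Zariski-open neighbourhood (h <> 0) of H, the set Z
   is the zero set of polynomials with independent differentials at H. *)
Definition smooth_at Z H N : Prop :=
  exists (c : nat) (F : 'I_c -> mpoly.mpoly (p * m) C)
         (h : mpoly.mpoly (p * m) C),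
    [/\ peval h 0 != 0,
        row_free (\matrix_(i < c) gradient0 (F i)) &
        forall X, peval h X != 0 ->
          (in_chart Z H N X <-> forall i, peval (F i) X = 0)].

(* Subspaces meet transversally when the codimension of their intersection is
   the sum of their codimensions. *)
Definition transverse (I : finType) (Z : I -> 'M[C]_(p, m + p) -> Prop) : Prop :=
  forall H, row_free H -> (forall i, Z i H) ->
  forall N, complementary H N ->
    (forall i, smooth_at (Z i) H N) /\
    exists T : I -> 'M[C]_(p * m),
      (forall i, is_tangent_space (Z i) H N (T i)) /\
      (p * m - \rank (\bigcap_i T i)%MS = \sum_i (p * m - \rank (T i)))%N.

End Transversality.

(* Main.v *)
(* The points are chosen one after the other, each close enough to 0. Planes in
   sigma_w(0), in a special cycle of codimension a at s and in some further cycles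
   are followed as s -> 0: a sequence of such planes is a plane over an ultrapower
   of C, where s becomes a nonzero infinitesimal, and the standard part of its
   reduced echelon form lies in sigma_u(0) for a partition u containing w.
   Up to powers of s, the vectors of an osculating space are the values at
   integers of polynomials of bounded degree, and the nonzero entries of the echelon
   form lie in a strip between w and u; counting shows |u| >= |w| + a. When the
   dimensions match, the limit planes are known by induction to be rigid. Two planes
   with the same limit, or a plane with a tangent direction common to all the
   conditions, would yield, after scaling the difference and taking its standard
   part, a nonzero tangent direction of the conditions at the limit. This gives
   transversality, and, applied to a plane and to its complex conjugate, reality.
   In the base case only opposite Schubert varieties at 0 and oo remain. Finally,
   in the chart given by the echelon form with respect to the flag, each cycle is a
   coordinate subspace, which gives smoothness and the tangent spaces. *)

Require Import Defs.
From HB Require Import structures.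
From mathcomp Require Import all_boot all_order all_algebra perm.
From mathcomp Require Import boolp classical_sets filter.
From mathcomp Require Import reals complex.
From mathcomp Require Import ring lra zify.
From mathcomp Require Import -(notations) mpoly.

Set Implicit Arguments.
Unset Strict Implicit.
Unset Printing Implicit Defensive.
Import Order.TTheory GRing.Theory Num.Theory.
Local Open Scope ring_scope.

(** Solutions are never counted and never shown to exist: only emptiness above the expected
    codimension ([no_excess]) and rigidity with reality at it ([rigid_real]) are proved. Both are
    carried for all [w], [v] at once, because a limit replaces [w] by an unknown larger partition u;
    emptiness at the limit then turns |u| >= |w| + a into an equality. That equality makes the skew
    shape a horizontal or vertical strip, with one allowed entry per column or per row, and this
    keeps the scaled limit direction tangent to the smaller Schubert variety. The count rests on
    coding theory: after division by powers of s an osculating space is a Reed-Solomon code, or for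
    linear forms the dual of one, so a finite codeword with too many infinitesimal coordinates is
    infinitesimal. Smoothness and tangent limits need conditions met in exact dimension; a larger
    intersection would satisfy the condition of codimension a + 1, which is why emptiness is also
    proved for [incremented] codimensions. The ultrapower gives every sequence of planes a single
    limit, computed by matrix algebra. *)

Section UltrapowerDef.
Local Open Scope quotient_scope.
Variables (U : set_system nat) (UU : UltraFilter U) (K : fieldType).
Implicit Types f g : nat -> K.

Definition eventually_eq f g : bool := `[< U (fun n => f n = g n) >].

Lemma eventually_eq_equiv : equiv_class_of eventually_eq.
Proof.
split=> [f|f g|g f h].
- by apply/asboolP; apply: filterE.
- by apply/asboolP/asboolP; apply: filterS => n /= ->.
- move=> /asboolP fg /asboolP gh; apply/asboolP.
  by apply: filterS2 fg gh => n /= -> ->.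
Qed.

Canonical eventually_eq_equivRel := EquivRelPack eventually_eq_equiv.

Definition ultrapower := {eq_quot eventually_eq_equivRel}%qT.

HB.instance Definition _ := Choice.on ultrapower.

Definition germ f : ultrapower := \pi f.

Lemma germ_eq f g : germ f = germ g <-> U (fun n => f n = g n).
Proof.
split=> [/eqP|fg]; last by apply/eqmodP/asboolP.
by rewrite /germ -/(\pi_ultrapower f) eqmodE => /asboolP.
Qed.

Definition rep (x : ultrapower) : nat -> K := repr x.

Lemma repK x : germ (rep x) = x.
Proof. exact: reprK. Qed.

Lemma rep_germ f : U (fun n => rep (germ f) n = f n).
Proof. by apply/germ_eq; rewrite repK. Qed.

Definition uop2 (op : K -> K -> K) (x y : ultrapower) :=
  germ (fun n => op (rep x n) (rep y n)).
Definition uop1 (op : K -> K) (x : ultrapower) := germ (fun n => op (rep x n)).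

Lemma germ_op2 op f g : uop2 op (germ f) (germ g) = germ (fun n => op (f n) (g n)).
Proof. by apply/germ_eq; apply: filterS2 (rep_germ f) (rep_germ g) => n /= -> ->. Qed.

Lemma germ_op1 op f : uop1 op (germ f) = germ (fun n => op (f n)).
Proof. by apply/germ_eq; apply: filterS (rep_germ f) => n /= ->. Qed.

Lemma germP (x : ultrapower) : exists f, x = germ f.
Proof. by exists (rep x); rewrite repK. Qed.

Let uadd := uop2 +%R.
Let umul := uop2 *%R.
Let uopp := uop1 -%R.
Let uinv := uop1 GRing.inv.
Let u0 := germ (fun=> 0).
Let u1 := germ (fun=> 1).

Ltac ugerm := rewrite /uadd /umul /uopp ?(germ_op2, germ_op1);
  congr germ; apply: funext => n.

Fact uaddA : associative uadd. Proof.
by move=> x y z; case: (germP x) (germP y) (germP z) => [f ->] [g ->] [h ->]; ugerm; rewrite addrA.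
Qed.
Fact uaddC : commutative uadd. Proof. by move=> x y; case: (germP x) (germP y) => [f ->] [g ->]; ugerm; rewrite addrC. Qed.
Fact uadd0 : left_id u0 uadd. Proof. by move=> x; case: (germP x) => [f ->]; ugerm; rewrite add0r. Qed.
Fact uaddN : left_inverse u0 uopp uadd. Proof. by move=> x; case: (germP x) => [f ->]; ugerm; rewrite addNr. Qed.

HB.instance Definition _ := GRing.isZmodule.Build ultrapower uaddA uaddC uadd0 uaddN.

Fact umulA : associative umul. Proof.
by move=> x y z; case: (germP x) (germP y) (germP z) => [f ->] [g ->] [h ->]; ugerm; rewrite mulrA.
Qed.
Fact umulC : commutative umul. Proof. by move=> x y; case: (germP x) (germP y) => [f ->] [g ->]; ugerm; rewrite mulrC. Qed.
Fact umul1 : left_id u1 umul. Proof. by move=> x; case: (germP x) => [f ->]; ugerm; rewrite mul1r. Qed.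
Fact umulDl : left_distributive umul +%R.
Proof.
move=> x y z; case: (germP x) (germP y) (germP z) => [f ->] [g ->] [h ->].
by rewrite /GRing.add /=; ugerm; rewrite mulrDl.
Qed.
Fact u1_neq0 : u1 != 0.
Proof.
apply/eqP => /germ_eq h; apply: (@filter_not_empty _ U).
by apply: filterS h => n /= /eqP; rewrite oner_eq0.
Qed.

HB.instance Definition _ :=
  GRing.Zmodule_isComNzRing.Build ultrapower umulA umulC umul1 umulDl u1_neq0.

(** This is where the filter must be ultra: either f vanishes on a large set, and then its germ is
    0, or f is nonzero on a large set, and there the termwise inverse works. *)
Fact umulV x : x != 0 -> umul (uinv x) x = u1.
Proof.
have [f ->] := germP x => f0; rewrite /umul /uinv germ_op1 germ_op2.
apply/germ_eq; have [h|] := in_ultra_setVsetC (fun n => f n = 0) UU.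
  by case/eqP: f0; apply/germ_eq.
by apply: filterS => n /= /eqP h; rewrite mulVf.
Qed.

Fact uinv0 : uinv 0 = 0.
Proof. by rewrite /uinv germ_op1 invr0. Qed.

HB.instance Definition _ := GRing.ComNzRing_isField.Build ultrapower umulV uinv0.

Lemma germ0 : 0 = germ (fun=> 0). Proof. by []. Qed.
Lemma germ1 : 1 = germ (fun=> 1). Proof. by []. Qed.
Lemma germD f g : germ f + germ g = germ (fun n => f n + g n).
Proof. exact: germ_op2. Qed.
Lemma germM f g : germ f * germ g = germ (fun n => f n * g n).
Proof. exact: germ_op2. Qed.
Lemma germN f : - germ f = germ (fun n => - f n).
Proof. exact: germ_op1. Qed.
Lemma germV f : (germ f)^-1 = germ (fun n => (f n)^-1).
Proof. exact: germ_op1. Qed.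

Lemma germ_sum (I : Type) (r : seq I) (P : pred I) (F : I -> nat -> K) :
  \sum_(i <- r | P i) germ (F i) = germ (fun n => \sum_(i <- r | P i) F i n).
Proof.
elim: r => [|i r IHr].
  by rewrite big_nil germ0; congr germ; apply: funext => n; rewrite big_nil.
rewrite big_cons; case Pi: (P i); rewrite IHr ?germD; congr germ;
  by apply: funext => n; rewrite big_cons Pi.
Qed.

Definition const_germ (c : K) := germ (fun=> c).

Fact const_germ_is_zmod : zmod_morphism const_germ.
Proof. by move=> x y; rewrite germN germD. Qed.
Fact const_germ_is_monoid : monoid_morphism const_germ.
Proof. by split=> // x y; rewrite germM. Qed.
HB.instance Definition _ :=
  GRing.isZmodMorphism.Build K ultrapower const_germ const_germ_is_zmod.
HB.instance Definition _ :=
  GRing.isMonoidMorphism.Build K ultrapower const_germ const_germ_is_monoid.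

Definition germ_mx a b (A : nat -> 'M[K]_(a, b)) : 'M[ultrapower]_(a, b) :=
  \matrix_(i, j) germ (fun n => A n i j).

Lemma germ_mxM a b c (A : nat -> 'M[K]_(a, b)) (B : nat -> 'M[K]_(b, c)) :
  germ_mx A *m germ_mx B = germ_mx (fun n => A n *m B n).
Proof.
apply/matrixP=> i j; rewrite !mxE.
under eq_bigr do rewrite !mxE germM.
by rewrite germ_sum; congr germ; apply: funext => n; rewrite mxE.
Qed.

Lemma germ_mxD a b (A B : nat -> 'M[K]_(a, b)) :
  germ_mx A + germ_mx B = germ_mx (fun n => A n + B n).
Proof.
by apply/matrixP=> i j; rewrite !mxE germD; congr germ; apply: funext => n; rewrite mxE.
Qed.

Lemma germ_mx_const a b (A : 'M[K]_(a, b)) :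
  germ_mx (fun=> A) = map_mx const_germ A.
Proof. by apply/matrixP=> i j; rewrite !mxE. Qed.

Lemma germ_mx1 a : germ_mx (fun=> 1%:M) = 1%:M :> 'M_a.
Proof. by rewrite germ_mx_const map_mx1. Qed.

Lemma germ_mx0 a b : germ_mx (fun=> 0) = 0 :> 'M_(a, b).
Proof. by rewrite germ_mx_const map_mx0. Qed.

End UltrapowerDef.

(* The data of a place F -> K union {oo} with a section cst: finite is its
   valuation ring, and st, the residue map, plays the part of the limit. *)
Record place (F K : fieldType) := Place {
  finite : F -> Prop;
  st : F -> K;
  cst : {rmorphism K -> F};
  finite_cst : forall c, finite (cst c);
  st_cst : forall c, st (cst c) = c;
  finiteD : forall x y, finite x -> finite y -> finite (x + y);
  finiteM : forall x y, finite x -> finite y -> finite (x * y);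
  stD : forall x y, finite x -> finite y -> st (x + y) = st x + st y;
  stM : forall x y, finite x -> finite y -> st (x * y) = st x * st y;
  finite_or_inv : forall x, finite x \/ finite x^-1 /\ st x^-1 = 0
}.

Lemma pos_complex (R : realType) (e : R[i]) : 0 < e -> exists2 x : R, 0 < x & e = x%:C%C.
Proof. by case: e => x y; rewrite ltcE /= => /andP[/eqP-> x0]; exists x. Qed.

(** * Limits along an ultrafilter and standard parts of complex germs *)

Section UltraLimit.
Variables (U : set_system nat) (UU : UltraFilter U).

Section Limit.
Variable K : numFieldType.
Implicit Types (f g : nat -> K) (c d : K).

Definition ulim f c := forall e : K, 0 < e -> U (fun n => `|f n - c| < e).

Lemma ulim_unique f c d : ulim f c -> ulim f d -> c = d.
Proof.
move=> fc fd; apply/eqP; rewrite -subr_eq0; apply/negPn/negP => cd0.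
have e0 : 0 < `|c - d| / 2 by rewrite divr_gt0 ?normr_gt0.
have [n [/= h1 h2]] := @filter_ex _ _ _ _ (filterI (fc _ e0) (fd _ e0)).
have : `|c - d| < `|c - d|.
  rewrite {2}(splitr `|c - d|); apply: le_lt_trans (ltrD h1 h2).
  by rewrite -(distrC c) (le_trans _ (ler_normD _ _)) // addrA subrK.
by rewrite ltxx.
Qed.

Lemma ulim_eq f g c : U (fun n => f n = g n) -> ulim f c -> ulim g c.
Proof. by move=> fg fc e /fc; apply: filterS2 fg => n /= ->. Qed.

Lemma ulim_cst c : ulim (fun=> c) c.
Proof. by move=> e e0; apply: filterE => n; rewrite /= subrr normr0. Qed.

Lemma ulimD f g c d : ulim f c -> ulim g d -> ulim (fun n => f n + g n) (c + d).
Proof.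
move=> fc gd e e0; have e20 : 0 < e / 2 by rewrite divr_gt0.
apply: filterS2 (fc _ e20) (gd _ e20) => n /= h1 h2.
rewrite (splitr e) (_ : _ - _ = (f n - c) + (g n - d)); last by ring.
by apply: le_lt_trans (ler_normD _ _) (ltrD h1 h2).
Qed.

Lemma ulimM f g c d : ulim f c -> ulim g d -> ulim (fun n => f n * g n) (c * d).
Proof.
(* The tolerance e / t is at most 1, which controls the product of the two errors, and e / t times 1
   + |d| + |c| stays below e because t exceeds that sum by e. *)
move=> fc gd e e0; set t := e + 1 + `|c| + `|d|.
have t0 : 0 < t by rewrite /t !ltr_wpDr.
have s0 : 0 < e / t by rewrite divr_gt0.
have s1 : e / t <= 1.
  by rewrite ler_pdivrMr // mul1r /t -!addrA lerDl !addr_ge0.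
apply: filterS2 (fc _ s0) (gd _ s0) => n /= h1 h2.
rewrite (_ : _ - _ = (f n - c) * (g n - d) + ((f n - c) * d + c * (g n - d)));
  last by ring.
apply: (@le_lt_trans _ _ (e / t * (1 + `|d| + `|c|))).
  rewrite -(addrA 1) (mulrDr _ 1) (mulrDr _ `|d|); apply: le_trans (ler_normD _ _) _.
  apply: lerD; first by rewrite normrM; apply: ler_pM => //; [exact: ltW|exact: ltW (lt_le_trans h2 s1)].
  apply: le_trans (ler_normD _ _) _; rewrite !normrM [in leRHS](mulrC _ `|c|).
  by apply: lerD; rewrite ?ler_wpM2l ?ler_wpM2r // ltW.
rewrite mulrAC ltr_pdivrMr // ltr_pM2l // /t.
by rewrite -addrA [`|d| + _]addrC !addrA -[ltLHS]add0r -!addrA ltrD2r.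
Qed.
End Limit.

(** The limit is the supremum of the reals that lie below f on a large set. Since sup + e / 2 is not
    such a real, the ultrafilter puts f below it on a large set. *)
Lemma ulim_bounded (R : realType) (f : nat -> R) (M : R) :
  U (fun n => `|f n| <= M) -> exists c, ulim f c.
Proof.
move=> fM; pose L := [set x | U (fun n => x <= f n)]%classic.
have hL : has_sup L.
  split; first by exists (- M); apply: filterS fM => n; rewrite /= ler_norml => /andP[].
  exists M => x Lx; have [n [/= h1]] := @filter_ex _ _ _ _ (filterI Lx fM).
  by rewrite ler_norml => /andP[_]; apply: le_trans.
exists (sup L) => e e0.
have [x Lx xe] := sup_adherent e0 hL.
have nL : ~ L (sup L + e / 2).
  by move=> /(ub_le_sup hL.2); rewrite gerDl => /(lt_le_trans (divr_gt0 e0 (ltr0n R 2))); rewrite ltxx.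
have [//|h] := in_ultra_setVsetC (fun n => sup L + e / 2 <= f n) UU.
apply: filterS2 Lx h => n /= h1 /negP; rewrite -ltNge => h2.
by rewrite ltr_norml; apply/andP; split; lra.
Qed.

Section StandardPart.
Variable R : realType.
Local Notation C := R[i].
Local Open Scope complex_scope.

Lemma ulim_complex (f : nat -> C) (M : R) :
  U (fun n => `|f n| <= M%:C) -> exists c, ulim f c.
Proof.
move=> fM.
have reM (x : C) : `|complex.Re x|%:C <= `|x|.
  by rewrite normc_def lecR -sqrtr_sqr ler_wsqrtr // lerDl sqr_ge0.
have imM (x : C) : `|complex.Im x|%:C <= `|x|.
  by rewrite normc_def lecR -sqrtr_sqr ler_wsqrtr // lerDr sqr_ge0.
have [a ha] : exists a, ulim (fun n => complex.Re (f n)) a.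
  by apply: (@ulim_bounded _ _ M); apply: filterS fM => n /=; rewrite -lecR; apply: le_trans.
have [b hb] : exists b, ulim (fun n => complex.Im (f n)) b.
  by apply: (@ulim_bounded _ _ M); apply: filterS fM => n /=; rewrite -lecR; apply: le_trans.
have limR (g : nat -> R) c : ulim g c -> ulim (fun n => (g n)%:C) c%:C.
  move=> gc _ /pos_complex[e e0 ->]; apply: filterS (gc _ e0) => n /= h.
  by rewrite -rmorphB normc_def /= expr0n /= addr0 ltcR sqrtr_sqr.
exists (a%:C + 'i%C * b%:C).
apply: ulim_eq (ulimD (limR _ _ ha) (ulimM (ulim_cst _) (limR _ _ hb))).
by apply: filterE => n; rewrite -complexE.
Qed.

Local Notation F := (ultrapower UU C).

Definition ufinite (x : F) := exists c, ulim (rep x) c.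
(** Germs without a limit receive the default value 0. *)
Definition ust (x : F) : C := xget 0 (ulim (rep x)).

Lemma ufinite_germ f c : ulim f c -> ufinite (germ UU f) /\ ust (germ UU f) = c.
Proof.
move=> fc; have h : ulim (rep (germ UU f)) c.
  by apply: ulim_eq fc; apply: filterS (rep_germ UU f) => n /= ->.
split; first by exists c.
exact: ulim_unique (xgetPex 0 (ex_intro _ c h)) h.
Qed.

Lemma ufiniteP x : ufinite x -> exists2 f, x = germ UU f & ulim f (ust x).
Proof.
by move=> [c hc]; exists (rep x); rewrite ?repK //; apply: xgetPex; exists c.
Qed.

Fact ufinite_cst c : ufinite (const_germ UU c).
Proof. by have [] := ufinite_germ (ulim_cst c). Qed.
Fact ust_cst c : ust (const_germ UU c) = c.
Proof. by have [] := ufinite_germ (ulim_cst c). Qed.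

Fact ufiniteD_st x y : ufinite x -> ufinite y ->
  ufinite (x + y) /\ ust (x + y) = ust x + ust y.
Proof.
move=> /ufiniteP[f ef fc] /ufiniteP[g eg gd]; rewrite {1 2}ef {1 2}eg germD.
by apply: ufinite_germ; apply: ulimD.
Qed.

Fact ufiniteM_st x y : ufinite x -> ufinite y ->
  ufinite (x * y) /\ ust (x * y) = ust x * ust y.
Proof.
move=> /ufiniteP[f ef fc] /ufiniteP[g eg gd]; rewrite {1 2}ef {1 2}eg germM.
by apply: ufinite_germ; apply: ulimM.
Qed.

(** If no bound holds for |f| on a large set, then for every e > 0 the ultrafilter makes |f| exceed
    e^-1 on a large set, so the inverse tends to 0. *)
Fact ufinite_or_inv x : ufinite x \/ ufinite x^-1 /\ ust x^-1 = 0.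
Proof.
have [f ->] := germP x; pose r n := complex.Re `|f n|.
have rE n : `|f n| = (r n)%:C by rewrite /r normc_def.
have [[M hM]|noM] := pselect (exists M, U (fun n => r n <= M)).
  left; have [c fc] : exists c, ulim f c.
    by apply: (@ulim_complex f M); apply: filterS hM => n; rewrite /= rE lecR.
  by have [] := ufinite_germ fc.
right; rewrite germV; apply: ufinite_germ => _ /pos_complex[e e0 ->].
have [h|] := in_ultra_setVsetC (fun n => r n <= e^-1) UU; first by case: noM; exists e^-1.
apply: filterS => n /= /negP; rewrite -ltNge => h.
have r0 : 0 < r n by apply: lt_trans h; rewrite invr_gt0.
rewrite subr0 normfV rE -fmorphV ltcR.
by rewrite -[ltRHS]invrK ltf_pV2 // posrE ?invr_gt0.
Qed.

Definition ultraplace : place F C :=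
  @Place F C ufinite ust (@const_germ U UU C) ufinite_cst ust_cst
    (fun x y hx hy => (ufiniteD_st hx hy).1) (fun x y hx hy => (ufiniteM_st hx hy).1)
    (fun x y hx hy => (ufiniteD_st hx hy).2) (fun x y hx hy => (ufiniteM_st hx hy).2)
    ufinite_or_inv.

End StandardPart.
End UltraLimit.

Lemma eqmx_unit (K : fieldType) p N (A : 'M[K]_p) (H : 'M[K]_(p, N)) :
  A \in unitmx -> (A *m H :=: H)%MS.
Proof. by move=> uA; apply: eqmxMfull; rewrite row_full_unit. Qed.

(** * Minors and reduced echelon forms *)

Section Minors.
Variable K : fieldType.

Lemma det_replace_col p (M : 'M[K]_p) i :
  (forall k l, l != i -> M k l = (k == l)%:R) -> \det M = M i i.
Proof.
move=> hM; rewrite (expand_det_row M i) (bigD1 i) //= big1 ?addr0; last first.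
  by move=> l li; rewrite hM // eq_sym (negPf li) mul0r.
rewrite /cofactor addnn -signr_odd odd_double mul1r.
suff -> : row' i (col' i M) = 1%:M by rewrite det1 mulr1.
by apply/matrixP=> k l; rewrite !mxE hM ?neq_lift ?(inj_eq (@lift_inj _ i)) // eq_sym neq_lift.
Qed.

Definition redirect p N (f : 'I_p -> 'I_N) i q : {ffun 'I_p -> 'I_N} :=
  [ffun j => if j == i then q else f j].

(** Cramer's rule: entries of a matrix normalized on the columns [f] are quotients of maximal
    minors, so that a choice of an extremal minor controls all entries at once. *)
Lemma det_exchange p N (A : 'M[K]_(p, N)) f i q :
  colsub f A = 1%:M -> \det (colsub (redirect f i q) A) = A i q.
Proof.
move=> /matrixP hf; rewrite (det_replace_col (i := i)) => [|k l li].
  by rewrite mxE ffunE eqxx.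
by rewrite mxE ffunE (negPf li); have := hf k l; rewrite !mxE.
Qed.

Lemma row_free_minor p N (A : 'M[K]_(p, N)) : row_free A ->
  exists f : {ffun 'I_p -> 'I_N}, \det (colsub f A) != 0.
Proof.
move=> rA; have rA' : row_full A^T by rewrite /row_full mxrank_tr.
exists (fullrankfun rA'); rewrite -unitfE -unitmxE -unitmx_tr trmx_mxsub.
exact: fullrowsub_unit.
Qed.

(* Among the column sets with nonzero minor the one maximizing the weighted sum
   is the set of last nonzero columns, in increasing order. *)
Lemma echelon p N (A : 'M[K]_(p, N)) : row_free A ->
  exists B (d : 'I_p -> 'I_N),
  [/\ B \in unitmx, {homo d : i j / (i < j)%N}, colsub d (B *m A) = 1%:M &
     forall i (q : 'I_N), (d i < q)%N -> (B *m A) i q = 0].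
Proof.
move=> rA; have [f0 hf0] := row_free_minor rA.
pose P f := \det (colsub (f : {ffun 'I_p -> 'I_N}) A) != 0.
case: (@arg_maxnP _ f0 P (fun f => \sum_(i < p) f i * i.+1)%N hf0) => d hd dmax.
have ud : colsub d A \in unitmx by rewrite unitmxE unitfE.
have dB : colsub d (invmx (colsub d A) *m A) = 1%:M by rewrite -mulmx_colsub mulVmx.
exists (invmx (colsub d A)), d; split; rewrite ?unitmx_inv //.
- move=> i j ij; rewrite ltnNge leq_eqVlt; apply/negP => /orP[/eqP/val_inj eij|lij].
    have := hd; rewrite /P -det_tr (determinant_alternate (i1 := i) (i2 := j)) ?eqxx //.
      by rewrite neq_ltn ij.
    by move=> l; rewrite !mxE eij.
  (* Rearrangement: the weights i.+1 increase, so exchanging two columns that stand in decreasing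
     order raises the weighted sum, while the minor only changes sign. *)
  pose d' := [ffun l => d (tperm i j l)].
  have Pd' : P d'.
    rewrite /P (_ : colsub d' A = xcol i j (colsub d A)).
      by rewrite xcolE det_mulmx mulf_neq0 // det_perm signr_eq0.
    by apply/matrixP=> k l; rewrite !mxE ffunE.
  have := dmax _ Pd'; rewrite /= leqNgt => /negP; apply.
  have ji : j != i by rewrite neq_ltn ij orbT.
  rewrite (bigD1 i) //= (bigD1 j) //= [ltnRHS](bigD1 i) //= [X in (_ < _ + X)%N](bigD1 j) //=.
  have -> : d' i = d j by rewrite ffunE tpermL.
  have -> : d' j = d i by rewrite ffunE tpermR.
  rewrite !addnA [X in (_ < _ + X)%N](eq_bigr (fun l : 'I_p => d l * l.+1)%N).
    rewrite ltn_add2r; move: lij ij; move: (nat_of_ord (d i)) (nat_of_ord (d j)).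
    move: (nat_of_ord i) (nat_of_ord j) => a b x y yx ab.
    have [u ->] : exists u, x = (y + u.+1)%N by exists (x - y).-1; lia.
    have [v ->] : exists v, b = (a + v.+1)%N by exists (b - a).-1; lia.
    nia.
  by move=> l /andP[li lj]; rewrite ffunE tpermD // eq_sym.
- move=> i q diq; apply/eqP; apply/negPn/negP => h.
  (* A nonzero entry beyond the pivot would allow replacing [d i] by the larger column [q], again
     raising the sum. *)
  have Pd' : P (redirect d i q).
    rewrite /P -(det_exchange i q dB) -mulmx_colsub det_mulmx mulf_eq0 negb_or in h.
    by rewrite /P; case/andP: h.
  have := dmax _ Pd'; rewrite /= leqNgt => /negP; apply.
  rewrite (bigD1 i) //= [ltnRHS](bigD1 i) //= ffunE eqxx.
  rewrite [X in (_ < _ + X)%N](eq_bigr (fun l : 'I_p => d l * l.+1)%N) ?ltn_add2r ?ltn_mul2r //.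
  by move=> l li; rewrite ffunE (negPf li).
Qed.

End Minors.

(** * Linear algebra over the valuation ring of a place *)

Section PlaceTheory.
Variables (F K : fieldType) (P : place F K).
Local Notation fin := (finite P).
Local Notation std := (st P).
Local Notation inj := (cst P).

Lemma finite0 : fin 0. Proof. by rewrite -(rmorph0 inj); apply: finite_cst. Qed.
Lemma finite1 : fin 1. Proof. by rewrite -(rmorph1 inj); apply: finite_cst. Qed.
Lemma st0 : std 0 = 0. Proof. by rewrite -(rmorph0 inj) st_cst. Qed.
Lemma st1 : std 1 = 1. Proof. by rewrite -(rmorph1 inj) st_cst. Qed.

Lemma finiteN x : fin x -> fin (- x).
Proof. by move=> fx; rewrite -mulN1r -(rmorph1 inj) -rmorphN; apply/finiteM/fx/finite_cst. Qed.
Lemma stN x : fin x -> std (- x) = - std x.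
Proof.
move=> fx; rewrite -mulN1r -(rmorph1 inj) -rmorphN stM ?st_cst ?mulN1r //.
exact: finite_cst.
Qed.
Lemma finiteB x y : fin x -> fin y -> fin (x - y).
Proof. by move=> fx fy; apply/finiteD/finiteN. Qed.
Lemma finite_st_sum I (r : seq I) (p : pred I) (f : I -> F) :
  (forall i, p i -> fin (f i)) ->
  fin (\sum_(i <- r | p i) f i) /\
  std (\sum_(i <- r | p i) f i) = \sum_(i <- r | p i) std (f i).
Proof.
move=> hf; elim: r => [|i r [IH1 IH2]]; first by rewrite !big_nil; split; [exact: finite0|exact: st0].
rewrite !big_cons; case: ifP => // pi; split; first exact/finiteD/IH1/hf.
by rewrite stD // ?IH2 //; apply: hf.
Qed.

Lemma finite_sum I (r : seq I) (p : pred I) (f : I -> F) :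
  (forall i, p i -> fin (f i)) -> fin (\sum_(i <- r | p i) f i).
Proof. by move=> /(finite_st_sum r)[]. Qed.

Lemma st_sum I (r : seq I) (p : pred I) (f : I -> F) :
  (forall i, p i -> fin (f i)) ->
  std (\sum_(i <- r | p i) f i) = \sum_(i <- r | p i) std (f i).
Proof. by move=> /(finite_st_sum r)[]. Qed.

Lemma finite_st_prod I (r : seq I) (p : pred I) (f : I -> F) :
  (forall i, p i -> fin (f i)) ->
  fin (\prod_(i <- r | p i) f i) /\
  std (\prod_(i <- r | p i) f i) = \prod_(i <- r | p i) std (f i).
Proof.
move=> hf; elim: r => [|i r [IH1 IH2]]; first by rewrite !big_nil; split; [exact: finite1|exact: st1].
rewrite !big_cons; case: ifP => // pi; split; first exact/finiteM/IH1/hf.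
by rewrite stM // ?IH2 //; apply: hf.
Qed.

Lemma finiteX x n : fin x -> fin (x ^+ n).
Proof. by move=> fx; elim: n => [|n IH]; rewrite ?exprS; [exact: finite1|exact: finiteM]. Qed.
Lemma stX x n : fin x -> std (x ^+ n) = std x ^+ n.
Proof.
by move=> fx; elim: n => [|n IH]; rewrite ?st1 ?exprS // stM ?IH //; apply: finiteX.
Qed.

Lemma finiteV x : fin x -> std x != 0 -> fin x^-1.
Proof.
move=> fx sx; have [//|[]] := finite_or_inv P x^-1; rewrite invrK => _ s0.
by rewrite s0 eqxx in sx.
Qed.

Lemma st_neq0 x : std x != 0 -> x != 0.
Proof. by apply: contraNneq => ->; rewrite st0. Qed.

(** Of two elements one is always a finite multiple of the other, so a finite family has a dominant
    member. Dividing by it makes the family finite with one entry equal to 1, hence with nonzero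
    standard part. *)
Lemma max_finite (I : finType) (x : I -> F) i0 : x i0 != 0 ->
  exists2 i, x i != 0 & forall j, fin (x j / x i).
Proof.
move=> hi0; suff /(_ (enum I)) [i xi hi] : forall r : seq I,
    exists2 i, x i != 0 & forall j, j \in r -> fin (x j / x i).
  by exists i => // j; apply: hi; rewrite mem_enum.
elim=> [|k r [i xi hi]]; first by exists i0.
have [fk|[fk _]] := finite_or_inv P (x k / x i).
  by exists i => // j; rewrite inE => /orP[/eqP->|/hi].
have [xk0|xk] := eqVneq (x k) 0.
  exists i => // j; rewrite inE => /orP[/eqP->|/hi//].
  by rewrite xk0 mul0r; apply: finite0.
exists k => // j; rewrite inE => /orP[/eqP->|/hi h]; first by rewrite mulfV //; apply: finite1.
suff -> : x j / x k = (x j / x i) * (x k / x i)^-1 by apply: finiteM.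
by rewrite invf_div mulrA mulfVK.
Qed.

Definition finmx a b (A : 'M[F]_(a, b)) := forall i j, fin (A i j).
Definition stmx a b (A : 'M[F]_(a, b)) := map_mx std A.

Lemma finmxM a b c (A : 'M_(a, b)) (B : 'M_(b, c)) :
  finmx A -> finmx B -> finmx (A *m B).
Proof. by move=> fA fB i j; rewrite mxE; apply: finite_sum => k _; apply: finiteM. Qed.
Lemma stmxM a b c (A : 'M_(a, b)) (B : 'M_(b, c)) :
  finmx A -> finmx B -> stmx (A *m B) = stmx A *m stmx B.
Proof.
move=> fA fB; apply/matrixP=> i j; rewrite !mxE st_sum => [|k _]; last exact: finiteM.
by apply: eq_bigr => k _; rewrite !mxE stM.
Qed.
Lemma finmx_cst a b (A : 'M[K]_(a, b)) : finmx (map_mx inj A).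
Proof. by move=> i j; rewrite mxE; apply: finite_cst. Qed.
Lemma stmx_cst a b (A : 'M[K]_(a, b)) : stmx (map_mx inj A) = A.
Proof. by apply/matrixP=> i j; rewrite !mxE st_cst. Qed.
Lemma stmx0 a b : stmx (0 : 'M_(a, b)) = 0.
Proof. by apply/matrixP=> i j; rewrite !mxE st0. Qed.
Lemma stmx1 a : stmx (1%:M : 'M_a) = 1%:M.
Proof. by rewrite -(map_mx1 inj) stmx_cst. Qed.
Lemma finmx_colsub a b c (f : 'I_c -> 'I_b) (A : 'M_(a, b)) : finmx A -> finmx (colsub f A).
Proof. by move=> fA i j; rewrite mxE. Qed.
Lemma stmx_colsub a b c (f : 'I_c -> 'I_b) (A : 'M_(a, b)) :
  stmx (colsub f A) = colsub f (stmx A).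
Proof. by apply/matrixP=> i j; rewrite !mxE. Qed.

Lemma finite_st_det n (A : 'M_n) : finmx A -> fin (\det A) /\ std (\det A) = \det (stmx A).
Proof.
move=> fA; have fp (s : 'S_n) := finite_st_prod (index_enum 'I_n) (p := xpredT)
  (f := fun i => A i (s i)) (fun i _ => fA i _).
have fs (b : bool) : fin ((-1) ^+ b) by apply/finiteX/finiteN/finite1.
split; first by apply: finite_sum => s _; apply/finiteM/(fp s).1/fs.
rewrite st_sum => [|s _]; last exact/finiteM/(fp s).1/fs.
apply: eq_bigr => s _; rewrite (stM (fs s) (fp s).1) (fp s).2.
have h1 := finite1; have h2 := finiteN h1.
rewrite stX // stN // st1; congr (_ * _).
by apply: eq_bigr => i _; rewrite mxE.
Qed.

Lemma stmx_unit n (A : 'M_n) : finmx A -> stmx A \in unitmx -> A \in unitmx.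
Proof.
by move=> fA; rewrite !unitmxE !unitfE -(finite_st_det fA).2; apply: st_neq0.
Qed.

Lemma finmx_inv n (A : 'M_n) : finmx A -> stmx A \in unitmx ->
  finmx (invmx A) /\ stmx (invmx A) = invmx (stmx A).
Proof.
move=> fA uA; have uA' := stmx_unit fA uA.
have fV : finmx (invmx A).
  move=> i j; rewrite /invmx uA' mxE.
  apply: finiteM; last first.
    rewrite mxE; apply: finiteM; first exact/finiteX/finiteN/finite1.
    by apply: (finite_st_det _).1 => k l; rewrite !mxE.
  have [fd sd] := finite_st_det fA; apply: finiteV => //.
  by rewrite sd; move: uA; rewrite unitmxE unitfE.
split=> //; apply: (row_free_inj (A := stmx A)); first by rewrite row_free_unit.
by rewrite /= -stmxM // !mulVmx // stmx1.
Qed.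

(** Normalizing on the columns of a dominant minor makes each entry a quotient of a minor by the
    dominant one, hence finite; the identity block survives in the standard part and keeps its rank.
    This is properness of the Grassmannian. *)
Lemma finite_basis p N (A : 'M[F]_(p, N)) : row_free A ->
  exists2 B, B \in unitmx & finmx (B *m A) /\ row_free (stmx (B *m A)).
Proof.
move=> /row_free_minor[f0 hf0].
have [d hd dmax] := max_finite (x := fun f : {ffun _} => \det (colsub f A)) hf0.
have ud : colsub d A \in unitmx by rewrite unitmxE unitfE.
have dB : colsub d (invmx (colsub d A) *m A) = 1%:M by rewrite -mulmx_colsub mulVmx.
exists (invmx (colsub d A)); rewrite ?unitmx_inv //; split.
  move=> i q; rewrite -(det_exchange i q dB) -mulmx_colsub det_mulmx.
  by rewrite det_inv mulrC; apply: dmax.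
apply: inj_row_free => v hv.
by rewrite -(mulmx1 v) -stmx1 -dB stmx_colsub mulmx_colsub hv; apply/matrixP=> i j; rewrite !mxE.
Qed.

Lemma stmx_row_free p N (A : 'M[F]_(p, N)) : finmx A -> row_free (stmx A) -> row_free A.
Proof.
move=> fA /row_freeP[B hB]; have : row_free (A *m map_mx inj B).
  rewrite row_free_unit; apply: stmx_unit; first exact/finmxM/finmx_cst.
  by rewrite stmxM // ?stmx_cst ?hB ?unitmx1 //; apply: finmx_cst.
move=> /row_freeP[C]; rewrite -mulmxA => hC; apply/row_freeP; exists (map_mx inj B *m C) => //.
Qed.

(** A right inverse of the standard part, lifted by [cst], makes [A] into a square matrix invertible
    over the valuation ring, through which [x] is recovered. *)
Lemma finite_coef p N c (A : 'M[F]_(p, N)) (x : 'M_(c, p)) :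
  finmx A -> row_free (stmx A) -> finmx (x *m A) -> finmx x.
Proof.
move=> fA /row_freeP[B hB] fx.
have fB := @finmx_cst _ _ B.
have sAB : stmx (A *m map_mx inj B) \in unitmx by rewrite stmxM // stmx_cst hB unitmx1.
have [fV _] := finmx_inv (finmxM fA fB) sAB.
have uAB := stmx_unit (finmxM fA fB) sAB.
have -> : x = x *m A *m map_mx inj B *m invmx (A *m map_mx inj B).
  by rewrite -(mulmxA x) mulmxK.
by do 2!apply: finmxM => //.
Qed.

(** The limit [T] is the standard part of a finite basis of [S]: finite vectors of [S] have finite
    coefficients in it by [finite_coef]. The format of [T] records that the dimension is kept. *)
Lemma limit_subspace a N (S : 'M[F]_(a, N)) : exists T : 'M[K]_(\rank S, N),
  row_free T /\ forall b (A : 'M_(b, N)), finmx A -> (A <= S)%MS -> (stmx A <= T)%MS.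
Proof.
have [B uB [fB rB]] := finite_basis (row_base_free S).
exists (stmx (B *m row_base S)); split=> // b A fA AS.
have /submxP[x Ax] : (A <= B *m row_base S)%MS.
  by rewrite eqmxMfull ?row_full_unit // eq_row_base.
have fx : finmx x by apply: (finite_coef fB rB); rewrite -Ax.
by rewrite Ax stmxM // submxMl.
Qed.

Lemma stmx_rank a b (A : 'M[F]_(a, b)) : finmx A -> (\rank (stmx A) <= \rank A)%N.
Proof.
move=> fA; have [T [fT hT]] := limit_subspace A.
by apply: leq_trans (mxrankS (hT _ _ fA (submx_refl _))) (rank_leq_row _).
Qed.

End PlaceTheory.

(** * Incidence with coordinate flags *)

Section CoordinateFlag.
Variables (K : fieldType) (p N : nat).

Lemma sub_pid_mxP a c (V : 'M[K]_(a, N)) :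
  reflect (forall i (q : 'I_N), (c <= q)%N -> V i q = 0) (V <= (pid_mx c : 'M_N))%MS.
Proof.
have Vpid i q : (V *m (pid_mx c : 'M_N)) i q = V i q *+ (q < c)%N.
  rewrite mxE (bigD1 q) //= big1 ?addr0 => [|k kq]; rewrite mxE.
    by rewrite eqxx mulr_natr.
  by rewrite val_eqE (negPf kq) mulr0.
apply: (iffP idP) => [/submxP[x ->] i q cq|h].
  rewrite mxE big1 // => k _; rewrite !mxE.
  by case: eqP => [->|_]; rewrite ?ltnNge ?cq /= mulr0.
suff -> : V = V *m pid_mx c by apply: submxMl.
apply/matrixP=> i q; rewrite Vpid; case: ltnP => // /h -> //.
Qed.

(** A rank bound becomes the existence of a matrix subject to equations, a form that passes to the
    ultrapower by choosing witnesses termwise. *)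
Lemma cap_rank_witness a (H : 'M[K]_(p, N)) (V : 'M[K]_(a, N)) j : row_free H ->
  (j <= \rank (H :&: V))%N <-> exists y : 'M[K]_(j, p), row_free y /\ (y *m H <= V)%MS.
Proof.
move=> fH; split=> [jr|[y [fy yHV]]].
  pose S := pid_mx j *m row_base (H :&: V)%MS : 'M_(j, N).
  have SHV : (S <= H :&: V)%MS by rewrite (submx_trans (submxMl _ _)) ?eq_row_base.
  have fS : \rank S = j by rewrite mxrankMfree ?row_base_free // rank_pid_mx.
  move: SHV; rewrite sub_capmx => /andP[/submxP[y Sy] SV].
  exists y; rewrite -Sy; split=> //.
  by rewrite /row_free eqn_leq rank_leq_row -{1}fS Sy mxrankM_maxl.
rewrite -[leqLHS](eqP fy) -(mxrankMfree _ fH); apply: mxrankS.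
by rewrite sub_capmx submxMl.
Qed.

Variables (d : 'I_p -> 'I_N) (H : 'M[K]_(p, N)).
Hypothesis dH : colsub d H = 1%:M.

Lemma colsub1_row_free : row_free H.
Proof.
apply: inj_row_free => v hv.
by rewrite -(mulmx1 v) -dH mulmx_colsub hv; apply/matrixP=> i j; rewrite !mxE.
Qed.

Lemma colsub1E i j : H i (d j) = (i == j)%:R.
Proof. by have /matrixP/(_ i j) := dH; rewrite !mxE. Qed.

Lemma colsub1_coef a (y : 'M[K]_(a, p)) k i : (y *m H) k (d i) = y k i.
Proof.
have /matrixP/(_ k i) : colsub d (y *m H) = y by rewrite -mulmx_colsub dH mulmx1.
by rewrite mxE.
Qed.

Section Condition.
Variable c : nat.
Let I := [set i | d i < c]%N.
Let E : 'M[K]_(#|I|, p) := \matrix_(k, i) (i == enum_val k)%:R.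

Let E_cover a (y : 'M[K]_(a, p)) :
  (forall k i, (c <= d i)%N -> y k i = 0) -> (y <= E)%MS.
Proof.
move=> h; suff -> : y = colsub (@enum_val _ (mem I)) y *m E by apply: submxMl.
apply/matrixP=> k i; rewrite mxE.
have [iI|iI] := boolP (i \in I).
  rewrite (bigD1 (enum_rank_in iI i)) //= big1 ?addr0 => [|l li].
    by rewrite !mxE enum_rankK_in // eqxx mulr1.
  rewrite !mxE; case: eqP => [e|_]; rewrite ?mulr0 //.
  by case/eqP: li; apply: enum_val_inj; rewrite enum_rankK_in.
rewrite big1 => [|l _]; first by apply: h; move: iI; rewrite inE -leqNgt.
rewrite !mxE; case: eqP => [e|_]; rewrite ?mulr0 //.
by case/negP: iI; rewrite e enum_valP.
Qed.

Lemma pid_coef0 a (y : 'M[K]_(a, p)) : (y *m H <= (pid_mx c : 'M_N))%MS ->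
  forall k i, (c <= d i)%N -> y k i = 0.
Proof. by move=> /sub_pid_mxP h k i ci; rewrite -colsub1_coef h. Qed.

Let E_free : row_free E.
Proof.
apply: inj_row_free => v /matrixP hv; apply/matrixP=> i k; rewrite mxE.
have := hv i (enum_val k); rewrite !mxE (bigD1 k) //= big1 ?addr0 => [|l li].
  by rewrite mxE eqxx mulr1.
by rewrite mxE (inj_eq enum_val_inj) eq_sym (negPf li) mulr0.
Qed.

Lemma pid_cap_rank : (\rank (H :&: (pid_mx c : 'M_N))%MS <= #|I|)%N.
Proof.
have [y [fy yH]] := (cap_rank_witness (pid_mx c : 'M_N) _ colsub1_row_free).1 (leqnn _).
rewrite -{1}(eqP fy); apply: leq_trans (mxrankS (E_cover (pid_coef0 yH))) _.
exact: rank_leq_row.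
Qed.

Lemma pid_cap_cover j (y : 'M[K]_(j, p)) i : row_free y ->
  (y *m H <= (pid_mx c : 'M_N))%MS -> (#|I| <= j)%N -> (d i < c)%N ->
  ((delta_mx 0 i : 'rV_p) <= y)%MS.
Proof.
move=> fy yH Ij di; have yE := E_cover (pid_coef0 yH).
have : (y == E)%MS.
  have [_ <-] := mxrank_leqif_eq yE; rewrite (eqP E_free) (eqP fy) eqn_leq Ij andbT.
  by rewrite -[leqLHS](eqP fy) (leq_trans (mxrankS yE)) ?rank_leq_row.
move=> /eqmxP ->; apply: E_cover => k l cl; rewrite mxE.
by have [e|] := eqVneq l i; rewrite ?andbF //; move: di; rewrite -e ltnNge cl.
Qed.

(** Coefficients are read in the pivot columns, so vectors of the intersection only involve rows of
    [I]. In dimension #|I| all of these rows are reached, and each lies in the coordinate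
    subspace. *)
Lemma pid_cap_vanish j : (#|I| <= j)%N -> (j <= \rank (H :&: (pid_mx c : 'M_N)))%N ->
  forall i (q : 'I_N), (d i < c)%N -> (c <= q)%N -> H i q = 0.
Proof.
move=> Ij /(cap_rank_witness (pid_mx c : 'M_N) _ colsub1_row_free)[y [fy yH]] i q di cq.
have /submxP[z ez] := pid_cap_cover fy yH Ij di.
have : (row i H <= (pid_mx c : 'M_N))%MS.
  by rewrite rowE ez -mulmxA (submx_trans (submxMl _ _)).
by move=> /sub_pid_mxP/(_ 0 q cq); rewrite mxE.
Qed.

Lemma pid_cap_rank_ge : (forall i (q : 'I_N), (d i < c)%N -> (c <= q)%N -> H i q = 0) ->
  (#|I| <= \rank (H :&: (pid_mx c : 'M_N)))%N.
Proof.
move=> h; apply/(cap_rank_witness (pid_mx c : 'M_N) _ colsub1_row_free).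
exists E; split; first exact: E_free.
apply/sub_pid_mxP=> k q cq; rewrite mxE big1 // => i _.
rewrite mxE; case: eqP => [->|_]; last by rewrite mul0r.
by rewrite mul1r h //; have := enum_valP k; rewrite inE.
Qed.

(** Linearized [pid_cap_vanish]. Since [D] vanishes in the pivot columns, those from [c] on show
    that the correction by [H'] uses only rows with pivot below [c], and these rows vanish from
    column [c] on. *)
Lemma pid_tangent_vanish j (y : 'M[K]_(j, p)) (D : 'M[K]_(p, N)) :
  row_free y -> (y *m H <= (pid_mx c : 'M_N))%MS -> (#|I| <= j)%N ->
  (forall i (q : 'I_N), (d i < c)%N -> (c <= q)%N -> H i q = 0) ->
  forall H' : 'M[K]_(p, N), colsub d H' = 1%:M ->
  (forall i (q : 'I_N), (d i < c)%N -> (c <= q)%N -> H' i q = 0) ->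
  colsub d D = 0 -> (y *m D <= (pid_mx c : 'M_N) + H')%MS ->
  forall i (q : 'I_N), (d i < c)%N -> (c <= q)%N -> D i q = 0.
Proof.
move=> fy yH Ij hH H' dH' hH' dD yD i q di cq.
have /submxP[z ez] := pid_cap_cover fy yH Ij di.
have : (row i D <= (pid_mx c : 'M_N) + H')%MS.
  by rewrite rowE ez -mulmxA (submx_trans (submxMl _ _)).
move=> /sub_addsmxP[[u1 u2] /= e].
have /sub_pid_mxP k0 := submxMl u1 (pid_mx c : 'M[K]_N).
have dH'E l k : H' l (d k) = (l == k)%:R.
  by have /matrixP/(_ l k) := dH'; rewrite !mxE.
have u20 l : (c <= d l)%N -> u2 0 l = 0.
  move=> cl; have /matrixP/(_ 0 (d l)) := e; rewrite !mxE.
  have /matrixP/(_ i l) := dD; rewrite !mxE => ->.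
  have := k0 0 (d l) cl; rewrite mxE => ->; rewrite add0r.
  rewrite (bigD1 l) //= big1 ?addr0 => [|k kl]; rewrite dH'E ?eqxx ?mulr1 //.
  by rewrite (negPf kl) mulr0.
have /matrixP/(_ 0 q) := e; rewrite mxE => ->; rewrite mxE k0 // add0r mxE.
apply: big1 => l _; have [cl|lc] := leqP c (d l); first by rewrite u20 // mul0r.
by rewrite hH' // mulr0.
Qed.

End Condition.
End CoordinateFlag.

(** * Counting rows and columns in the strip between two partitions *)

Lemma sum_interval a b N : (\sum_(q < N) (a < q <= b) = minn N b.+1 - minn N a.+1)%N.
Proof.
elim: N => [|N IH]; first by rewrite big_ord0 !min0n.
by rewrite big_ord_recr /= IH; lia.
Qed.

Section Strips.
Variables (p N : nat) (d : 'I_p -> 'I_N) (c : 'I_p -> nat).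
Hypotheses (d_incr : {homo d : i j / (i < j)%N}).
Hypotheses (c_lt : forall j, (c j < N)%N) (d_le : forall j, (d j <= c j)%N).

(* In reduced echelon form with last columns d, the conditions of the Schubert
   variety with last columns c force the entry (i, q) to vanish unless it is
   allowed: condition j is attained with equality when j is tight. *)
Definition pivot : pred 'I_N := mem (codom d).
Definition tight (j : 'I_p) := [forall l : 'I_p, (j < l)%N ==> (c j < d l)%N].
Definition allowed (i : 'I_p) (q : 'I_N) :=
  (d i < q)%N && [forall j, tight j ==> (i <= j)%N ==> (q <= c j)%N].

Let excess := (\sum_j (c j - d j))%N.

Lemma pivot_leq (i j : 'I_p) : (i <= j)%N -> (d i <= d j)%N.
Proof. by rewrite leq_eqVlt => /orP[/eqP/val_inj->//|/d_incr/ltnW]. Qed.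

Lemma pivot_inj : injective d.
Proof.
move=> i j e; apply/val_inj/eqP; have [/d_incr|/d_incr|//] := ltngtP i j;
  by rewrite e ltnn.
Qed.

Lemma pivot_in i : d i \in pivot. Proof. exact: codom_f. Qed.

Lemma tight_card j : tight j -> #|[set i | d i < (c j).+1]%N| = j.+1.
Proof.
move=> /forallP tj; rewrite -(card_ord j.+1).
have -> : [set i | d i < (c j).+1]%N = [set widen_ord (ltn_ord j) i | i in 'I_j.+1].
  apply/setP=> i; rewrite inE; apply/idP/imsetP => [dic|[k _ ->]].
    have ij : (i < j.+1)%N.
      by rewrite ltnS leqNgt; apply/negP => ji; have /implyP/(_ ji) := tj i; rewrite ltnNge -ltnS dic.
    by exists (Ordinal ij) => //; apply: val_inj.
  rewrite ltnS (leq_trans _ (d_le j)) //; apply: pivot_leq.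
  by have := ltn_ord k; rewrite ltnS.
by rewrite card_imset // => x y /(congr1 val)/= /val_inj.
Qed.

Let T : {set 'I_p * 'I_N} := [set x : 'I_p * 'I_N | d x.1 < x.2 <= c x.1]%N.

Let card_T : #|T| = excess.
Proof.
transitivity (\sum_(j < p) \sum_(q < N) (d j < q <= c j))%N.
  by rewrite pair_bigA -sum1_card big_mkcond; apply: eq_bigr => x _; rewrite inE; case: ifP.
apply: eq_bigr => j _; rewrite sum_interval; have := c_lt j; have := d_le j; lia.
Qed.

Lemma last_below i (q : 'I_N) : (d i < q)%N -> q \notin pivot ->
  exists2 j : 'I_p, [/\ (i <= j)%N & (d j < q)%N] & forall l : 'I_p, (j < l)%N -> (q < d l)%N.
Proof.
move=> diq nq; case: (@arg_maxnP _ i (fun j => d j < q)%N val diq) => j hj jmax.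
exists j; first by split=> //; apply: (jmax i).
move=> l jl; rewrite ltn_neqAle; apply/andP; split.
  by apply: contraNneq nq => /val_inj->; apply: pivot_in.
by rewrite leqNgt; apply/negP => /jmax /=; rewrite leqNgt jl.
Qed.

(** The column is charged to the last row j whose pivot lies to its left. Were q beyond [c j], row j
    would be tight and would forbid the entry; so (j, q) is one of the [excess] many cells of
    [T]. *)
Let col_in_T q i : q \notin pivot -> allowed i q -> q \in snd @: T.
Proof.
move=> nq /andP[diq /forallP h]; have [j [ij djq] jl] := last_below diq nq.
apply/imsetP; exists (j, q) => //; rewrite inE /= djq leqNgt; apply/negP => cjq.
have tj : tight j by apply/forallP => l; apply/implyP => /jl; apply: ltn_trans.
by have := h j; rewrite tj ij leqNgt cjq.
Qed.

Lemma strip_cols : (#|[set q | (q \notin pivot) && [exists i, allowed i q]]| <= excess)%N.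
Proof.
rewrite -card_T; apply: leq_trans (leq_imset_card snd T).
set B := [set q | _]; suff /subset_leq_card : B \subset snd @: T by [].
by apply/fintype.subsetP=> q; rewrite inE => /andP[nq /existsP[i /col_in_T]]; apply.
Qed.

(** Equality forces the cells of [T] into distinct, nonpivot columns. A pivot [d l] <= [c j] with j
    < l would be the column of a cell, so every row is tight: the skew shape is a horizontal strip,
    and allowed entries are cells of [T]. *)
Lemma strip_col_unique :
  (excess <= #|[set q | (q \notin pivot) && [exists i, allowed i q]]|)%N ->
  forall i i' q, q \notin pivot -> allowed i q -> allowed i' q -> i = i'.
Proof.
set B := [set q | _] => hB.
have BT : B \subset snd @: T.
  by apply/fintype.subsetP=> q; rewrite inE => /andP[nq /existsP[i /col_in_T]]; apply.
have inj : {in T &, injective snd}.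
  apply/imset_injP; rewrite eqn_leq leq_imset_card card_T.
  exact: leq_trans hB (subset_leq_card BT).
have eBT : B = snd @: T.
  by apply/eqP; rewrite eqEcard BT (leq_trans (leq_imset_card _ _)) // card_T.
have all_tight j : tight j.
  apply/forallP => l; apply/implyP => jl; rewrite ltnNge; apply/negP => dlc.
  have : d l \in B by rewrite eBT; apply/imsetP; exists (j, d l) => //; rewrite inE /= dlc d_incr.
  by rewrite inE pivot_in.
have ST i q : allowed i q -> (i, q) \in T.
  by move=> /andP[diq /forallP/(_ i)]; rewrite all_tight leqnn inE /= diq.
by move=> i i' q _ /ST h /ST /(inj _ _ h) /(_ erefl) [].
Qed.

(** Otherwise row i would be tight with nothing permitted beyond its own pivot. *)
Let row_lt i q : allowed i q -> (d i < c i)%N.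
Proof.
move=> /andP[diq /forallP/(_ i)]; rewrite ltnNge => h; apply/negP => cid.
have : tight i by apply/forallP => l; apply/implyP => /d_incr; apply: leq_ltn_trans.
by move=> ti; move: h; rewrite ti leqnn /= leqNgt (leq_ltn_trans cid).
Qed.

Let rows_le : (#|[set i | [exists q, (q \notin pivot) && allowed i q]]|
  <= \sum_j (d j < c j))%N.
Proof.
rewrite -sum1_card big_mkcond /=; apply: leq_sum => i _; case: ifP => //.
by rewrite inE => /existsP[q /andP[_ /row_lt ->]].
Qed.

Lemma strip_rows :
  (#|[set i | [exists q, (q \notin pivot) && allowed i q]]| <= excess)%N.
Proof. by apply: leq_trans rows_le _; apply: leq_sum => i _; lia. Qed.

(** Equality forces [c j] <= [d j] + 1 in every row, a vertical strip. The last row l with pivot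
    left of an allowed nonpivot column q is then tight with [c l] <= q, so two such columns in one
    row bound each other. *)
Lemma strip_row_unique :
  (excess <= #|[set i | [exists q, (q \notin pivot) && allowed i q]]|)%N ->
  forall i q q', q \notin pivot -> q' \notin pivot ->
  allowed i q -> allowed i q' -> q = q'.
Proof.
move=> /leq_trans/(_ rows_le) hs.
have c_le j : (c j <= (d j).+1)%N.
  move: hs; rewrite /excess (bigD1 j) //= [X in (_ <= X)%N](bigD1 j) //=.
  have : (\sum_(i < p | i != j) (d i < c i) <= \sum_(i < p | i != j) (c i - d i))%N.
    by apply: leq_sum => k _; lia.
  move: (\sum_(i < p | i != j) (d i < c i))%N (\sum_(i < p | i != j) (c i - d i))%N => x y.
  by have := d_le j; case: (d j < c j)%N => /=; lia.
have key i q : q \notin pivot -> allowed i q ->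
    exists2 l : 'I_p, tight l & [/\ (i <= l)%N, (q : nat) = (d l).+1 & (c l <= q)%N].
  move=> nq /andP[diq /forallP h]; have [l [il dlq] ll] := last_below diq nq.
  have tl : tight l.
    apply/forallP => k; apply/implyP => /ll; apply: leq_ltn_trans.
    exact: leq_trans (c_le l) dlq.
  exists l => //; have := h l; rewrite tl il /= => qc; have := c_le l; split => //; lia.
move=> i q q' nq nq' a a'; apply: val_inj => /=.
have [l tl [il ql cl]] := key i q nq a; have [l' tl' [il' ql' cl']] := key i q' nq' a'.
have /andP[_ /forallP/(_ l')] := a; rewrite tl' il' /= => h.
have /andP[_ /forallP/(_ l)] := a'; rewrite tl il /= => h'.
have := c_le l; have := c_le l'; lia.
Qed.

End Strips.

Lemma position_card p N (d : 'I_p -> 'I_N) : {homo d : i j / (i < j)%N} ->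
  forall j : 'I_p, #|[set i | d i < (d j).+1]%N| = j.+1.
Proof.
move=> d_incr j; apply: (tight_card d_incr (fun _ => leqnn _)).
by apply/forallP => l; apply/implyP/d_incr.
Qed.

(** * Limits of echelon forms meeting osculating spaces *)

Section Core.
Variables (F K : fieldType) (P : place F K).
Local Notation fin := (finite P).
Local Notation std := (st P).
Variable s : F.
Hypotheses (s_fin : fin s) (s_st : std s = 0) (s_neq0 : s != 0).
(* W is a code with the MDS property, read after reduction at the place: kappa
   infinitesimal coordinates of a finite codeword make it infinitesimal. *)
Variables (I J : finType) (h : I + J -> nat) (kappa : nat).
Variable W : (I + J -> F) -> Prop.
Hypothesis W_lin : forall a b u v, W u -> W v -> W (fun k => a * u k + b * v k).
Hypothesis W_mds : forall u (B : {set I + J}), W u -> (forall k, fin (u k)) ->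
  (kappa <= #|B|)%N -> (forall k, k \in B -> std (u k) = 0) -> forall k, std (u k) = 0.
Implicit Types (x y : I -> J -> F) (u v r : I + J -> F).

(** The true coordinates are u k s^(h k), and those in [J] are combinations, by the echelon matrix
    [x], of those in [I]. For the lower condition [I] is the set of pivots and h the position; for
    the upper one the two parts trade places and the heights are reversed. *)
Definition incident x u := forall j, u (inr j) * s ^+ h (inr j) =
  \sum_i u (inl i) * s ^+ h (inl i) * x i j.

Let W_scale a u : W u -> W (fun k => a * u k).
Proof.
move=> Wu; have := W_lin a 0 Wu Wu; congr W; apply: funext => k.
by rewrite mul0r addr0.
Qed.

Lemma higher_terms (Q : pred I) n u z :
  (forall i, fin (u (inl i))) -> (forall i, fin (z i)) ->
  (forall i, Q i -> z i != 0 -> (n < h (inl i))%N) ->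
  exists2 t, \sum_(i | Q i) u (inl i) * s ^+ h (inl i) * z i = s ^+ n * t & fin t /\ std t = 0.
Proof.
move=> fu fz hz.
have ft i : fin (u (inl i) * s ^+ (h (inl i) - n) * z i).
  by apply: finiteM => //; apply: finiteM => //; apply: finiteX.
exists (\sum_(i | Q i) u (inl i) * s ^+ (h (inl i) - n) * z i).
  rewrite mulr_sumr; apply: eq_bigr => i Qi; have [->|/(hz i Qi) hi] := eqVneq (z i) 0.
    by rewrite !mulr0.
  by rewrite -{1}(subnKC (ltnW hi)) exprD; ring.
split; first by apply: finite_sum => i _.
rewrite st_sum // big1 // => i Qi; have [->|/(hz i Qi) hi] := eqVneq (z i) 0.
  by rewrite mulr0 st0.
rewrite stM // ?stM ?stX // ?s_st; try by apply: finiteM => //; apply: finiteX.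
  by rewrite expr0n subn_eq0 leqNgt hi mulr0 mul0r.
exact: finiteX.
Qed.

Definition shifted_cols (B : {set J}) x :=
  forall i j, j \in B -> x i j != 0 -> (h (inr j) < h (inl i))%N.

Lemma core_normalize u k0 x : W u -> incident x u -> u k0 != 0 ->
  exists a k, [/\ a != 0, W (fun k => a * u k), incident x (fun k => a * u k),
     forall k, fin (a * u k) & a * u k = 1].
Proof.
move=> Wu ux uk0; have [k uk hk] := max_finite P uk0.
exists (u k)^-1, k; rewrite invr_neq0 ?mulVf //; split=> //; first exact: W_scale.
  move=> j; rewrite -mulrA ux mulr_sumr; apply: eq_bigr => i _; ring.
by move=> l; rewrite mulrC.
Qed.

Lemma core_vanish B x u : (forall i j, fin (x i j)) -> shifted_cols B x ->
  incident x u -> (forall k, fin (u k)) -> forall j, j \in B -> std (u (inr j)) = 0.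
Proof.
move=> fx xB ux fu j jB; have := ux j.
have [t -> [ft t0]] := @higher_terms xpredT (h (inr j)) u (x^~ j) (fun i => fu _)
  (fun i => fx i j) (fun i _ => xB i j jB).
by rewrite mulrC => /(mulfI _)-> //; rewrite expf_neq0.
Qed.

(** Scale u to be finite with one coordinate 1. Its coordinates in [B] are infinitesimal, as every
    term of their expansion has a spare factor s; kappa of them would make all coordinates
    infinitesimal. *)
Lemma core_bound B x u k0 : (forall i j, fin (x i j)) -> shifted_cols B x ->
  W u -> incident x u -> u k0 != 0 -> (#|B| < kappa)%N.
Proof.
move=> fx xB Wu ux uk0; have [a [k [a0 Wau xau fau k1]]] := core_normalize Wu ux uk0.
rewrite ltnNge; apply/negP => kB.
have := W_mds (B := inr @: B) Wau fau _ _ k; rewrite k1 st1 card_imset; last by move=> ? ? [].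
move=> /(_ kB) h1; case/eqP: (oner_neq0 K); apply: h1 => _ /imsetP[j jB ->].
exact: (core_vanish fx xB xau).
Qed.

(* With one row i0 allowed below the height of the column j0, the coefficient at
   (i0, j0) of the secant or tangent direction y tends to 0. *)
Lemma core_direction B x x' y u u' r k0 k1 i0 j0 :
  (forall i j, fin (x i j)) -> (forall i j, fin (x' i j)) -> (forall i j, fin (y i j)) ->
  shifted_cols B x -> shifted_cols B x' -> shifted_cols B y ->
  (kappa <= #|B|.+1)%N ->
  W u -> incident x u -> u k0 != 0 -> W u' -> incident x' u' -> u' k1 != 0 ->
  W r -> (forall j, \sum_i u' (inl i) * s ^+ h (inl i) * y i j +
                    \sum_i r (inl i) * s ^+ h (inl i) * x i j = r (inr j) * s ^+ h (inr j)) ->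
  (h (inl i0) < h (inr j0))%N ->
  (forall i, i != i0 -> x i j0 != 0 -> (h (inr j0) < h (inl i))%N) ->
  (forall i, i != i0 -> y i j0 != 0 -> (h (inr j0) < h (inl i))%N) ->
  std (y i0 j0) = 0.
Proof.
move=> fx fx' fy xB x'B yB kB Wu ux uk0 Wu' ux' uk1 Wr rxy h0 xj0 yj0.
have cardB : (kappa <= #|inl i0 |: inr @: B|)%N.
  rewrite cardsU1 card_imset; last by move=> ? ? [].
  by case: imsetP => [[]|_] //; rewrite add1n.
(* Together with [B] the index [inl i0] makes up kappa positions, so a normalized codeword cannot be
   infinitesimal at [inl i0]. *)
have key z v k : (forall i j, fin (z i j)) -> shifted_cols B z -> W v -> incident z v ->
    (forall k, fin (v k)) -> v k = 1 -> std (v (inl i0)) != 0.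
  move=> fz zB Wv vz fv vk; apply/eqP => v0.
  have := W_mds Wv fv cardB _ k; rewrite vk st1 => h1.
  case/eqP: (oner_neq0 K); apply: h1 => l.
  rewrite !inE => /orP[/eqP->//|/imsetP[j jB ->]]; exact: (core_vanish fz zB vz).
have [a [k [a0 Wau xau fau k1E]]] := core_normalize Wu ux uk0.
have [a' [k' [a0' Wau' xau' fau' k1E']]] := core_normalize Wu' ux' uk1.
have su := key x _ k fx xB Wau xau fau k1E.
have su' := key x' _ k' fx' x'B Wau' xau' fau' k1E'.
set w := (fun k => a * u k) in Wau xau fau k1E su.
set w' := (fun k => a' * u' k) in Wau' xau' fau' k1E' su'.
(* Multiples of [w], incident to [x], may be added to the correction term without disturbing the
   relation; this one removes its coordinate at [inl i0]. *)
pose b := - (a' * r (inl i0) / w (inl i0)).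
pose R k := a' * r k + b * w k.
have WR : W R by apply: W_lin.
have Ri0 : R (inl i0) = 0.
  by rewrite /R /b mulNr divfK ?subrr //  (st_neq0 su).
have Rxy j : \sum_i w' (inl i) * s ^+ h (inl i) * y i j +
             \sum_i R (inl i) * s ^+ h (inl i) * x i j = R (inr j) * s ^+ h (inr j).
  rewrite /R mulrDl -mulrA -rxy -mulrA xau mulrDr !mulr_sumr -addrA; congr (_ + _).
    by apply: eq_bigr => i _; rewrite /w'; ring.
  by rewrite -big_split; apply: eq_bigr => i _ /=; ring.
(* If the dominant entry of [R] were infinite, division by it would suppress the term in [y]; the
   quotient would be a finite codeword, infinitesimal on [B] and at [inl i0], with an entry equal to
   1. *)
have fR o : fin (R o).
  have [[k2 Rk2]|R0] := pselect (exists k, R k != 0); last first.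
    have -> : R o = 0 by apply/eqP/negPn/negP => Rk; apply: R0; exists o.
    exact: finite0.
  have [l Rl hl] := max_finite P Rk2.
  have [fl|[fl sl]] := finite_or_inv P (R l).
    by rewrite -(divfK Rl (R o)); apply: finiteM.
  pose q k := (R l)^-1 * R k.
  have fq k3 : fin (q k3) by rewrite /q mulrC.
  have Wq : W q by apply: W_scale.
  have := W_mds Wq fq cardB _ l; rewrite /q mulVf // st1 => h1.
  case/eqP: (oner_neq0 K); apply: h1 => k3; rewrite !inE => /orP[/eqP->|/imsetP[j jB ->]].
    by rewrite Ri0 mulr0 st0.
  have [t1 e1 [ft1 t10]] := @higher_terms xpredT (h (inr j)) w' (y^~ j) (fun i => fau' _)
    (fun i => fy i j) (fun i _ => yB i j jB).
  have [t2 e2 [ft2 t20]] := @higher_terms xpredT (h (inr j)) q (x^~ j) (fun i => fq _)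
    (fun i => fx i j) (fun i _ => xB i j jB).
  have -> : (R l)^-1 * R (inr j) = (R l)^-1 * t1 + t2.
    apply: (mulfI (expf_neq0 (h (inr j)) s_neq0)).
    rewrite [RHS]mulrDr -e2 mulrCA [X in _ = X + _]mulrCA -e1 [s ^+ _ * R _]mulrC -Rxy mulrDr; congr (_ + _).
    by rewrite mulr_sumr; apply: eq_bigr => i _; rewrite /q; ring.
  by rewrite stD ?stM ?sl ?mul0r ?t20 ?addr0 //; apply: finiteM.
have := Rxy j0; rewrite (bigD1 i0) //= [X in _ + X = _](bigD1 i0) //= Ri0 !mul0r add0r.
have [t1 -> [ft1 t10]] := @higher_terms (fun i => i != i0) (h (inr j0)) w' (y^~ j0)
  (fun i => fau' _) (fun i => fy i j0) yj0.
have [t2 -> [ft2 t20]] := @higher_terms (fun i => i != i0) (h (inr j0)) R (x^~ j0)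
  (fun i => fR _) (fun i => fx i j0) xj0.
rewrite -(subnKC (ltnW h0)) exprD => e.
(* In column [j0] every other term carries at least the power h (inr j0) of s, which exceeds h (inl
   i0). *)
have e' : w' (inl i0) * y i0 j0 = s ^+ (h (inr j0) - h (inl i0)) * (R (inr j0) - t1 - t2).
  apply: (mulfI (expf_neq0 (h (inl i0)) s_neq0)).
  by rewrite !mulrBr [_ * (_ * R _)]mulrA [_ * R _]mulrC -e; ring.
have : std (w' (inl i0) * y i0 j0) = 0.
  rewrite e' stM; [|exact: finiteX|by apply: finiteB => //; apply: finiteB].
  by rewrite stX // s_st expr0n subn_eq0 leqNgt h0 mul0r.
by rewrite (stM (fau' _) (fy _ _)) => /eqP; rewrite mulf_eq0 (negPf su') => /eqP.
Qed.

End Core.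

(** * Reed-Solomon codes at integer points and their duals *)

Section Falling.
Variable K : fieldType.

Definition falling n : {poly K} := \prod_(l < n) ('X - l%:R%:P).

Lemma falling_horner n j : (falling n).[j%:R] = (j ^_ n)%:R.
Proof.
rewrite /falling; elim: n => [|n IH]; first by rewrite big_ord0 hornerC.
rewrite big_ord_recr hornerM IH !hornerE ffactnSr natrM.
have [nj|jn] := leqP n j; first by rewrite natrB.
by rewrite ffact_small // !mul0r.
Qed.

Lemma size_falling n : size (falling n) = n.+1.
Proof. by rewrite /falling size_prod_XsubC /index_enum -enumT size_enum_ord. Qed.

Lemma falling_monic n : falling n \is monic.
Proof. exact: monic_prod_XsubC. Qed.

(* The falling factorials come from the derivatives: the i-th derivative of s^q
   is (q ^_ i) s^(q-i). *)
Lemma falling_span (T : finType) (c x : T -> K) n :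
  (forall i, (i < n)%N -> \sum_k c k * (falling i).[x k] = 0) ->
  forall Q : {poly K}, (size Q <= n)%N -> \sum_k c k * Q.[x k] = 0.
Proof.
elim: n => [|n IH] h Q.
  by rewrite leqn0 size_poly_eq0 => /eqP->; apply: big1 => k _; rewrite horner0 mulr0.
move=> sQ; have /IH : forall i, (i < n)%N -> \sum_k c k * (falling i).[x k] = 0.
  by move=> i /ltnW; rewrite -ltnS; apply: h.
move=> /(_ (Q - Q`_n *: falling n)).
have sz : (size (Q - Q`_n *: falling n)%R <= n)%N.
  apply/leq_sizeP => j; rewrite coefB coefZ leq_eqVlt => /orP[/eqP<-|nj].
    have := falling_monic n; rewrite monicE lead_coefE size_falling => /eqP->.
    by rewrite mulr1 subrr.
  rewrite (nth_default _ (leq_trans sQ nj)) (nth_default 0 (s := falling n)) ?size_falling //.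
  by rewrite mulr0 subrr.
move=> /(_ sz) e.
have -> : \sum_k c k * Q.[x k] = \sum_k c k * (Q - Q`_n *: falling n).[x k] +
    Q`_n * \sum_k c k * (falling n).[x k].
  by rewrite mulr_sumr -big_split; apply: eq_bigr => k _ /=; rewrite hornerD hornerN hornerZ; ring.
by rewrite e h // mulr0 addr0.
Qed.

End Falling.

Section Codes.
Variables (F K : fieldType) (P : place F K).
Local Notation fin := (finite P).
Local Notation std := (st P).
Hypothesis natK : injective (fun n : nat => n%:R : K).
Variables (T : finType) (pos : T -> nat).
Hypothesis pos_inj : injective pos.

(** The Reed-Solomon code of dimension at most [kappa] with evaluation points [pos k]. *)
Definition eval_code kappa (u : T -> F) :=
  exists2 Q : {poly F}, (size Q <= kappa)%N & forall k, u k = Q.[(pos k)%:R].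

Lemma eval_code_lin kappa a b u v : eval_code kappa u -> eval_code kappa v ->
  eval_code kappa (fun k => a * u k + b * v k).
Proof.
move=> [Q sQ hQ] [Q' sQ' hQ']; exists (a *: Q + b *: Q').
  rewrite (leq_trans (size_polyD _ _)) // geq_max.
  by rewrite !(leq_trans (size_scale_leq _ _)).
by move=> k; rewrite !hornerE hQ hQ'.
Qed.

(** The Vandermonde matrix of the points of [B] has entries in K, so finite values on [B] force
    finite coefficients. The standard part of the polynomial then has kappa distinct roots and
    vanishes. *)
Lemma eval_code_mds kappa u (B : {set T}) : eval_code kappa u -> (forall k, fin (u k)) ->
  (kappa <= #|B|)%N -> (forall k, k \in B -> std (u k) = 0) -> forall k, std (u k) = 0.
Proof.
move=> [Q sQ hQ] fu kB u0 k.
pose x (k : T) : K := (pos k)%:R.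
pose V : 'M[K]_(kappa, #|B|) := \matrix_(i, b) x (enum_val b) ^+ i.
have fV : row_free V.
  apply: inj_row_free => v /matrixP hv; apply: (can_inj rVpolyK); rewrite linear0.
  apply: (@roots_geq_poly_eq0 _ _ [seq x b | b <- enum B]).
  - apply/allP => _ /mapP[b bB ->]; rewrite rootE (horner_coef_wide _ (size_poly _ _)).
    rewrite mem_enum in bB; have := hv 0 (enum_rank_in bB b); rewrite !mxE => e.
    by apply/eqP; rewrite -[RHS]e; apply: eq_bigr => i _; rewrite coef_rVpoly_ord mxE enum_rankK_in.
  - by rewrite map_inj_uniq ?enum_uniq // => b b' /natK/pos_inj.
  - by rewrite size_map -cardE (leq_trans (size_poly _ _)).
pose z : 'rV[F]_kappa := poly_rV Q.
have uE b : u b = \sum_(i < kappa) z 0 i * cst P (x b ^+ i).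
  rewrite hQ (horner_coef_wide _ sQ); apply: eq_bigr => i _.
  by rewrite mxE rmorphXn rmorph_nat.
have fz : finmx P z.
  apply: (finite_coef (finmx_cst P V)); first by rewrite stmx_cst.
  move=> i b; rewrite ord1.
  suff -> : (z *m map_mx (cst P) V) 0 b = u (enum_val b) by [].
  by rewrite uE mxE; apply: eq_bigr => j _; rewrite !mxE.
have stu b : std (u b) = \sum_(i < kappa) stmx P z 0 i * x b ^+ i.
  rewrite uE st_sum => [|i _]; last by apply: finiteM => //; apply: finite_cst.
  by apply: eq_bigr => i _; rewrite stM ?st_cst ?[stmx _ _ _ _]mxE //; apply: finite_cst.
suff sz0 : stmx P z = 0.
  by rewrite stu; apply: big1 => i _; rewrite sz0 mxE mul0r.
apply: (row_free_inj fV); rewrite mul0mx; apply/matrixP=> i b.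
have := stu (enum_val b); rewrite u0 ?enum_valP // => e; rewrite ord1 mxE [RHS]mxE [RHS]e.
by apply: eq_bigr => j _; rewrite !mxE.
Qed.

(** Orthogonality to the values of all polynomials of degree below [l], written in the basis of
    falling factorials: the dual of a Reed-Solomon code. *)
Definition dual_code l (u : T -> F) :=
  forall i, (i < l)%N -> \sum_k u k * (pos k ^_ i)%:R = 0.

Lemma dual_code_lin l a b u v : dual_code l u -> dual_code l v ->
  dual_code l (fun k => a * u k + b * v k).
Proof.
move=> hu hv i il.
have -> : \sum_k (a * u k + b * v k) * (pos k ^_ i)%:R =
    a * (\sum_k u k * (pos k ^_ i)%:R) + b * \sum_k v k * (pos k ^_ i)%:R.
  by rewrite !mulr_sumr -big_split; apply: eq_bigr => k _ /=; ring.
by rewrite hu // hv // !mulr0 addr0.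
Qed.

Lemma dual_code_mds l kappa u (B : {set T}) : #|T| = (l + kappa)%N ->
  dual_code l u -> (forall k, fin (u k)) ->
  (kappa <= #|B|)%N -> (forall k, k \in B -> std (u k) = 0) -> forall k, std (u k) = 0.
Proof.
move=> cT hu fu kB u0 k0; have [/u0//|kB0] := boolP (k0 \in B).
have h i : (i < l)%N -> \sum_k std (u k) * (falling K i).[(pos k)%:R] = 0.
  move=> il; have fk k : fin (u k * (pos k ^_ i)%:R).
    by rewrite -(rmorph_nat (cst P)); apply: finiteM => //; apply: finite_cst.
  have := congr1 std (hu i il); rewrite st0 st_sum // => e; rewrite -[RHS]e.
  apply: eq_bigr => k _; rewrite falling_horner -[_%:R in RHS](rmorph_nat (cst P)).
  by rewrite stM ?st_cst //; apply: finite_cst.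
(* The test polynomial vanishes at all positions outside [B] except [k0]. As #|T| - #|B| <= l its
   degree is below l, and orthogonality leaves only the term of [k0]. *)
pose Q : {poly K} :=
  \prod_(a <- [seq (pos k)%:R | k <- enum (~: B :\ k0)]) ('X - a%:P).
have sQ : (size Q <= l)%N.
  rewrite size_prod_XsubC size_map -cardE; have := cardsD1 k0 (~: B); rewrite inE kB0 /=.
  have := cardsC B; rewrite cT; move: kB; lia.
have := falling_span h sQ; rewrite (bigD1 k0) //= big1 => [/eqP|k kk0].
  rewrite addr0 mulf_eq0 => /orP[/eqP//|]; rewrite -[_ == 0]/(root Q _) root_prod_XsubC.
  move=> /mapP[k]; rewrite mem_enum !inE => /andP[/eqP kk _] /natK/pos_inj ek.
  by case: kk.
have [kB'|kB'] := boolP (k \in B); first by rewrite u0 // mul0r.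
suff : root Q (pos k)%:R by rewrite rootE => /eqP->; rewrite mulr0.
by rewrite root_prod_XsubC; apply: map_f; rewrite mem_enum !inE kk0 kB'.
Qed.

End Codes.

Section OsculatingMatrix.
Variables (F : fieldType) (N : nat).

Definition osc_mx k (s : F) : 'M[F]_(k, N) := \matrix_(i < k, j < N) ('X^j)^`(i).[s].

Lemma osc_mxE k (s : F) i j : osc_mx k s i j = (j ^_ i)%:R * s ^+ (j - i).
Proof. by rewrite mxE derivnXn hornerMn hornerXn mulr_natl. Qed.

Lemma osc_mxE' k (s : F) i j : s != 0 ->
  osc_mx k s i j = (s ^+ i)^-1 * (s ^+ j * (j ^_ i)%:R).
Proof.
move=> s0; rewrite osc_mxE; have [ij|ji] := leqP i j; last by rewrite ffact_small // mul0r !mulr0.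
apply: (mulfI (expf_neq0 i s0)); rewrite mulrCA -exprD subnKC // mulVKf ?expf_neq0 //.
by rewrite mulrC.
Qed.

(** Row i of the osculating matrix is s^(-i) times the values of a falling factorial, each weighted
    by s^q. Division of coordinate q by s^q thus turns the osculating space into a Reed-Solomon code
    independent of s. *)
Lemma osc_row_eval k (s : F) (z : 'rV_k) : s != 0 ->
  exists2 Q : {poly F}, (size Q <= k)%N &
    forall q : 'I_N, (z *m osc_mx k s) 0 q = Q.[q%:R] * s ^+ q.
Proof.
move=> s0; exists (\sum_(i < k) (z 0 i / s ^+ i) *: falling F i).
  apply: (leq_trans (size_sum _ _ _)); apply/bigmax_leqP => i _.
  by rewrite (leq_trans (size_scale_leq _ _)) // size_falling.
move=> q; rewrite mxE horner_sum mulr_suml; apply: eq_bigr => i _.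
by rewrite osc_mxE' // hornerZ falling_horner; ring.
Qed.

Lemma osc_ker_dual l (s : F) (u : 'cV_N) : s != 0 -> osc_mx l s *m u = 0 ->
  forall i, (i < l)%N -> \sum_(q < N) s ^+ q * u q 0 * (q ^_ i)%:R = 0.
Proof.
move=> s0 /matrixP hu i il; have := hu (Ordinal il) 0; rewrite !mxE => e.
rewrite -[RHS](mulr0 (s ^+ i)) -{2}e mulr_sumr; apply: eq_bigr => q _.
by rewrite osc_mxE' //= mulrA mulVKf ?expf_neq0 //; ring.
Qed.

End OsculatingMatrix.

(** In this and the next two facts b is the number of lines without allowed entries, n the number of
    the others and e the excess. Lines are columns with total m for the lower condition, rows with
    total p for the upper one. *)
Lemma count_bound m a b n e :
  (b + n = m -> n <= e -> b < m + 1 - a -> a <= e)%N.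
Proof. lia. Qed.

Lemma count_defect m a b n e : (b + n = m -> n <= e -> e <= a -> m + 1 - a <= b.+1)%N.
Proof. lia. Qed.

Lemma count_tight m a b n e : (b + n = m -> b < m + 1 - a -> e <= a -> e <= n)%N.
Proof. lia. Qed.

Section StripLimit.
Variables (F K : fieldType) (P : place F K).
Local Notation fin := (finite P).
Local Notation std := (st P).
Hypothesis natK : injective (fun n : nat => n%:R : K).
Variable s : F.
Hypotheses (s_fin : fin s) (s_st : std s = 0) (s_neq0 : s != 0).
Variables (m p : nat).
Local Notation N := (m + p)%N.
Variables (d : 'I_p -> 'I_N) (c : 'I_p -> nat).
Hypotheses (d_incr : {homo d : i j / (i < j)%N}).
Hypotheses (c_lt : forall j, (c j < N)%N) (d_le : forall j, (d j <= c j)%N).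
Local Notation piv := (pivot d).
Local Notation excess := (\sum_j (c j - d j))%N.

Local Notation J := {q : 'I_N | q \notin piv}.
Let ord_pos (k : 'I_p + J) : 'I_N := match k with inl i => d i | inr q => val q end.

Let ord_pos_inj : injective ord_pos.
Proof.
move=> [i|q] [i'|q'] //=.
- by move/(pivot_inj d_incr) ->.
- by move=> e; have := valP q'; rewrite /= -e pivot_in.
- by move=> e; have := valP q; rewrite /= e pivot_in.
- by move/val_inj ->.
Qed.

Let card_J : #|{: J}| = m.
Proof.
rewrite card_sig; have := cardC piv; rewrite card_ord (card_codom (pivot_inj d_incr)) card_ord.
by rewrite addnC => /addIn.
Qed.

Let card_IJ : #|{: 'I_p + J}| = N.
Proof. by rewrite card_sum card_J card_ord addnC. Qed.

Let ord_pos_sum (f : 'I_N -> F) :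
  \sum_q f q = \sum_i f (d i) + \sum_(q : J) f (val q).
Proof.
rewrite (reindex ord_pos) /=; first by rewrite big_sumType.
by apply/onW_bij/inj_card_bij; [exact: ord_pos_inj|rewrite card_IJ card_ord].
Qed.

Let pos (k : 'I_p + J) : nat := ord_pos k.
Let pos_inj : injective pos. Proof. by move=> k k' /val_inj/ord_pos_inj. Qed.

(** Entries to the left of the pivot stay unrestricted: they are damped by positive powers of s in
    the rescaled coordinates. *)
Definition strip_support (H : 'M[F]_(p, N)) :=
  forall i q, q \notin piv -> H i q != 0 -> (d i < q)%N -> allowed d c i q.

Let allowed_lt i (q : J) : (d i < val q)%N || (val q < d i)%N.
Proof.
rewrite -neq_ltn; apply/eqP => /val_inj e.
by have := valP q; rewrite /= -e pivot_in.
Qed.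

Let ccols := #|[set q | (q \notin piv) && [exists i, allowed d c i q]]|.
Let crows := #|[set i | [exists q, (q \notin piv) && allowed d c i q]]|.
Let Bc : {set J} := [set q | ~~ [exists i, allowed d c i (val q)]].
Let Br : {set 'I_p} := [set i | ~~ [exists q, (q \notin piv) && allowed d c i q]].

Let card_Bc : (#|Bc| + ccols = m)%N.
Proof.
have := cardsC Bc; rewrite card_J => e; rewrite -[RHS]e; congr (_ + _)%N.
rewrite -(card_imset (mem (~: Bc)) val_inj); apply: eq_card => q; rewrite inE.
apply/andP/imsetP => [[nq aq]|[q' hq' ->]].
  by exists (exist _ q nq); rewrite // !inE negbK.
by move: hq'; rewrite !inE negbK; split=> //; apply: (valP q').
Qed.

Let card_Br : (#|Br| + crows = p)%N.
Proof.
rewrite -[RHS]card_ord -(cardsC Br); congr (_ + #|pred_of_set _|)%N.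
by apply/setP => i; rewrite !inE negbK.
Qed.

Section Lower.
Variable a : nat.
Let kappa := (m + 1 - a)%N.
Let h := pos.
Let x (H : 'M[F]_(p, N)) (i : 'I_p) (q : J) := H i (val q).
Let W := @eval_code F _ pos kappa.
Let y_eval (v : 'rV[F]_N) (k : 'I_p + J) := v 0 (ord_pos k) / s ^+ pos k.

Let evalK v k : y_eval v k * s ^+ h k = v 0 (ord_pos k).
Proof. by rewrite /y_eval divfK // expf_neq0. Qed.

Let eval_W (v : 'rV[F]_N) : (v <= osc_mx N kappa s)%MS -> W (y_eval v).
Proof.
move=> /submxP[z ->]; have [Q sQ hQ] := osc_row_eval N z s_neq0.
by exists Q => // k; rewrite /y_eval hQ mulfK // expf_neq0.
Qed.

Let eval_inc H (y : 'rV_p) : colsub d H = 1%:M -> incident s h (x H) (y_eval (y *m H)).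
Proof.
move=> dH q; rewrite evalK mxE; apply: eq_bigr => i _.
by rewrite evalK /= (colsub1_coef dH).
Qed.

Let shifted H : strip_support H -> shifted_cols h Bc (x H).
Proof.
move=> sH i q; rewrite inE => /existsPn nq Hiq.
have := allowed_lt i q; case: ltnP => //= diq _.
by have := nq i; rewrite (sH _ _ (valP q) Hiq diq).
Qed.

Let shifted1 H i0 (q : J) : strip_support H ->
  (forall i, allowed d c i (val q) -> i = i0) ->
  forall i, i != i0 -> x H i q != 0 -> (h (inr q) < h (inl i))%N.
Proof.
move=> sH h1 i ii0 Hiq; have := allowed_lt i q; case: ltnP => //= diq _.
by case/eqP: ii0; apply/h1/sH => //; apply: (valP q).
Qed.

Let eval_neq0 H (y : 'rV_p) : colsub d H = 1%:M -> y != 0 ->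
  exists k, y_eval (y *m H) k != 0.
Proof.
move=> dH /rV0Pn[i yi]; exists (inl i).
by rewrite /y_eval mulf_neq0 ?invr_neq0 ?expf_neq0 //= (colsub1_coef dH).
Qed.

(** In the columns of [Bc] all nonzero entries stand left of their pivots, so the rescaled vector is
    infinitesimal there. Hence #|Bc| < m + 1 - a, and at least a columns contain allowed entries. *)
Lemma lower_excess H (y : 'rV_p) : colsub d H = 1%:M -> finmx P H -> strip_support H ->
  y != 0 -> (y *m H <= osc_mx N kappa s)%MS -> (a <= excess)%N.
Proof.
move=> dH fH sH y0 yH; have [k k0] := eval_neq0 dH y0.
have cb := core_bound s_fin s_st s_neq0 (@eval_code_lin F _ _ kappa) (@eval_code_mds _ _ P natK _ _ pos_inj kappa)
  (fun i j => fH i (val j)) (shifted sH) (eval_W yH) (eval_inc y dH) k0.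
have cc := strip_cols c_lt d_le.
by apply: count_bound card_Bc cc cb.
Qed.

Lemma lower_direction H H' D (y y' : 'rV_p) :
  colsub d H = 1%:M -> finmx P H -> strip_support H ->
  colsub d H' = 1%:M -> finmx P H' -> strip_support H' ->
  colsub d D = 0 -> finmx P D -> strip_support D -> (excess <= a)%N ->
  y != 0 -> (y *m H <= osc_mx N kappa s)%MS ->
  y' != 0 -> (y' *m H' <= osc_mx N kappa s)%MS -> (y' *m D <= osc_mx N kappa s + H)%MS ->
  forall i (q : 'I_N), (d i < q)%N -> std (D i q) = 0.
Proof.
move=> dH fH sH dH' fH' sH' dD fD sD ea y0 yH y0' yH' yD i q diq.
have Dd i' j' : D i' (d j') = 0 by have /matrixP/(_ i' j') := dD; rewrite !mxE.
have [pq|nq] := boolP (q \in piv).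
  by move: pq => /codomP[j ->]; rewrite Dd st0.
have [->|Diq] := eqVneq (D i q) 0; first by rewrite st0.
have aiq := sD _ _ nq Diq diq.
have [k k0] := eval_neq0 dH y0; have [k' k0'] := eval_neq0 dH' y0'.
have ae := lower_excess dH fH sH y0 yH.
have cb := core_bound s_fin s_st s_neq0 (@eval_code_lin F _ _ kappa) (@eval_code_mds _ _ P natK _ _ pos_inj kappa)
  (fun i j => fH i (val j)) (shifted sH) (eval_W yH) (eval_inc y dH) k0.
have cc := strip_cols c_lt d_le.
have hB : (kappa <= #|Bc|.+1)%N by apply: count_defect card_Bc cc ea.
have uniq i' : allowed d c i' q -> i' = i.
  move=> a'; apply: (strip_col_unique d_incr c_lt d_le _ nq a' aiq).
  by apply: count_tight card_Bc cb ea.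
have [[z1 z2] /= e] := sub_addsmxP yD.
(* Since [D] vanishes in the pivot columns, the pivot coordinates of [r] are those of - z2; this
   expresses its other coordinates in the inhomogeneous form required by [core_direction]. *)
pose r := z1 *m osc_mx N kappa s.
have er : r = y' *m D - z2 *m H by rewrite e addrK.
have rd j : r 0 (d j) = - z2 0 j.
  rewrite er [LHS]mxE [X in _ + X]mxE (colsub1_coef dH) mxE big1 ?add0r // => k1 _.
  by rewrite Dd mulr0.
apply: (core_direction s_fin s_st s_neq0 (@eval_code_lin F _ _ kappa)
  (@eval_code_mds _ _ P natK _ _ pos_inj kappa) (x := x H) (x' := x H') (y := x D) (B := Bc) (h := h)
  (i0 := i) (j0 := exist _ q nq : J) (r := y_eval r) _ _ _ (shifted sH) (shifted sH') (shifted sD)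
  hB (eval_W yH) (eval_inc y dH) k0 (eval_W yH') (eval_inc y' dH') k0') => //.
- by move=> i' j'; apply: fH.
- by move=> i' j'; apply: fH'.
- by move=> i' j'; apply: fD.
- by apply: eval_W; apply: submxMl.
- move=> j; rewrite evalK; have -> : r 0 (ord_pos (inr j)) =
      \sum_k1 y' 0 k1 * D k1 (val j) - \sum_k1 z2 0 k1 * H k1 (val j) by rewrite er !mxE.
  rewrite -sumrN; congr (_ + _); apply: eq_bigr => k1 _.
    by rewrite evalK /= (colsub1_coef dH').
  by rewrite evalK (rd k1 : r 0 (ord_pos (inl k1)) = _) mulNr.
- exact: shifted1.
- exact: shifted1.
Qed.
End Lower.

Section Upper.
Variable a : nat.
Hypotheses (m_gt0 : (0 < m)%N) (a_gt0 : (0 < a)%N) (a_le : (a <= p)%N).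
Let l := (m - 1 + a)%N.
Let kappa := (p + 1 - a)%N.
Let ord_pos' (k : J + 'I_p) : 'I_N := match k with inl q => val q | inr i => d i end.
Let pos' (k : J + 'I_p) : nat := ord_pos' k.
(** A form u with [H *m u] = 0 has its pivot coordinates determined by the others. Rows and columns
    of the echelon form therefore trade places, the matrix changes sign and the heights are
    reversed; the rescaled form then carries a common factor s^N. *)
Let h k := (N - pos' k)%N.
Let x (H : 'M[F]_(p, N)) (q : J) (i : 'I_p) := - H i (val q).
Let W := @dual_code F _ pos' l.
Let u_eval (u : 'cV[F]_N) (k : J + 'I_p) := s ^+ pos' k * u (ord_pos' k) 0.

Let pos'_inj : injective pos'.
Proof.
have swap (k : J + 'I_p) : pos' k = pos (match k with inl q => inr q | inr i => inl i end).
  by case: k.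
by move=> [q|i] [q'|i']; rewrite !swap => /pos_inj // [->].
Qed.

Let evalK u k : u_eval u k * s ^+ h k = s ^+ N * u (ord_pos' k) 0.
Proof. by rewrite /u_eval mulrAC -exprD subnKC // (ltnW (ltn_ord _)). Qed.

Let card_JI : #|{: J + 'I_p}| = (l + kappa)%N.
Proof. rewrite card_sum card_J card_ord /l /kappa; lia. Qed.

Let ord_pos_sum' (f : 'I_N -> F) :
  \sum_q f q = \sum_(q : J) f (val q) + \sum_i f (d i).
Proof. by rewrite ord_pos_sum addrC. Qed.

Let eval_W (u : 'cV[F]_N) : osc_mx N l s *m u = 0 -> W (u_eval u).
Proof.
move=> /(osc_ker_dual s_neq0) hu i il; have := hu i il.
by rewrite ord_pos_sum' big_sumType.
Qed.

Let coef_pivot H (u : 'cV[F]_N) i : colsub d H = 1%:M ->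
  (H *m u) i 0 = u (d i) 0 + \sum_(q : J) H i (val q) * u (val q) 0.
Proof.
move=> dH; rewrite mxE ord_pos_sum; congr (_ + _).
rewrite (bigD1 i) //= big1 ?addr0 => [|k ki]; rewrite (colsub1E dH) ?eqxx ?mul1r //.
by rewrite eq_sym (negPf ki) mul0r.
Qed.

Let eval_inc H (u : 'cV_N) : colsub d H = 1%:M -> H *m u = 0 ->
  incident s h (x H) (u_eval u).
Proof.
move=> dH Hu i; rewrite evalK /=; have := coef_pivot u i dH; rewrite Hu mxE => /esym/eqP.
rewrite addr_eq0 => /eqP->; rewrite -sumrN mulr_sumr; apply: eq_bigr => q _.
by rewrite evalK /= /x mulrN mulrN -mulrA [u _ _ * _]mulrC.
Qed.

Let shifted H : strip_support H -> shifted_cols h Br (x H).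
Proof.
move=> sH q i; rewrite inE => /existsPn nq; rewrite oppr_eq0 => Hiq.
have := allowed_lt i q; case: ltnP => /= [diq _|_ qd].
  by have := nq (val q); rewrite (valP q) (sH _ _ (valP q) Hiq diq).
by apply: ltn_sub2l => //; apply: ltn_ord.
Qed.

Let shifted1 H i (q0 : J) : strip_support H ->
  (forall q : J, allowed d c i (val q) -> q = q0) ->
  forall q, q != q0 -> H i (val q) != 0 -> (h (inr i) < h (inl q))%N.
Proof.
move=> sH h1 q qq0 Hiq; have := allowed_lt i q; case: ltnP => /= [diq _|_ qd].
  by case/eqP: qq0; apply/h1/sH => //; apply: (valP q).
by apply: ltn_sub2l => //; apply: ltn_ord.
Qed.

Let eval_neq0 (u : 'cV_N) : u != 0 -> exists k, u_eval u k != 0.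
Proof.
move=> /cV0Pn[q uq]; have [pq|nq] := boolP (q \in piv).
  move: pq uq => /codomP[i ->] ui; exists (inr i).
  by rewrite mulf_neq0 ?expf_neq0.
by exists (inl (exist _ q nq)); rewrite mulf_neq0 ?expf_neq0.
Qed.

Lemma upper_excess H (u : 'cV_N) : colsub d H = 1%:M -> finmx P H -> strip_support H ->
  u != 0 -> H *m u = 0 -> osc_mx N l s *m u = 0 -> (a <= excess)%N.
Proof.
move=> dH fH sH u0 Hu ou; have [k k0] := eval_neq0 u0.
have cb := core_bound s_fin s_st s_neq0 (@dual_code_lin F _ _ l)
  (fun u B => @dual_code_mds _ _ P natK _ _ pos'_inj l kappa u B card_JI)
  (fun j i => finiteN (fH i (val j))) (shifted sH) (eval_W ou) (eval_inc dH Hu) k0.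
have cc := strip_rows d_incr c_lt d_le.
by apply: count_bound card_Br cc cb.
Qed.

Lemma upper_direction H H' D (u u' v : 'cV_N) :
  colsub d H = 1%:M -> finmx P H -> strip_support H ->
  colsub d H' = 1%:M -> finmx P H' -> strip_support H' ->
  colsub d D = 0 -> finmx P D -> strip_support D -> (excess <= a)%N ->
  u != 0 -> H *m u = 0 -> osc_mx N l s *m u = 0 ->
  u' != 0 -> H' *m u' = 0 -> osc_mx N l s *m u' = 0 ->
  osc_mx N l s *m v = 0 -> H' *m v = D *m u ->
  forall i (q : 'I_N), (d i < q)%N -> std (D i q) = 0.
Proof.
move=> dH fH sH dH' fH' sH' dD fD sD ea u0 Hu ou u0' Hu' ou' ov Dv i q diq.
have Dd i' j' : D i' (d j') = 0 by have /matrixP/(_ i' j') := dD; rewrite !mxE.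
have [pq|nq] := boolP (q \in piv).
  by move: pq => /codomP[j ->]; rewrite Dd st0.
have [->|Diq] := eqVneq (D i q) 0; first by rewrite st0.
have aiq := sD _ _ nq Diq diq.
have [k k0] := eval_neq0 u0; have [k' k0'] := eval_neq0 u0'.
have cb := core_bound s_fin s_st s_neq0 (@dual_code_lin F _ _ l)
  (fun u B => @dual_code_mds _ _ P natK _ _ pos'_inj l kappa u B card_JI)
  (fun j i => finiteN (fH i (val j))) (shifted sH) (eval_W ou) (eval_inc dH Hu) k0.
have cc := strip_rows d_incr c_lt d_le.
have hB : (kappa <= #|Br|.+1)%N by apply: count_defect card_Br cc ea.
have uniq (q' : J) : allowed d c i (val q') -> q' = exist _ q nq.
  move=> a'; apply: val_inj.
  apply: (strip_row_unique d_incr c_lt d_le _ (valP q') nq a' aiq).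
  by apply: count_tight card_Br cb ea.
pose y (q : J) i := D i (val q).
have sy : shifted_cols h Br y.
  by have := shifted sD; move=> sh q' i' iB; rewrite -oppr_eq0; apply: sh.
(* The planes are exchanged compared with the lower case: in [H' *m v] = [D *m u] the correction v
   is multiplied by [H'], while u is incident to [H]. *)
apply: (core_direction s_fin s_st s_neq0 (@dual_code_lin F _ _ l)
  (fun u B => @dual_code_mds _ _ P natK _ _ pos'_inj l kappa u B card_JI)
  (x := x H') (x' := x H) (y := y) (B := Br) (h := h)
  (i0 := exist _ q nq : J) (j0 := i) (r := u_eval v) _ _ _ (shifted sH') (shifted sH) sy
  hB (eval_W ou') (eval_inc dH' Hu') k0' (eval_W ou) (eval_inc dH Hu) k0) => //.
- by move=> j' i'; apply/finiteN/fH'.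
- by move=> j' i'; apply/finiteN/fH.
- by move=> j' i'; apply: fD.
- exact: eval_W.
- move=> j; rewrite evalK /=; have := coef_pivot v j dH'.
  rewrite Dv mxE ord_pos_sum [X in X + _]big1 ?add0r => [e|i' _]; last by rewrite Dd mul0r.
  rewrite -[v _ _](addrK (\sum_(q : J) H' j (val q) * v (val q) 0)) -e mulrBr !mulr_sumr -sumrN.
  congr (_ + _); apply: eq_bigr => q' _; rewrite evalK /= /y /x; ring.
- by apply: ltn_sub2l => //; apply: ltn_ord.
- move=> q' qq; rewrite oppr_eq0; apply: shifted1 qq => //.
- exact: shifted1.
Qed.
End Upper.

End StripLimit.

(** * Degeneration over a place *)

Section Conditions.
Variables (K : fieldType) (p N : nat).
Implicit Types (H D : 'M[K]_(p, N)) (V : 'M[K]_N).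

(* D represents a homomorphism from the row space of H to its quotient; it is
   tangent at H to the locus of planes meeting V in the dimension of H :&: V. *)
Definition tangent H V D := forall y : 'rV[K]_p,
  (y *m H <= V)%MS -> (y *m D <= V + H)%MS.

Definition satisfies (L : nat -> 'M[K]_N -> Prop) H :=
  forall c V, L c V -> (c <= \rank (H :&: V))%N.

Definition exactly (L : nat -> 'M[K]_N -> Prop) H :=
  forall c V, L c V -> \rank (H :&: V) = c.

Definition standard_schubert (c : 'I_p -> nat) H :=
  forall j : 'I_p, (j.+1 <= \rank (H :&: (pid_mx (c j).+1 : 'M_N)))%N.

(* The plane H' together with a direction D at H which annihilates, modulo V + H,
   the vectors of a c-dimensional part of H' lying in V. *)
Definition weak_tangent c H H' V D := exists y : 'M[K]_(c, p),
  [/\ row_free y, (y *m H' <= V)%MS & (y *m D <= V + H)%MS].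

(** Together with the next lemma this puts differences of two planes and tangent directions into one
    form, so that a single limit argument yields both reality and transversality. *)
Lemma secant_weak_tangent c H H' V : row_free H' ->
  (c <= \rank (H' :&: V))%N -> weak_tangent c H H' V (H' - H).
Proof.
move=> fH' /(cap_rank_witness V c fH')[y [fy yV]]; exists y; split=> //.
by rewrite mulmxBr addmx_sub_adds // -mulNmx submxMl.
Qed.

Lemma tangent_weak_tangent c H V D : row_free H ->
  (c <= \rank (H :&: V))%N -> tangent H V D -> weak_tangent c H H V D.
Proof.
move=> fH /(cap_rank_witness V c fH)[y [fy yV]] tD; exists y; split=> //.
apply/row_subP => i; rewrite row_mul; apply: tD.
by rewrite -row_mul (submx_trans (row_sub _ _)).
Qed.

Lemma weak_tangent_change c H H' V D A B E : A \in unitmx -> B \in unitmx ->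
  weak_tangent c H H' V D ->
  weak_tangent c (A *m H) (B *m H') V (B *m D - E *m (A *m H)).
Proof.
move=> uA uB [y [fy yV yD]]; exists (y *m invmx B); split.
- by rewrite /row_free mxrankMfree // row_free_unit unitmx_inv.
- by rewrite mulmxA mulmxKV.
rewrite mulmxBr (mulmxA _ B) mulmxKV // addmx_sub //.
  by apply: submx_trans yD _; rewrite addsmxS // -[X in (X <= _)%MS](mulKmx uA) submxMl.
by rewrite eqmx_opp (mulmxA _ E) (submx_trans (submxMl _ _)) ?addsmxSr.
Qed.

Lemma weak_tangentZ c H H' V D b : weak_tangent c H H' V D -> weak_tangent c H H' V (b *: D).
Proof.
by move=> [y [fy yV yD]]; exists y; split=> //; rewrite -scalemxAr scalemx_sub.
Qed.

End Conditions.

Section Degeneration.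
Variables (F K : fieldType) (P : place F K).
Local Notation fin := (finite P).
Local Notation std := (st P).
Local Notation inj := (cst P).

(** The echelon form is taken for the standard part and lifted. Dividing by the pivot block, whose
    standard part is 1, makes the pivot columns exact over F; entries beyond the pivots are only
    infinitesimal. *)
Lemma normalize p N (H : 'M[F]_(p, N)) : row_free H ->
  exists A (d : 'I_p -> 'I_N), [/\ A \in unitmx, {homo d : i j / (i < j)%N},
    colsub d (A *m H) = 1%:M, finmx P (A *m H) &
    forall i (q : 'I_N), (d i < q)%N -> stmx P (A *m H) i q = 0].
Proof.
move=> /(finite_basis P)[B uB [fB /echelon[B0 [d [uB0 d_incr dB0 eB0]]]]].
pose H2 := map_mx inj B0 *m (B *m H).
have fH2 : finmx P H2 by apply: finmxM => //; apply: finmx_cst.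
have sH2 : stmx P H2 = B0 *m stmx P (B *m H).
  by rewrite stmxM ?stmx_cst //; apply: finmx_cst.
pose M := colsub d H2.
have fM : finmx P M by apply: finmx_colsub.
have sM : stmx P M = 1%:M by rewrite stmx_colsub sH2.
have uM : M \in unitmx by apply: (stmx_unit fM); rewrite sM unitmx1.
have [fV sV] : finmx P (invmx M) /\ stmx P (invmx M) = 1%:M.
  by have := finmx_inv fM; rewrite sM invmx1 unitmx1 => /(_ isT).
exists (invmx M *m map_mx inj B0 *m B), d.
have e : invmx M *m map_mx inj B0 *m B *m H = invmx M *m H2 by rewrite /H2 !mulmxA.
rewrite e; split=> //.
- by rewrite !unitmx_mul unitmx_inv uM map_unitmx uB0.
- by rewrite -mulmx_colsub mulVmx.
- exact: finmxM.
- by move=> i q diq; rewrite stmxM // sV mul1mx sH2 eB0.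
Qed.

(** The ranks of [H] and V persist in the limit and the rank of their sum can only drop, so the
    intersection can only grow. *)
Lemma limit_condition p N c (H : 'M[F]_(p, N)) (V : 'M[K]_N) : finmx P H ->
  row_free (stmx P H) -> (c <= \rank (H :&: map_mx inj V))%N ->
  (c <= \rank (stmx P H :&: V))%N.
Proof.
move=> fH sH cH; have rH := stmx_row_free fH sH.
have e1 := mxrank_sum_cap H (map_mx inj V); have e2 := mxrank_sum_cap (stmx P H) V.
rewrite mxrank_map (eqP rH) in e1; rewrite (eqP sH) -e1 in e2.
have fc : finmx P (col_mx H (map_mx inj V)).
  by move=> i j; rewrite mxE; case: splitP => k _; rewrite ?mxE //; apply: finite_cst.
have := stmx_rank fc; rewrite /stmx map_col_mx -/(stmx P H) -/(stmx P _) stmx_cst.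
rewrite -(addsmxE (stmx P H) V) -(addsmxE H) => le; apply: (leq_trans cH).
by rewrite -(leq_add2l (\rank (stmx P H + V))) e2 leq_add2r.
Qed.

Lemma limit_sub_cst a N (A : 'M[F]_(a, N)) (V : 'M[K]_N) : finmx P A ->
  (A <= map_mx inj V)%MS -> (stmx P A <= V)%MS.
Proof.
move=> fA; rewrite !submxE -map_cokermx => /eqP h.
by rewrite -[X in stmx P A *m X](stmx_cst P) -stmxM ?h ?stmx0 //; apply: finmx_cst.
Qed.

(** Exactness at the limit is essential: by dimension the vectors of [y *m H'] then tend to the
    whole intersection with V, and V + H tends to the sum of V and the limit plane, rather than to a
    larger space. *)
Lemma limit_tangent p N c (H H' D : 'M[F]_(p, N)) (V : 'M[K]_N) :
  finmx P H -> finmx P H' -> finmx P D -> stmx P H' = stmx P H -> row_free (stmx P H) ->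
  \rank (stmx P H :&: V) = c -> (c <= \rank (H :&: map_mx inj V))%N ->
  weak_tangent c H H' (map_mx inj V) D -> tangent (stmx P H) V (stmx P D).
Proof.
move=> fH fH' fD sH' sH r0 rH [y [fy yV yD]] z zV.
have [B uB [fBy sBy]] := finite_basis P fy.
set y1 := B *m y in fBy sBy.
have y1V : (stmx P y1 *m stmx P H <= V)%MS.
  rewrite -sH' -stmxM //; apply: limit_sub_cst; first exact: finmxM.
  by rewrite -mulmxA (submx_trans (submxMl _ _)).
have eqV : (stmx P y1 *m stmx P H == stmx P H :&: V)%MS.
  have sub : (stmx P y1 *m stmx P H <= stmx P H :&: V)%MS by rewrite sub_capmx submxMl.
  by have [_ <-] := mxrank_leqif_eq sub; rewrite r0 mxrankMfree // (eqP sBy).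
have : (z *m stmx P H <= stmx P y1 *m stmx P H)%MS.
  by rewrite (eqmxP eqV) sub_capmx submxMl.
move=> /submxP[w]; rewrite mulmxA => /(row_free_inj sH) ->.
rewrite -mulmxA (submx_trans (submxMl _ _)) // -stmxM //.
have [T [fT hT]] := limit_subspace P (map_mx inj V + H)%MS.
have VT : (V <= T)%MS.
  by have := hT _ _ (finmx_cst P V) (addsmxSl _ _); rewrite stmx_cst.
have HT : (stmx P H <= T)%MS by apply: hT => //; exact: addsmxSr.
have DT : (stmx P (y1 *m D) <= T)%MS.
  by apply: hT; [exact: finmxM|rewrite -mulmxA (submx_trans (submxMl _ _))].
suff : (T <= V + stmx P H)%MS by apply: submx_trans.
have sub : (V + stmx P H <= T)%MS by rewrite addsmx_sub VT HT.
have [_ e] := mxrank_leqif_sup sub; rewrite -e eqn_leq (mxrankS sub) (eqP fT) /=.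
have e1 := mxrank_sum_cap (map_mx inj V) H; have e2 := mxrank_sum_cap V (stmx P H).
rewrite mxrank_map (eqP (stmx_row_free fH sH)) capmxC in e1.
rewrite (eqP sH) capmxC r0 in e2.
by rewrite -(leq_add2r c) e2 -e1 leq_add2l.
Qed.

End Degeneration.

Lemma colsub1_tangent_eq0 (K : fieldType) p N (d : 'I_p -> 'I_N) (H D : 'M[K]_(p, N)) :
  colsub d H = 1%:M -> colsub d D = 0 -> (D <= H)%MS -> D = 0.
Proof.
move=> dH dD /submxP[z Dz]; have : z = 0.
  by rewrite -[z]mulmx1 -dH mulmx_colsub -Dz.
by move=> z0; rewrite Dz z0 mul0mx.
Qed.

Lemma stmx_colsub1 (F K : fieldType) (P : place F K) p N (d : 'I_p -> 'I_N)
  (H : 'M[F]_(p, N)) : colsub d H = 1%:M -> colsub d (stmx P H) = 1%:M.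
Proof. by move=> dH; rewrite -stmx_colsub dH stmx1. Qed.

Section SpecialCondition.
Variables (F : fieldType) (m p : nat) (upper : bool) (a : nat) (s : F).
Local Notation N := (m + p)%N.

(* The upper condition is read on linear forms: H and the osculating space
   together do not span, so some u annihilates both. *)
Definition special_witness (H : 'M[F]_(p, N)) :=
  if upper then (a <= p)%N /\
    exists u : 'cV_N, [/\ u != 0, H *m u = 0 & osc_mx N (m - 1 + a) s *m u = 0]
  else exists y : 'rV_p, y != 0 /\ (y *m H <= osc_mx N (m + 1 - a) s)%MS.

(** In the upper case this is the derivative of the equation [H *m u] = 0, with v the negated
    variation of u; placing [H'] before v lets a secant qualify with v = u. *)
Definition special_direction (H H' D : 'M[F]_(p, N)) :=
  if upper then exists u v : 'cV_N,
    [/\ u != 0, H *m u = 0, osc_mx N (m - 1 + a) s *m u = 0,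
        osc_mx N (m - 1 + a) s *m v = 0 & H' *m v = D *m u]
  else exists y : 'rV_p, [/\ y != 0, (y *m H' <= osc_mx N (m + 1 - a) s)%MS &
    (y *m D <= osc_mx N (m + 1 - a) s + H)%MS].

Lemma special_witness_change H A : A \in unitmx -> special_witness H ->
  special_witness (A *m H).
Proof.
move=> uA; rewrite /special_witness; case: upper => [[ap [u [u0 Hu ou]]]|[y [y0 yH]]].
  by split=> //; exists u; split=> //; rewrite -mulmxA Hu mulmx0.
exists (y *m invmx A); split; last by rewrite mulmxA mulmxKV.
by apply: contraNneq y0 => e; rewrite -(mulmxKV uA y) e mul0mx.
Qed.

Lemma special_direction_secant H H' : special_witness H -> special_witness H' ->
  special_direction H H' (H' - H).
Proof.
rewrite /special_witness /special_direction; case: upper.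
  move=> [_ [u [u0 Hu ou]]] _; exists u, u; split=> //.
  by rewrite mulmxBl Hu subr0.
move=> _ [y [y0 yH']]; exists y; split=> //.
by rewrite mulmxBr addmx_sub_adds // eqmx_opp submxMl.
Qed.

Lemma special_direction_change H D A E : A \in unitmx -> special_direction H H D ->
  special_direction (A *m H) (A *m H) (A *m D - E *m (A *m H)).
Proof.
move=> uA; rewrite /special_direction; case: upper.
  move=> [u [v [u0 Hu ou ov e]]]; exists u, v; split=> //.
    by rewrite -mulmxA Hu mulmx0.
  by rewrite mulmxBl -!mulmxA Hu !mulmx0 subr0 e.
move=> [y [y0 yH yD]]; exists (y *m invmx A); split.
- by apply: contraNneq y0 => e; rewrite -(mulmxKV uA y) e mul0mx.
- by rewrite mulmxA mulmxKV.
rewrite mulmxBr (mulmxA _ A D) mulmxKV // addmx_sub //.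
  by apply: submx_trans yD _; rewrite addsmxS // -[X in (X <= _)%MS](mulKmx uA) submxMl.
by rewrite eqmx_opp (mulmxA _ E) (submx_trans (submxMl _ _)) ?addsmxSr.
Qed.

Lemma special_directionZ H H' D b : special_direction H H' D ->
  special_direction H H' (b *: D).
Proof.
rewrite /special_direction; case: upper.
  move=> [u [v [u0 Hu ou ov e]]]; exists u, (b *: v); split=> //.
    by rewrite -scalemxAr ov scaler0.
  by rewrite -scalemxAr e scalemxAl.
by move=> [y [y0 yH yD]]; exists y; split=> //; rewrite -scalemxAr scalemx_sub.
Qed.

End SpecialCondition.

Section StepOverField.
Variables (F K : fieldType) (P : place F K).
Local Notation inj := (cst P).
Hypothesis natK : injective (fun n : nat => n%:R : K).
Variable s : F.
Hypotheses (s_fin : finite P s) (s_st : st P s = 0) (s_neq0 : s != 0).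
Variables (m p : nat).
Local Notation N := (m + p)%N.
Hypothesis m_gt0 : (0 < m)%N.
Variables (c : 'I_p -> nat) (a : nat) (upper : bool) (L : nat -> 'M[K]_N -> Prop).
Hypotheses (c_lt : forall j, (c j < N)%N) (a_gt0 : (0 < a)%N).

Section Normalized.
Variable d : 'I_p -> 'I_N.
Hypothesis d_incr : {homo d : i j / (i < j)%N}.
Local Notation excess := (\sum_j (c j - d j))%N.

Lemma echelon_pivot_le (H : 'M[K]_(p, N)) : colsub d H = 1%:M ->
  standard_schubert c H -> forall j, (d j <= c j)%N.
Proof.
move=> dH hc j; have := leq_trans (hc j) (pid_cap_rank dH _).
rewrite ltnNge => h; rewrite leqNgt; apply: contra h => cd.
rewrite -[X in (_ <= X)%N](card_ord j).
have -> : #|'I_j| = #|[set widen_ord (ltnW (ltn_ord j)) i | i in 'I_j]|.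
  by rewrite card_imset // => x y /(congr1 val)/= /val_inj.
apply: subset_leq_card; apply/fintype.subsetP => i; rewrite inE ltnS => dc.
have ij : (i < j)%N.
  rewrite ltnNge; apply/negP => /(pivot_leq d_incr) h.
  by have := leq_trans cd (leq_trans h dc); rewrite ltnn.
by apply/imsetP; exists (Ordinal ij) => //; apply: val_inj.
Qed.

Lemma echelon_standard_schubert (H : 'M[K]_(p, N)) : colsub d H = 1%:M ->
  (forall i (q : 'I_N), (d i < q)%N -> H i q = 0) ->
  standard_schubert (fun j => d j) H.
Proof.
move=> dH eH j.
have : (#|[set i | d i < (d j).+1]| <= \rank (H :&: (pid_mx (d j).+1 : 'M_N)))%N.
  apply: (pid_cap_rank_ge dH) => i q; rewrite ltnS => dij dq.
  exact/eH/(leq_ltn_trans dij).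
by rewrite position_card.
Qed.

Hypothesis d_le : forall j, (d j <= c j)%N.

(** At a tight j exactly j.+1 pivots lie below (c j).+1, so condition j holds with equality and
    confines each of these rows to the coordinate subspace. *)
Lemma schubert_support (H : 'M[F]_(p, N)) : colsub d H = 1%:M ->
  standard_schubert c H ->
  (forall j i (q : 'I_N), tight d c j -> (d i < (c j).+1)%N -> ((c j).+1 <= q)%N -> H i q = 0)
  /\ strip_support d c H.
Proof.
move=> dH hc.
have key j i (q : 'I_N) : tight d c j -> (d i < (c j).+1)%N -> ((c j).+1 <= q)%N -> H i q = 0.
  move=> tj; apply: (pid_cap_vanish dH _ (hc j)).
  by rewrite (tight_card d_incr d_le).
split=> // i q nq Hiq diq; rewrite /allowed diq; apply/forallP => j.
apply/implyP => tj; apply/implyP => ij; rewrite leqNgt; apply: contraNN Hiq => cq.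
by rewrite (key j) // ltnS (leq_trans _ (d_le j)) // pivot_leq.
Qed.

Lemma tangent_support (H H' D : 'M[F]_(p, N)) :
  colsub d H = 1%:M -> standard_schubert c H ->
  colsub d H' = 1%:M -> standard_schubert c H' -> colsub d D = 0 ->
  (forall j : 'I_p, weak_tangent j.+1 H H' (pid_mx (c j).+1) D) -> strip_support d c D.
Proof.
move=> dH cH dH' cH' dD hD i q nq Diq diq; rewrite /allowed diq; apply/forallP => j.
apply/implyP => tj; apply/implyP => ij; rewrite leqNgt; apply: contraNN Diq => cq.
have [y [fy yV yD]] := hD j.
have [kH _] := schubert_support dH cH; have [kH' _] := schubert_support dH' cH'.
have cj : (#|[set i | d i < (c j).+1]%N| <= j.+1)%N by rewrite (tight_card d_incr d_le).
apply/eqP; apply: (pid_tangent_vanish dH' fy yV cj (fun i q => kH' j i q tj) dH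
  (fun i q => kH j i q tj) dD yD) => //.
by rewrite ltnS (leq_trans _ (d_le j)) // pivot_leq.
Qed.

Lemma special_excess (H : 'M[F]_(p, N)) : colsub d H = 1%:M -> finmx P H ->
  strip_support d c H -> special_witness upper a s H -> (a <= excess)%N.
Proof.
move=> dH fH sH; rewrite /special_witness; case: upper => [[ap [u [u0 Hu ou]]]|[y [y0 yH]]].
  exact: (upper_excess natK s_fin s_st s_neq0 d_incr c_lt d_le m_gt0 a_gt0 ap dH fH sH u0 Hu ou).
exact: (lower_excess natK s_fin s_st s_neq0 d_incr c_lt d_le dH fH sH y0 yH).
Qed.

(** Dividing [D] by a dominant entry gives a finite direction with an entry 1, whose standard part
    is nonzero. The conditions in [L] pass to it by [limit_tangent]; the flag at 0 needs the special
    condition as well. *)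
Lemma limit_direction (H H' D : 'M[F]_(p, N)) :
  let H0 := stmx P H in
  colsub d H = 1%:M -> finmx P H -> colsub d H' = 1%:M -> finmx P H' -> stmx P H' = H0 ->
  standard_schubert c H -> standard_schubert c H' ->
  special_witness upper a s H -> special_witness upper a s H' ->
  (forall k V, L k V -> (k <= \rank (H :&: map_mx inj V))%N) ->
  exactly L H0 -> (excess <= a)%N ->
  colsub d D = 0 -> D != 0 ->
  (forall j : 'I_p, weak_tangent j.+1 H H' (pid_mx (c j).+1) D) ->
  special_direction upper a s H H' D ->
  (forall k V, L k V -> weak_tangent k H H' (map_mx inj V) D) ->
  exists D0 : 'M[K]_(p, N), [/\ colsub d D0 = 0, D0 != 0,
    forall j : 'I_p, tangent H0 (pid_mx (d j).+1) D0 &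
    forall k V, L k V -> tangent H0 V D0].
Proof.
move=> H0 dH fH dH' fH' sH' cH cH' wH wH' rL eL ea dD D0 tc ts tL.
have fH0 : row_free H0 by apply: (colsub1_row_free (stmx_colsub1 P dH)).
have [x xD] : exists x : 'I_p * 'I_N, D x.1 x.2 != 0.
  move/eqP: D0; apply: contra_notP => h; apply/matrixP=> i q; rewrite mxE.
  by apply/eqP/negPn/negP => Diq; apply: h; exists (i, q).
have [[i q] /= Diq hmax] := max_finite P (x := fun x : 'I_p * 'I_N => D x.1 x.2) xD.
pose E := (D i q)^-1 *: D.
have dE : colsub d E = 0.
  by apply/matrixP=> k l; have /matrixP/(_ k l) := dD; rewrite !mxE => ->; rewrite mulr0.
have fE : finmx P E by move=> k l; rewrite mxE mulrC; apply: (hmax (k, l)).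
have tc' (j : 'I_p) : weak_tangent j.+1 H H' (pid_mx (c j).+1) E by apply: weak_tangentZ.
have ts' : special_direction upper a s H H' E by apply: special_directionZ.
have tL' k V : L k V -> weak_tangent k H H' (map_mx inj V) E.
  by move=> LV; apply/weak_tangentZ/tL.
have [_ suppH] := schubert_support dH cH; have [_ suppH'] := schubert_support dH' cH'.
have suppE := tangent_support dH cH dH' cH' dE tc'.
(* Here the special condition upgrades tangency for the last columns [c] to tangency for the smaller
   last columns [d]. *)
have E0 k (l : 'I_N) : (d k < l)%N -> st P (E k l) = 0.
  move: ts' wH wH'; rewrite /special_direction /special_witness; case: upper.
    move=> [u [v [u0 Hu ou ov e]]] [ap _] [_ [u' [u0' Hu' ou']]].
    exact: (upper_direction natK s_fin s_st s_neq0 d_incr c_lt d_le m_gt0 a_gt0 ap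
      dH fH suppH dH' fH' suppH' dE fE suppE ea u0 Hu ou u0' Hu' ou' ov e).
  move=> [y' [y0' yH' yD]] [y [y0 yH]] _.
  exact: (lower_direction natK s_fin s_st s_neq0 d_incr c_lt d_le
      dH fH suppH dH' fH' suppH' dE fE suppE ea y0 yH y0' yH' yD).
have dsE : colsub d (stmx P E) = 0 by rewrite -stmx_colsub dE stmx0.
exists (stmx P E); split=> //.
- apply/eqP => /matrixP/(_ i q); rewrite !mxE mulVf // st1 => /eqP.
  by rewrite oner_eq0.
- move=> j y yV; apply: (submx_trans _ (addsmxSl _ _)).
  apply/sub_pid_mxP => k l dl; rewrite mxE; apply: big1 => i' _.
  have [di|dj] := leqP (d j).+1 (d i').
    by rewrite (pid_coef0 (stmx_colsub1 P dH) yV) ?mul0r.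
  by rewrite mxE E0 ?mulr0 //; apply: leq_trans dl.
- move=> k V LV; apply: limit_tangent (tL' _ _ LV) => //; first exact: eL.
  exact: rL.
Qed.

End Normalized.

Lemma limit_position (H : 'M[F]_(p, N)) : row_free H ->
  standard_schubert c H -> special_witness upper a s H ->
  (forall k V, L k V -> (k <= \rank (H :&: map_mx inj V))%N) ->
  exists A (d : 'I_p -> 'I_N), let H0 := stmx P (A *m H) in
  [/\ A \in unitmx, {homo d : i j / (i < j)%N}, colsub d (A *m H) = 1%:M &
      finmx P (A *m H)] /\
  [/\ (forall j, d j <= c j)%N, row_free H0, standard_schubert (fun j => d j) H0,
      satisfies L H0 & (a <= \sum_j (c j - d j))%N].
Proof.
move=> fH cH wH rL; have [A [d [uA d_incr dH fAH eH]]] := normalize P fH.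
exists A, d; rewrite /=; split=> //.
have dH0 := stmx_colsub1 P dH.
have fH0 := colsub1_row_free dH0.
have eqA := eqmx_unit H uA.
have cAH : standard_schubert c (A *m H).
  by move=> j; rewrite (cap_eqmx eqA (eqmx_refl _)).
have cH0 : standard_schubert c (stmx P (A *m H)).
  by move=> j; apply: limit_condition => //; rewrite map_pid_mx; apply: cAH.
have d_le := echelon_pivot_le d_incr dH0 cH0.
split=> //; first exact: echelon_standard_schubert.
  move=> k V LV; apply: limit_condition => //.
  by rewrite (cap_eqmx eqA (eqmx_refl _)); apply: rL.
have [_ supp] := schubert_support d_incr d_le dH cAH.
by apply: (special_excess d_incr d_le dH fAH supp); apply: special_witness_change.
Qed.

End StepOverField.

Lemma mulmx_col (R : pzRingType) a b c (A : 'M[R]_(a, b)) (B : 'M_(b, c)) j :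
  A *m col j B = col j (A *m B).
Proof. by rewrite !colE mulmxA. Qed.

(** * Transfer to the ultrapower *)

Section Transfer.
Variables (U : set_system nat) (UU : UltraFilter U) (K : fieldType).
Local Notation germ := (germ UU).
Local Notation germ_mx := (germ_mx UU).

(** Facts about rank are transferred through witnesses of matrix equations, here a right inverse,
    since equations may be checked termwise. *)
Lemma germ_row_free a b (A : nat -> 'M[K]_(a, b)) : (forall n, row_free (A n)) ->
  row_free (germ_mx A).
Proof.
move=> h; have /choice[B hB] : forall n, exists B, A n *m B = 1%:M.
  by move=> n; have /row_freeP := h n.
apply/row_freeP; exists (germ_mx B); rewrite germ_mxM -germ_mx1.
by congr germ_mx; apply: funext => n; apply: hB.
Qed.

Lemma germ_submx a b c (A : nat -> 'M[K]_(a, c)) (B : nat -> 'M[K]_(b, c)) :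
  (forall n, (A n <= B n)%MS) -> (germ_mx A <= germ_mx B)%MS.
Proof.
move=> h; have /choice[D hD] : forall n, exists D, A n = D *m B n.
  by move=> n; have /submxP := h n.
suff -> : germ_mx A = germ_mx D *m germ_mx B by apply: submxMl.
by rewrite germ_mxM; congr germ_mx; apply: funext.
Qed.

Lemma germ_sub_adds a b b' c (A : nat -> 'M[K]_(a, c)) (B : nat -> 'M[K]_(b, c))
  (B' : nat -> 'M[K]_(b', c)) :
  (forall n, (A n <= B n + B' n)%MS) -> (germ_mx A <= germ_mx B + germ_mx B')%MS.
Proof.
move=> h; have /choice[D hD] : forall n, exists D, A n = D.1 *m B n + D.2 *m B' n.
  by move=> n; have /sub_addsmxP := h n.
suff -> : germ_mx A = germ_mx (fun n => (D n).1) *m germ_mx B +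
    germ_mx (fun n => (D n).2) *m germ_mx B' by apply: addmx_sub_adds; apply: submxMl.
by rewrite !germ_mxM germ_mxD; congr germ_mx; apply: funext.
Qed.

Lemma left_inverse_col b (u : 'cV[K]_b) : u != 0 -> exists z : 'rV_b, z *m u = 1%:M.
Proof.
move=> /cV0Pn[i ui]; exists ((u i 0)^-1 *: delta_mx 0 i).
rewrite -scalemxAl -rowE; apply/matrixP=> k l; rewrite !ord1 !mxE eqxx.
by rewrite mulVf.
Qed.

Lemma germ_neq0 b (u : nat -> 'cV[K]_b) : (forall n, u n != 0) -> germ_mx u != 0.
Proof.
move=> h; have /choice[z hz] : forall n, exists z : 'rV_b, z *m u n = 1%:M.
  by move=> n; apply: left_inverse_col.
have : germ_mx z *m germ_mx u = 1%:M.
  by rewrite germ_mxM -germ_mx1; congr germ_mx; apply: funext.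
by apply: contra_eqN => /eqP->; rewrite mulmx0 eq_sym oner_neq0.
Qed.

Lemma germ_row_neq0 b (y : nat -> 'rV[K]_b) : (forall n, y n != 0) -> germ_mx y != 0.
Proof.
move=> h; apply: contraNneq (@germ_neq0 b (fun n => (y n)^T) _) => [e|n]; last by rewrite trmx_eq0.
apply/eqP/matrixP => i j; have /matrixP/(_ j i) := e; rewrite !mxE => <-.
by congr germ; apply: funext => n; rewrite mxE.
Qed.

(** A negative statement is transferred through a positive witness: a linear form killing [B n] but
    not [A n]. *)
Lemma germ_nsubmx a b c (A : nat -> 'M[K]_(a, c)) (B : nat -> 'M[K]_(b, c)) :
  (forall n, ~~ (A n <= B n)%MS) -> ~~ (germ_mx A <= germ_mx B)%MS.
Proof.
move=> h; have /choice[u hu] : forall n, exists u : 'cV_c, B n *m u = 0 /\ A n *m u != 0.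
  move=> n; have := h n; rewrite submxE => /eqP/matrixP ne.
  have [j Aj] : exists j, A n *m col j (cokermx (B n)) != 0.
    apply: contra_notP ne => ne i j; rewrite [RHS]mxE.
    have [e|e] := eqVneq (A n *m col j (cokermx (B n))) 0; last by case: ne; exists j.
    by have /matrixP/(_ i 0) := e; rewrite mulmx_col !mxE.
  by exists (col j (cokermx (B n))); rewrite mulmx_col mulmx_coker linear0.
have Bu : germ_mx B *m germ_mx u = 0.
  by rewrite germ_mxM -(germ_mx0 UU); congr germ_mx; apply: funext => n; case: (hu n).
have : germ_mx A *m germ_mx u != 0.
  by rewrite germ_mxM; apply: germ_neq0 => n; case: (hu n).
by apply: contra => /submxP[x ->]; rewrite -mulmxA Bu mulmx0.
Qed.

Lemma germ_condition p N a c (H : nat -> 'M[K]_(p, N)) (V : nat -> 'M[K]_(a, N)) :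
  (forall n, row_free (H n)) -> (forall n, (c <= \rank (H n :&: V n))%N) ->
  (c <= \rank (germ_mx H :&: germ_mx V))%N.
Proof.
move=> fH h; have /choice[y hy] : forall n, exists y : 'M_(c, p),
    row_free y /\ (y *m H n <= V n)%MS.
  by move=> n; apply/cap_rank_witness.
apply/cap_rank_witness; first exact: germ_row_free.
exists (germ_mx y); split; first by apply: germ_row_free => n; case: (hy n).
by rewrite germ_mxM; apply: germ_submx => n; case: (hy n).
Qed.

Lemma germ_weak_tangent p N c (H D : nat -> 'M[K]_(p, N)) (V : nat -> 'M[K]_N) :
  (forall n, weak_tangent c (H n) (H n) (V n) (D n)) ->
  weak_tangent c (germ_mx H) (germ_mx H) (germ_mx V) (germ_mx D).
Proof.
move=> /choice[y hy]; exists (germ_mx y); split.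
- by apply: germ_row_free => n; case: (hy n).
- by rewrite germ_mxM; apply: germ_submx => n; case: (hy n).
- by rewrite germ_mxM; apply: germ_sub_adds => n; case: (hy n).
Qed.

Lemma germX (f : nat -> K) k : germ (fun n => f n ^+ k) = germ f ^+ k.
Proof.
elim: k => [|k IH]; first by [].
by rewrite exprS -IH germM; congr germ; apply: funext => n; rewrite exprS.
Qed.

Lemma germ_osc_mx N k (s : nat -> K) :
  germ_mx (fun n => osc_mx N k (s n)) = osc_mx N k (germ s).
Proof.
apply/matrixP=> i j; rewrite [LHS]mxE osc_mxE -germX -(rmorph_nat (const_germ UU (K := K))).
by rewrite germM; congr germ; apply: funext => n; rewrite osc_mxE.
Qed.

Lemma germ_special_witness m p upper a s (H : nat -> 'M[K]_(p, m + p)) :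
  (forall n, special_witness upper a (s n) (H n)) ->
  special_witness upper a (germ s) (germ_mx H).
Proof.
rewrite /special_witness; case: upper => h.
  split; first by case: (h 0).
  have /choice[u hu] := fun n => (h n).2; exists (germ_mx u); split.
  - by apply: germ_neq0 => n; case: (hu n).
  - by rewrite germ_mxM -germ_mx0; congr germ_mx; apply: funext => n; case: (hu n).
  - rewrite -germ_osc_mx germ_mxM -germ_mx0; congr germ_mx; apply: funext => n.
    by case: (hu n).
have /choice[y hy] := h; exists (germ_mx y); split.
  by apply: germ_row_neq0 => n; case: (hy n).
by rewrite germ_mxM -germ_osc_mx; apply: germ_submx => n; case: (hy n).
Qed.

Lemma germ_special_direction m p upper a s (H D : nat -> 'M[K]_(p, m + p)) :
  (forall n, special_direction upper a (s n) (H n) (H n) (D n)) ->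
  special_direction upper a (germ s) (germ_mx H) (germ_mx H) (germ_mx D).
Proof.
rewrite /special_direction; case: upper => h.
  have /choice[u /choice[v huv]] := h; exists (germ_mx u), (germ_mx v).
  rewrite -germ_osc_mx !germ_mxM; split.
  - by apply: germ_neq0 => n; case: (huv n).
  1-3: by rewrite -germ_mx0; congr germ_mx; apply: funext => n; case: (huv n).
  by congr germ_mx; apply: funext => n; case: (huv n).
have /choice[y hy] := h; exists (germ_mx y); rewrite !germ_mxM -germ_osc_mx; split.
- by apply: germ_row_neq0 => n; case: (hy n).
- by apply: germ_submx => n; case: (hy n).
- by apply: germ_sub_adds => n; case: (hy n).
Qed.

End Transfer.

Lemma kermx_image (K : fieldType) a b (M : 'M[K]_(a, b)) (v : 'cV_a) :
  kermx M *m v = 0 -> exists t, v = M *m t.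
Proof.
move=> kv; exists (pinvmx M *m v); apply/eqP; rewrite mulmxA -subr_eq0.
rewrite -{1}[v]mul1mx -mulmxBl; have : (1%:M - M *m pinvmx M <= kermx M)%MS.
  by apply/sub_kermxP; rewrite mulmxBl mul1mx mulmxKpV ?subrr.
by move=> /submxP[x ->]; rewrite -mulmxA kv mulmx0.
Qed.

Section SpecialVariety.
Variables (K : fieldType) (m p : nat) (upper : bool) (a : nat) (s : K).
Local Notation N := (m + p)%N.
Hypotheses (m_gt0 : (0 < m)%N) (a_gt0 : (0 < a)%N).

Definition special_dim := if upper then a else 1%N.
Definition special_space : 'M[K]_N :=
  <<osc_mx N (if upper then m - 1 + a else m + 1 - a)%N s>>%MS.

Lemma special_condition_witness (H : 'M[K]_(p, N)) : row_free H ->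
  (special_dim <= \rank (H :&: special_space))%N -> special_witness upper a s H.
Proof.
move=> fH; rewrite /special_dim /special_space /special_witness; case: upper => h; last first.
  have /(cap_rank_witness _ _ fH)[y [fy yV]] := h.
  exists y; split; last by rewrite genmxE in yV.
  by rewrite -mxrank_eq0 (eqP fy).
split; first by rewrite (leq_trans h) // (leq_trans (mxrankS (capmxSl _ _))) ?rank_leq_row.
set V := osc_mx _ _ _ in h *.
have e := mxrank_sum_cap H V; rewrite (eqP fH) in e.
rewrite (cap_eqmx (eqmx_refl _) (genmxE _)) in h.
(* In the upper case the sum has rank at most p + (m - 1 + a) - a = N - 1. *)
have lt : (\rank (H + V) < N)%N.
  have := rank_leq_row V; move: e h; move: (\rank _) (\rank _) (\rank _) => x y z; lia.
have : cokermx (H + V)%MS != 0.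
  by rewrite -mxrank_eq0 mxrank_coker subn_eq0 -ltnNge.
move=> /matrix0Pn[i [j ij]]; exists (col j (cokermx (H + V)%MS)); split.
- by apply/matrix0Pn; exists i, 0; rewrite mxE.
- by apply/eqP; rewrite mulmx_col (eqP (_ : H *m _ == 0)) ?linear0 // -submxE addsmxSl.
- by apply/eqP; rewrite mulmx_col (eqP (_ : V *m _ == 0)) ?linear0 // -submxE addsmxSr.
Qed.

(** In the upper case [D *m u] = [H *m v] must be solved with v killed by V. The obstruction
    vanishes by [kermx_image]: if a row z sends H into V, tangency puts z D in V + H, which u
    annihilates. *)
Lemma special_tangent_direction (H D : 'M[K]_(p, N)) :
  special_witness upper a s H -> tangent H special_space D ->
  special_direction upper a s H H D.
Proof.
rewrite /special_witness /special_space /tangent /special_direction; case: upper; last first.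
  move=> [y [y0 yH]] /(_ y); rewrite genmxE => /(_ yH) yD; exists y; split=> //.
  by rewrite (adds_eqmx (genmxE _) (eqmx_refl _)) in yD.
set V := osc_mx _ _ _ => -[_ [u [u0 Hu Vu]]] tD.
have [t et] : exists t, D *m u = (H *m cokermx V) *m t.
  apply: kermx_image; apply/row_matrixP => i; rewrite row0 row_mul.
  have : (row i (kermx (H *m cokermx V)) *m H <= <<V>>)%MS.
    rewrite genmxE submxE -mulmxA -row_mul.
    by rewrite mulmx_ker row0.
  move=> /tD /sub_addsmxP[[z1 z2] /= e].
  rewrite mulmxA e mulmxDl -!mulmxA Hu mulmx0 addr0.
  have /submxP[z ->] : (<<V>> <= V)%MS by rewrite genmxE.
  by rewrite -mulmxA Vu !mulmx0.
exists u, (cokermx V *m t); split=> //; first by rewrite mulmxA mulmx_coker mul0mx.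
by rewrite mulmxA et.
Qed.

End SpecialVariety.

Local Open Scope complex_scope.

(** Were there no such bound, each 1 / (n + 1) would provide a bad parameter, and these form a
    sequence tending to 0, whose germ is an infinitesimal. *)
Lemma small_parameter (R : realType) (Q : R -> Prop) :
  (forall s : nat -> R, (forall n, 0 < s n < n.+1%:R^-1) -> exists n, Q (s n)) ->
  exists2 e : R, 0 < e & forall s, 0 < s < e -> Q s.
Proof.
move=> h; apply: contrapT => ne.
have /choice[s hs] : forall n, exists s : R, 0 < s < n.+1%:R^-1 /\ ~ Q s.
  move=> n; apply: contrapT => nn; apply: ne; exists n.+1%:R^-1; first by rewrite invr_gt0 ltr0n.
  by move=> s hs; apply: contrapT => nQ; apply: nn; exists s.
have [n Qn] := h s (fun n => (hs n).1).
by case: (hs n).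
Qed.

Lemma natr_complex_inj (R : realType) : injective (fun n : nat => n%:R : R[i]).
Proof. by move=> x y /eqP; rewrite eqr_nat => /eqP. Qed.

Lemma colsub_residual (K : fieldType) p N (d : 'I_p -> 'I_N) (H B : 'M[K]_(p, N)) :
  colsub d H = 1%:M -> colsub d (B - colsub d B *m H) = 0.
Proof.
move=> dH; have -> : colsub d (B - colsub d B *m H) = colsub d B - colsub d B *m colsub d H.
  by rewrite mulmx_colsub; apply/matrixP=> i j; rewrite !mxE.
by rewrite dH mulmx1 subrr.
Qed.

Lemma colsub1_sub (K : fieldType) p N (d : 'I_p -> 'I_N) (H H' : 'M[K]_(p, N)) :
  colsub d H = 1%:M -> colsub d H' = 1%:M -> colsub d (H' - H) = 0.
Proof.
move=> dH dH'; have -> : colsub d (H' - H) = colsub d H' - colsub d H.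
  by apply/matrixP=> i j; rewrite !mxE.
by rewrite dH dH' subrr.
Qed.

Lemma colsub1_sub_eq (K : fieldType) p N (d : 'I_p -> 'I_N) (H H' : 'M[K]_(p, N)) :
  colsub d H = 1%:M -> colsub d H' = 1%:M -> (H' <= H)%MS -> H' = H.
Proof.
move=> dH dH' HH; apply/eqP; rewrite -subr_eq0; apply/eqP.
by apply: (colsub1_tangent_eq0 dH (colsub1_sub dH dH')); rewrite addmx_sub ?eqmx_opp.
Qed.

Section UltraFacts.
Variables (U : set_system nat) (UU : UltraFilter U).
Hypothesis U_cofinite : (eventually `<=` U)%classic.
Variable R : realType.
Local Notation C := R[i].
Local Notation F := (ultrapower UU C).
Local Notation P := (ultraplace UU R).

Section Infinitesimal.
Variable s : nat -> R.
Hypothesis s_small : forall n, 0 < s n < n.+1%:R^-1.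
Local Notation sF := (germ UU (fun n => (s n)%:C)).

Lemma infinitesimal : [/\ finite P sF, st P sF = 0 & sF != 0].
Proof.
have [h1 h2] : finite P sF /\ st P sF = 0.
  apply: ufinite_germ => _ /pos_complex[e e0 ->].
  apply: U_cofinite; exists (Num.bound e^-1) => // n /= hn.
  have /andP[s0 sn] := s_small n.
  rewrite subr0 normc_def /= expr0n addr0 ltcR sqrtr_sqr gtr0_norm //.
  apply: (lt_trans sn); rewrite -[ltRHS]invrK ltf_pV2 ?posrE ?invr_gt0 ?ltr0n //.
  apply: (lt_le_trans (archi_boundP _)); first by rewrite invr_ge0 ltW.
  by rewrite ler_nat ltnW.
split=> //; apply/eqP => /germ_eq h.
have [n /= hn] := @filter_ex _ _ _ _ h.
have /andP[s0 _] := s_small n; have /eqP := hn.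
by rewrite eq_complex /= eqxx andbT gt_eqF.
Qed.
End Infinitesimal.

(** Conjugation acts termwise and commutes with standard parts, so it carries the normalized form of
    a sequence to that of the conjugate sequence. *)
Definition uconj (x : F) : F := uop1 (@conjc R) x.

Lemma uconj_germ f : uconj (germ UU f) = germ UU (fun n => conjc (f n)).
Proof. exact: germ_op1. Qed.

Fact uconj_is_zmod : zmod_morphism uconj.
Proof.
move=> x y; have [f ->] := germP x; have [g ->] := germP y.
rewrite germN germD !uconj_germ germN germD; congr germ; apply: funext => n.
by rewrite rmorphB.
Qed.
Fact uconj_is_monoid : monoid_morphism uconj.
Proof.
split=> [|x y]; first by rewrite germ1 uconj_germ; congr germ; apply: funext => n; rewrite rmorph1.
have [f ->] := germP x; have [g ->] := germP y.
by rewrite germM !uconj_germ germM; congr germ; apply: funext => n; rewrite rmorphM.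
Qed.
HB.instance Definition _ := GRing.isZmodMorphism.Build F F uconj uconj_is_zmod.
HB.instance Definition _ := GRing.isMonoidMorphism.Build F F uconj uconj_is_monoid.

Lemma uconj_st x : finite P x -> finite P (uconj x) /\ st P (uconj x) = conjc (st P x).
Proof.
move=> fx; have [f ef fc] := @ufiniteP U UU R x fx.
have -> : uconj x = germ UU (fun n => conjc (f n)) by rewrite {1}ef uconj_germ.
apply: ufinite_germ => e e0; apply: filterS (fc e e0) => n /= h.
rewrite -rmorphB /=; apply: le_lt_trans h.
rewrite (_ : `|_| = `|f n - ust x|) //; rewrite !normc_def; congr (Num.sqrt _)%:C.
by case: (f n - ust x) => u v /=; rewrite sqrrN.
Qed.

Lemma germ_mx_conj a b (A : nat -> 'M[C]_(a, b)) :
  germ_mx UU (fun n => map_mx (@conjc R) (A n)) = map_mx uconj (germ_mx UU A).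
Proof.
by apply/matrixP=> i j; rewrite !mxE uconj_germ; congr germ; apply: funext => n; rewrite mxE.
Qed.

Lemma germ_mx_cst a b (V : 'M[C]_(a, b)) : germ_mx UU (fun=> V) = map_mx (cst P) V.
Proof. exact: germ_mx_const. Qed.

End UltraFacts.

Lemma ultrafilter_nat : exists U : set_system nat, exists UU : UltraFilter U,
  (eventually `<=` U)%classic.
Proof. by have [U [UU h]] := ultraFilterLemma eventually_filter; exists U, UU. Qed.

Lemma special_space_real (R : realType) m p upper a (s : R) :
  (map_mx (@conjc R) (special_space m p upper a s%:C) :=: special_space m p upper a s%:C)%MS.
Proof.
rewrite /special_space; set V := osc_mx _ _ _; apply: eqmx_trans (map_genmx _ _) _.
suff -> : map_mx (@conjc R) V = V by apply: eqmx_refl.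
apply/matrixP=> i j; rewrite mxE osc_mxE rmorphM rmorphXn rmorph_nat; congr (_ * _ ^+ _).
by rewrite /= /conjc /= oppr0.
Qed.

(** * One special point tending to 0: emptiness, rigidity and reality *)

Section Step.
Variables (R : realType) (m p : nat).
Local Notation N := (m + p)%N.
Local Notation C := R[i].
Hypothesis m_gt0 : (0 < m)%N.
Variables (c : 'I_p -> nat) (a : nat) (upper : bool) (L : nat -> 'M[C]_N -> Prop).
Hypotheses (c_lt : forall j, (c j < N)%N) (a_gt0 : (0 < a)%N).

Definition step_plane s (H : 'M[C]_(p, N)) :=
  [/\ row_free H, standard_schubert c H,
      (special_dim upper a <= \rank (H :&: special_space m p upper a s))%N &
      satisfies L H].

Section Sequence.
Variables (s : nat -> R) (H : nat -> 'M[C]_(p, N)).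
Hypotheses (s_small : forall n, 0 < s n < n.+1%:R^-1).
Hypotheses (H_step : forall n, step_plane (s n)%:C (H n)).
Variables (U : set_system nat) (UU : UltraFilter U).
Hypothesis U_cofinite : (eventually `<=` U)%classic.
Local Notation P := (ultraplace UU R).
Local Notation sF := (germ UU (fun n => (s n)%:C)).
Local Notation HF := (germ_mx UU H).

Lemma step_germ : [/\ row_free HF, standard_schubert c HF, special_witness upper a sF HF &
  forall k V, L k V -> (k <= \rank (HF :&: map_mx (cst P) V))%N].
Proof.
have fH n : row_free (H n) by case: (H_step n).
split; first exact: germ_row_free.
- move=> j; rewrite -(map_pid_mx (cst P)) -germ_mx_cst.
  by apply: germ_condition => // n; case: (H_step n).
- by apply: germ_special_witness => n; case: (H_step n) => *; apply: special_condition_witness.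
- move=> k V LV; rewrite -germ_mx_cst.
  by apply: germ_condition => // n; case: (H_step n) => _ _ _; apply.
Qed.
End Sequence.

Lemma step_empty :
  (forall (d : 'I_p -> 'I_N) H0, {homo d : i j / (i < j)%N} -> (forall j, d j <= c j)%N ->
     row_free H0 -> standard_schubert (fun j => d j) H0 -> satisfies L H0 ->
     ~ (a <= \sum_j (c j - d j))%N) ->
  exists2 e : R, 0 < e & forall s, 0 < s < e -> forall H, ~ step_plane s%:C H.
Proof.
move=> IH; apply: small_parameter => s s_small; apply: contrapT => nh.
have /choice[H H_step] : forall n, exists H, step_plane (s n)%:C H.
  move=> n; apply: contrapT => nH; apply: nh; exists n => H Hn; apply: nH.
  by exists H.
have [U [UU Uc]] := ultrafilter_nat.
have [fH cH wH rH] := step_germ H_step UU.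
have [s_fin s_st s_neq0] := infinitesimal UU Uc s_small.
have [A [d [[uA d_incr dH fAH] [d_le fH0 cH0 LH0 ae]]]] :=
  limit_position (@natr_complex_inj R) s_fin s_st s_neq0 m_gt0 c_lt a_gt0 fH cH wH rH.
exact: (IH d _ d_incr d_le fH0 cH0 LH0).
Qed.

Hypothesis IH : forall (d : 'I_p -> 'I_N) H0, {homo d : i j / (i < j)%N} ->
  (forall j, d j <= c j)%N ->
  row_free H0 -> standard_schubert (fun j => d j) H0 -> satisfies L H0 ->
  (a <= \sum_j (c j - d j))%N ->
  [/\ (\sum_j (c j - d j) <= a)%N, exactly L H0,
    forall D, (forall j : 'I_p, tangent H0 (pid_mx (d j).+1) D) ->
      (forall k V, L k V -> tangent H0 V D) -> (D <= H0)%MS &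
    (map_mx (@conjc R) H0 <= H0)%MS].

Section Limit.
Variables (s : nat -> R) (H : nat -> 'M[C]_(p, N)).
Hypotheses (s_small : forall n, 0 < s n < n.+1%:R^-1).
Hypotheses (H_step : forall n, step_plane (s n)%:C (H n)).
Variables (U : set_system nat) (UU : UltraFilter U).
Hypothesis U_cofinite : (eventually `<=` U)%classic.
Local Notation P := (ultraplace UU R).
Local Notation sF := (germ UU (fun n => (s n)%:C)).
Local Notation HF := (germ_mx UU H).

(* By rigidity at the limit plane, all planes of the sequence having the limit of
   the normalized A *m HF agree with it, and so do the tangent directions. *)
Lemma step_limit : exists A (d : 'I_p -> 'I_N), let G := A *m HF in
  [/\ A \in unitmx, colsub d G = 1%:M, finmx P G,
      (map_mx (@conjc R) (stmx P G) <= stmx P G)%MS &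
    forall G' D, colsub d G' = 1%:M -> finmx P G' -> stmx P G' = stmx P G ->
      standard_schubert c G' -> special_witness upper a sF G' -> colsub d D = 0 ->
      (forall j : 'I_p, weak_tangent j.+1 G G' (pid_mx (c j).+1) D) ->
      special_direction upper a sF G G' D ->
      (forall k V, L k V -> weak_tangent k G G' (map_mx (cst P) V) D) -> D = 0].
Proof.
have [fH cH wH rH] := step_germ H_step UU.
have [s_fin s_st s_neq0] := infinitesimal UU U_cofinite s_small.
have [A [d [[uA d_incr dH fAH] [d_le fH0 cH0 LH0 ae]]]] :=
  limit_position (@natr_complex_inj R) s_fin s_st s_neq0 m_gt0 c_lt a_gt0 fH cH wH rH.
have [ea eL IHt IHr] := IH d_incr d_le fH0 cH0 LH0 ae.
exists A, d; split; [exact: uA|exact: dH|exact: fAH|exact: IHr|].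
move=> G' D dG' fG' sG' cG' wG' dD tc ts tL.
have eqA := eqmx_unit HF uA.
have cAH : standard_schubert c (A *m HF).
  by move=> j; rewrite (cap_eqmx eqA (eqmx_refl _)).
have rAH k V : L k V -> (k <= \rank (A *m HF :&: map_mx (cst P) V))%N.
  by move=> LV; rewrite (cap_eqmx eqA (eqmx_refl _)); apply: (rH k V LV).
apply/eqP/negPn/negP => D0.
have [D1 [dD1 D1n tD1 tLD1]] := limit_direction (@natr_complex_inj R) s_fin s_st s_neq0 m_gt0
  c_lt a_gt0 d_incr d_le dH fAH dG' fG' sG' cAH cG' (special_witness_change uA wH) wG' rAH eL ea
  dD D0 tc ts tL.
by case/eqP: D1n; apply: (colsub1_tangent_eq0 (stmx_colsub1 P dH) dD1); apply: IHt.
Qed.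

End Limit.

Lemma step_tangent : exists2 e : R, 0 < e & forall s, 0 < s < e -> forall H,
  step_plane s%:C H -> forall D, (forall j : 'I_p, tangent H (pid_mx (c j).+1) D) ->
  tangent H (special_space m p upper a s%:C) D ->
  (forall k V, L k V -> tangent H V D) -> (D <= H)%MS.
Proof.
apply: small_parameter => s s_small; apply: contrapT => nh.
have /choice[HD hHD] : forall n, exists HD : 'M[C]_(p, N) * 'M[C]_(p, N),
    step_plane (s n)%:C HD.1 /\
    [/\ forall j : 'I_p, tangent HD.1 (pid_mx (c j).+1) HD.2,
      tangent HD.1 (special_space m p upper a (s n)%:C) HD.2,
      (forall k V, L k V -> tangent HD.1 V HD.2) & ~~ (HD.2 <= HD.1)%MS].
  move=> n; apply: contrapT => nH; apply: nh; exists n => H Hn D D1 D2 D3.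
  by apply/negPn/negP => ns; apply: nH; exists (H, D).
pose H n := (HD n).1; pose D n := (HD n).2.
have H_step n : step_plane (s n)%:C (H n) by case: (hHD n).
have fHn n : row_free (H n) by case: (H_step n).
have [U [UU Uc]] := ultrafilter_nat.
pose P := ultraplace UU R.
have [fH cH wH rH] := step_germ H_step UU.
have [A [d [uA dH fAH _ rig]]] := step_limit s_small H_step UU Uc.
set HF := germ_mx UU H in fH cH wH rH dH fAH rig *.
pose DF := germ_mx UU D.
have wtc (j : 'I_p) : weak_tangent j.+1 HF HF (pid_mx (c j).+1) DF.
  rewrite -(map_pid_mx (cst P)) -germ_mx_cst; apply: germ_weak_tangent => n.
  apply: tangent_weak_tangent => //; first by case: (H_step n).
  by case: (hHD n) => _ [].
have wtL k V : L k V -> weak_tangent k HF HF (map_mx (cst P) V) DF.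
  move=> LV; rewrite -germ_mx_cst; apply: germ_weak_tangent => n.
  apply: tangent_weak_tangent => //; first by case: (H_step n) => _ _ _; apply.
  by case: (hHD n) => _ [_ _ h _]; apply: h LV.
have wts : special_direction upper a (germ UU (fun n => (s n)%:C)) HF HF DF.
  apply: germ_special_direction => n; apply: special_tangent_direction.
    by case: (H_step n) => *; apply: special_condition_witness.
  by case: (hHD n) => _ [].
have nD : ~~ (DF <= HF)%MS by apply: germ_nsubmx => n; case: (hHD n) => _ [].
pose E := colsub d (A *m DF).
(* A direction counts only modulo the plane. This representative vanishes in the pivot columns, as
   rigidity requires; if it is 0, then [DF] lies in [HF], contrary to [nD]. *)
pose D1 := A *m DF - E *m (A *m HF).
have eqA := eqmx_unit HF uA.
have dD1 : colsub d D1 = 0 by apply: colsub_residual.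
have cAH : standard_schubert c (A *m HF).
  by move=> j; rewrite (cap_eqmx eqA (eqmx_refl _)).
have D10 : D1 = 0.
  exact: (rig _ _ dH fAH erefl cAH (special_witness_change uA wH) dD1
    (fun j => weak_tangent_change E uA uA (wtc j)) (special_direction_change E uA wts)
    (fun k V LV => weak_tangent_change E uA uA (wtL k V LV))).
case/negP: nD; rewrite -(eqmx_unit DF uA) -(subrK (E *m (A *m HF)) (A *m DF)) -/D1 D10 add0r.
by rewrite (submx_trans (submxMl _ _)) // eqA.
Qed.

Hypothesis L_real : forall k V, L k V -> (map_mx (@conjc R) V :=: V)%MS.

Lemma step_plane_conj (s : R) H : step_plane s%:C H -> step_plane s%:C (map_mx (@conjc R) H).
Proof.
have capE (V : 'M[C]_N) : (map_mx (@conjc R) V :=: V)%MS ->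
    \rank (map_mx (@conjc R) H :&: V) = \rank (H :&: V).
  by move=> e; rewrite -(cap_eqmx (eqmx_refl _) e) -(map_capmx (@conjc R)) mxrank_map.
move=> [fH cH sH LH]; split.
- by rewrite row_free_map.
- by move=> j; rewrite capE // map_pid_mx; apply: eqmx_refl.
- by rewrite capE //; apply: special_space_real.
- by move=> k V LV; rewrite capE; [apply: LH|apply: L_real LV].
Qed.

Lemma step_real : exists2 e : R, 0 < e & forall s, 0 < s < e -> forall H,
  step_plane s%:C H -> (map_mx (@conjc R) H <= H)%MS.
Proof.
apply: small_parameter => s s_small; apply: contrapT => nh.
have /choice[H hH] : forall n, exists H : 'M[C]_(p, N),
    step_plane (s n)%:C H /\ ~~ (map_mx (@conjc R) H <= H)%MS.
  move=> n; apply: contrapT => nH; apply: nh; exists n => H Hn.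
  by apply/negPn/negP => ns; apply: nH; exists H.
have H_step n : step_plane (s n)%:C (H n) by case: (hH n).
have H_step' n := step_plane_conj (H_step n).
have [U [UU Uc]] := ultrafilter_nat.
pose P := ultraplace UU R.
have [_ _ wH _] := step_germ H_step UU.
have [_ cH' wH' rH'] := step_germ H_step' UU.
have [A [d [uA dH fAH IHr rig]]] := step_limit s_small H_step UU Uc.
have nH : ~~ (germ_mx UU (fun n => map_mx (@conjc R) (H n)) <= germ_mx UU H)%MS.
  by apply: germ_nsubmx => n; case: (hH n).
rewrite germ_mx_conj in cH' wH' rH' nH.
set HF := germ_mx UU H in wH dH fAH IHr rig cH' wH' rH' nH *.
pose cA := map_mx (@uconj U UU R) A.
have ucA : cA \in unitmx by rewrite map_unitmx.
set HF' := map_mx (@uconj U UU R) HF in cH' wH' rH' nH.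
have eAH : cA *m HF' = map_mx (@uconj U UU R) (A *m HF) by rewrite map_mxM.
have dH' : colsub d (cA *m HF') = 1%:M by rewrite eAH -map_mxsub dH map_mx1.
have fAH' : finmx P (cA *m HF').
  by move=> i j; rewrite eAH mxE; apply: (uconj_st (fAH i j)).1.
(* The limit plane is stable under conjugation by induction, and its basis normalized on the columns
   d is unique; so the two sequences have equal limits as matrices, and their difference is a secant
   to which rigidity applies. *)
have sAH' : stmx P (cA *m HF') = stmx P (A *m HF).
  have e : stmx P (cA *m HF') = map_mx (@conjc R) (stmx P (A *m HF)).
    apply/matrixP=> i j; rewrite eAH [LHS]mxE [X in st P X]mxE [RHS]mxE [X in conjc X]mxE.
    exact: (uconj_st (fAH i j)).2.
  apply: (colsub1_sub_eq (stmx_colsub1 P dH) (stmx_colsub1 P dH')).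
  exact: (eq_ind_r (fun X => (X <= stmx P (A *m HF))%MS) IHr e).
have eqA' := eqmx_unit HF' ucA.
have wAH := special_witness_change uA wH; have wAH' := special_witness_change ucA wH'.
have cAH' : standard_schubert c (cA *m HF').
  by move=> j; rewrite (cap_eqmx eqA' (eqmx_refl _)).
have rAH' k V : L k V -> (k <= \rank (cA *m HF' :&: map_mx (cst P) V))%N.
  by move=> LV; rewrite (cap_eqmx eqA' (eqmx_refl _)); apply: (rH' k V LV).
have D0 : cA *m HF' - A *m HF = 0.
  have fr := colsub1_row_free dH'.
  exact: (rig _ _ dH' fAH' sAH' cAH' wAH' (colsub1_sub dH dH')
    (fun j => secant_weak_tangent (A *m HF) fr (cAH' j)) (special_direction_secant wAH wAH')
    (fun k V LV => secant_weak_tangent (A *m HF) fr (rAH' k V LV))).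
case/negP: nH; rewrite -eqA' -(subrK (A *m HF) (cA *m HF')) D0 add0r.
by rewrite (eqmx_unit HF uA).
Qed.

End Step.

(** * Flags and partitions *)

Section Flags.
Variables (K : fieldType) (p N : nat).

Definition flag_space (E : 'M[K]_N) k : 'M[K]_N := pid_mx k *m E.

Definition rev_mx : 'M[K]_N := \matrix_(i, j) (j == rev_ord i)%:R.

Lemma mul_rev_mx a (V : 'M[K]_(a, N)) i q : (V *m rev_mx) i q = V i (rev_ord q).
Proof.
rewrite mxE (bigD1 (rev_ord q)) //= big1 ?addr0 => [|k kq]; rewrite mxE.
  by rewrite rev_ordK eqxx mulr1.
have [e|_] := eqVneq q (rev_ord k); rewrite ?mulr0 //; case/eqP: kq.
by rewrite e rev_ordK.
Qed.

Lemma rev_mxK : rev_mx *m rev_mx = 1%:M.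
Proof. by apply/matrixP=> i j; rewrite mul_rev_mx !mxE (inj_eq rev_ord_inj) eq_sym. Qed.

Lemma rev_mx_unit : rev_mx \in unitmx.
Proof. by have [] := mulmx1_unit rev_mxK. Qed.

Lemma sub_pid_revP a k (V : 'M[K]_(a, N)) : (k <= N)%N ->
  reflect (forall i (q : 'I_N), (q < N - k)%N -> V i q = 0) (V <= flag_space rev_mx k)%MS.
Proof.
move=> kN; have -> : (V <= flag_space rev_mx k)%MS = (V *m rev_mx <= (pid_mx k : 'M_N))%MS.
  by rewrite -[in RHS](submxMfree _ _ (C := rev_mx)) ?row_free_unit ?rev_mx_unit // -mulmxA rev_mxK mulmx1.
apply: (iffP (sub_pid_mxP _ _)) => h i q hq.
  by rewrite -(rev_ordK q) -mul_rev_mx h //= leq_subRL // addnC -leq_subRL // ltnW.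
by rewrite mul_rev_mx h //=; have := ltn_ord q; lia.
Qed.

Lemma flag_cap_mulr (E A : 'M[K]_N) k (H : 'M[K]_(p, N)) : A \in unitmx ->
  \rank (H :&: flag_space (E *m A) k) = \rank (H *m invmx A :&: flag_space E k).
Proof.
move=> uA; have fA : row_free A by rewrite row_free_unit.
have fA' : row_free (invmx A) by rewrite row_free_unit unitmx_inv.
apply/eqP; rewrite eqn_leq; apply/andP; split.
  rewrite -(mxrankMfree _ fA'); apply/mxrankS/(submx_trans (capmxMr _ _ _)).
  by rewrite /flag_space mulmxA mulmxK.
rewrite -(mxrankMfree _ fA); apply/mxrankS/(submx_trans (capmxMr _ _ _)).
by rewrite mulmxKV // /flag_space mulmxA.
Qed.

Lemma pid_cap_flag (E : 'M[K]_N) k (H : 'M[K]_(p, N)) : E \in unitmx ->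
  \rank (H :&: flag_space E k) = \rank (H *m invmx E :&: (pid_mx k : 'M_N)).
Proof. by move=> uE; rewrite -{1}[E]mul1mx flag_cap_mulr // /flag_space mulmx1. Qed.

Lemma flag_echelon (E : 'M[K]_N) (H : 'M[K]_(p, N)) : E \in unitmx -> row_free H ->
  exists B (d : 'I_p -> 'I_N), let G := B *m (H *m invmx E) in
  [/\ B \in unitmx, {homo d : i j / (i < j)%N}, colsub d G = 1%:M,
      forall i (q : 'I_N), (d i < q)%N -> G i q = 0 &
      forall k, \rank (H :&: flag_space E k) = #|[set i | d i < k]%N|].
Proof.
move=> uE fH; have fHE : row_free (H *m invmx E).
  by rewrite /row_free mxrankMfree // row_free_unit unitmx_inv.
have [B [d [uB d_incr dB eB]]] := echelon fHE.
exists B, d; split=> // k; rewrite pid_cap_flag //.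
rewrite -(cap_eqmx (eqmx_unit _ uB) (eqmx_refl _)); apply/eqP; rewrite eqn_leq pid_cap_rank //=.
by apply: pid_cap_rank_ge => // i q dk kq; apply/eB/(leq_trans dk).
Qed.

End Flags.

Section Partitions.
Variables (m p : nat).
Local Notation N := (m + p)%N.

(** With j counted from 0, condition j concerns the span of the first m + j.+1 - w j coordinate
    vectors, of which this is the last index. *)
Definition last_col (w : 'I_p -> nat) (j : 'I_p) := (m + j - w j)%N.

Lemma last_col_lt w j : (last_col w j < N)%N.
Proof. by rewrite /last_col; have := ltn_ord j; lia. Qed.

Lemma incr_ge (d : 'I_p -> 'I_N) : {homo d : i j / (i < j)%N} ->
  forall i j : 'I_p, (i <= j)%N -> (d i + (j - i) <= d j)%N.
Proof.
move=> d_incr i j ij; move: {2}(j - i)%N (erefl (j - i)%N) => k.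
elim: k j ij => [|k IH] j ij e; first by rewrite e addn0 pivot_leq.
have jp : (j.-1 < p)%N by have := ltn_ord j; lia.
have := IH (Ordinal jp); rewrite /= => /(_ _ _)/[dup].
have h1 : (i <= j.-1)%N by lia.
have h2 : (j.-1 - i = k)%N by lia.
move=> h _; have := h h1 h2; rewrite h2.
have : (d (Ordinal jp) < d j)%N by apply: d_incr => /=; lia.
by rewrite e; lia.
Qed.

Definition position_partition (d : 'I_p -> 'I_N) (j : 'I_p) := (m + j - d j)%N.

Section Position.
Variable d : 'I_p -> 'I_N.
Hypothesis d_incr : {homo d : i j / (i < j)%N}.

Lemma position_bounds (j : 'I_p) : (j <= d j <= m + j)%N.
Proof.
have p0 : (0 < p)%N by apply: leq_trans (ltn_ord j).
have := incr_ge d_incr (i := Ordinal p0) (j := j) (leq0n _).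
have lp : (p.-1 < p)%N by lia.
have := incr_ge d_incr (i := j) (j := Ordinal lp); rewrite /=.
have := ltn_ord (d (Ordinal lp)); have := ltn_ord j.
by move=> h1 h2 h3 h4; have := h3; have := ltn_ord (d j); lia.
Qed.

Lemma position_schubert : schubert_condition m (position_partition d).
Proof.
split=> [j|i j ij]; rewrite /position_partition.
  by have := position_bounds j; lia.
by have := incr_ge d_incr ij; lia.
Qed.

Lemma last_col_position (j : 'I_p) : last_col (position_partition d) j = d j.
Proof. by rewrite /last_col /position_partition; have := position_bounds j; lia. Qed.

(** This translates the excess of the limit echelon form into the increase of codimension of the
    Schubert condition at 0. *)
Lemma position_sum w : (forall j, d j <= last_col w j)%N -> schubert_condition m w ->
  (\sum_j position_partition d j = \sum_j w j + \sum_j (last_col w j - d j))%N.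
Proof.
move=> h [wm _]; rewrite -big_split; apply: eq_bigr => j _ /=.
by have := h j; have := wm j; rewrite /last_col /position_partition; lia.
Qed.

End Position.

Lemma last_col_incr w : schubert_condition m w -> forall i j : 'I_p, (i < j)%N ->
  (last_col w i < last_col w j)%N.
Proof.
move=> [wm wd] i j ij; have := wd i j (ltnW ij); have := wm i; have := wm j.
by rewrite /last_col; lia.
Qed.

End Partitions.

(* A plane with larger incidence than prescribed lies in a smaller Schubert
   variety of the same flag. *)
Lemma schubert_exact (K : fieldType) m p (E : 'M[K]_(m + p)) (H : 'M[K]_(p, m + p))
  (w : 'I_p -> nat) : E \in unitmx -> row_free H -> schubert_condition m w ->
  (forall j : 'I_p, j.+1 <= \rank (H :&: flag_space E (last_col m w j).+1))%N ->
  (forall w', schubert_condition m w' ->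
     (forall j : 'I_p, j.+1 <= \rank (H :&: flag_space E (last_col m w' j).+1))%N ->
     (\sum_j w' j <= \sum_j w j)%N) ->
  exists2 d : 'I_p -> 'I_(m + p), {homo d : i j / (i < j)%N} /\
     (forall j, d j = last_col m w j :> nat) &
    (forall k, \rank (H :&: flag_space E k) = #|[set i | d i < k]%N|).
Proof.
move=> uE fH sw hw maxw; have [B [d [uB d_incr dB eB rd]]] := flag_echelon uE fH.
exists d => //; split=> // j0.
have cardE := position_card d_incr.
have d_le j : (d j <= last_col m w j)%N.
  rewrite leqNgt; apply/negP => dj; have := hw j; rewrite rd leqNgt => /negP; apply.
  rewrite -(cardE j); apply: proper_card; apply/properP; split.
    by apply/fintype.subsetP => i; rewrite !inE; move: dj; lia.
  by exists j; rewrite !inE ?ltnSn //; lia.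
have h : (\sum_j (last_col m w j - d j) <= 0)%N.
  rewrite -(leq_add2l (\sum_j w j)%N) addn0 -(position_sum d_le sw).
  apply: maxw; first exact: position_schubert.
  by move=> j; rewrite last_col_position // rd cardE.
move: h; rewrite leqn0 sum_nat_eq0 => /forallP/(_ j0) /=.
by have := d_le j0; lia.
Qed.

Lemma finite_small (R : realType) (I : finType) (Q : I -> R -> Prop) :
  (forall i, exists2 e : R, 0 < e & forall s, 0 < s < e -> Q i s) ->
  exists2 e : R, 0 < e & forall s, 0 < s < e -> forall i, Q i s.
Proof.
move=> h; suff [e e0 he] : exists2 e : R, 0 < e &
    forall s, 0 < s < e -> forall i, i \in enum I -> Q i s.
  by exists e => // s hs i; apply: (he s hs); rewrite mem_enum.
elim: (enum I) => [|k r [e e0 he]]; first by exists 1.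
have [e' e'0 he'] := h k; exists (Num.min e e'); first by rewrite lt_min e0.
move=> s /andP[s0]; rewrite lt_min => /andP[se se'] j; rewrite inE => /orP[/eqP->|jr].
  by apply: he'; rewrite s0.
by apply: he jr; rewrite s0.
Qed.

(** * Opposite Schubert varieties *)

Section Base.
Variables (K : fieldType) (m p : nat).
Local Notation N := (m + p)%N.

Section Pair.
Variables (w v : 'I_p -> nat) (H : 'M[K]_(p, N)).
Hypotheses (sw : schubert_condition m w) (sv : schubert_condition m v).
Hypotheses (fH : row_free H) (wH : standard_schubert (last_col m w) H).
Hypothesis vH : forall j : 'I_p,
  (j.+1 <= \rank (H :&: flag_space (rev_mx K N) (last_col m v j).+1))%N.

(** Inside the p-dimensional [H] two subspaces of dimensions at least j + 1 and p - j must meet. *)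
Lemma opposite_vector j : exists2 x : 'rV[K]_N, x != 0 & [/\ (x <= H)%MS,
  (x <= (pid_mx (last_col m w j).+1 : 'M_N))%MS &
  (x <= flag_space (rev_mx K N) (last_col m v (rev_ord j)).+1)%MS].
Proof.
set A := (pid_mx _ : 'M[K]_N); set B := flag_space _ _.
have rA : (j.+1 <= \rank (H :&: A))%N := wH j.
have rB : (p - j <= \rank (H :&: B))%N by have := vH (rev_ord j); rewrite /= subnSK.
have : ((H :&: A) :&: (H :&: B))%MS != 0.
  rewrite -mxrank_eq0 -lt0n.
  have e := mxrank_sum_cap (H :&: A)%MS (H :&: B)%MS.
  have le : (\rank ((H :&: A) + (H :&: B))%MS <= p)%N.
    by rewrite -[leqRHS](eqP fH) mxrankS // addsmx_sub !capmxSl.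
  move: e le rA rB; move: (\rank _) (\rank _) (\rank _) (\rank _) => x y z t.
  by have := ltn_ord j; lia.
move=> /rowV0Pn[x]; rewrite !sub_capmx => /andP[/andP[xH xA] /andP[_ xB]] x0.
by exists x.
Qed.

(** The common vector is supported on the columns from j + v (rev_ord j) to m + j - w j, so this
    interval is not empty. When the total codimension is m p every such interval is a single column,
    and [H] is a coordinate plane. *)
Lemma opposite_le j : (w j + v (rev_ord j) <= m)%N.
Proof.
have [x x0 [_ /sub_pid_mxP xw /sub_pid_revP xv]] := opposite_vector j.
rewrite leqNgt; apply/negP => lt; case/eqP: x0; apply/matrixP => i q; rewrite mxE.
have [lq|ql] := leqP (last_col m w j).+1 q; first exact: xw.
apply: xv; first exact: last_col_lt.
have := sw.1 j; have := sv.1 (rev_ord j); have := ltn_ord j; move: ql.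
by rewrite /last_col /=; lia.
Qed.

Lemma opposite_sum : (\sum_j w j + \sum_j v j <= m * p)%N.
Proof.
rewrite [X in (_ + X <= _)%N](reindex_inj rev_ord_inj) -big_split /=.
apply: (@leq_trans (\sum_(j < p) m)); first by apply: leq_sum => j _; apply: opposite_le.
by rewrite sum_nat_const card_ord mulnC.
Qed.

Hypothesis total : (\sum_j w j + \sum_j v j = m * p)%N.

Lemma opposite_eq j : (w j + v (rev_ord j) = m)%N.
Proof.
apply/eqP; rewrite eqn_leq opposite_le leqNgt; apply/negP => lt.
move: total; rewrite [X in (_ + X = _)%N](reindex_inj rev_ord_inj) -big_split /=.
rewrite (bigD1 j) //=.
have : (\sum_(i < p | i != j) (w i + v (rev_ord i)) <= \sum_(i < p | i != j) m)%N.
  by apply: leq_sum => i _; apply: opposite_le.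
have : (\sum_(i < p) m = m * p)%N by rewrite sum_nat_const card_ord mulnC.
rewrite (bigD1 j) //=.
move: (\sum_(i < p | i != j) (w i + v (rev_ord i)))%N (\sum_(i < p | i != j) m)%N => y z.
move: lt; move: (w j) (v (rev_ord j)) (m * p)%N => b c q; lia.
Qed.

Let x (j : 'I_p) : 'I_N := Ordinal (last_col_lt m w j).

Let x_inj : injective x.
Proof.
move=> i j /(congr1 val)/= e; apply/val_inj/eqP.
by have [/(last_col_incr sw)|/(last_col_incr sw)|//] := ltngtP i j; rewrite e ltnn.
Qed.

Lemma opposite_coordinate j : ((delta_mx 0 (x j) : 'rV_N) <= H)%MS.
Proof.
have [z z0 [zH /sub_pid_mxP zw /sub_pid_revP zv]] := opposite_vector j.
have zE : z = z 0 (x j) *: delta_mx 0 (x j).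
  apply/matrixP=> i q; rewrite ord1 !mxE eqxx /=.
  have [->|qx] := eqVneq q (x j); first by rewrite mulr1.
  rewrite mulr0; have [lq|ql] := leqP (last_col m w j).+1 q; first exact: zw.
  apply: zv; first exact: last_col_lt.
  have qw : (q < last_col m w j)%N.
    by rewrite ltn_neqAle -ltnS ql andbT; apply: contraNneq qx => e; apply/eqP/val_inj.
  have := opposite_eq j; move: qw; rewrite /last_col /=; have := ltn_ord j; lia.
have zx : z 0 (x j) != 0 by apply: contraNneq z0 => e; rewrite zE e scale0r.
by rewrite -[delta_mx _ _]scale1r -(mulVf zx) -scalerA -zE scalemx_sub.
Qed.

Let E : 'M[K]_(p, N) := \matrix_(j, q) (q == x j)%:R.

Let rowE j : row j E = delta_mx 0 (x j).
Proof. by apply/matrixP=> i q; rewrite ord1 !mxE eqxx. Qed.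

Let E_free : row_free E.
Proof.
apply: inj_row_free => y /matrixP h; apply/matrixP=> i j; rewrite mxE.
have := h i (x j); rewrite !mxE (bigD1 j) //= big1 ?addr0 => [|k kj].
  by rewrite mxE eqxx mulr1.
by rewrite mxE (inj_eq x_inj) eq_sym (negPf kj) mulr0.
Qed.

Lemma opposite_plane : (H :=: E)%MS.
Proof.
have EH : (E <= H)%MS by apply/row_subP => j; rewrite rowE opposite_coordinate.
have [_ e] := mxrank_leqif_eq EH; apply/eqmx_sym/eqmxP.
by rewrite -e (eqP fH) (eqP E_free).
Qed.

Lemma opposite_real (f : {rmorphism K -> K}) : (map_mx f H <= H)%MS.
Proof.
have /submxP[y Hy] : (H <= E)%MS by rewrite opposite_plane.
have fE : map_mx f E = E by apply/matrixP=> i q; rewrite !mxE rmorph_nat.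
by rewrite Hy map_mxM fE -Hy (submx_trans (submxMl _ _)) // opposite_plane.
Qed.

(** Modulo H, the image of the j-th coordinate vector is represented both by A, supported on columns
    up to [x j], and by B, supported from [x j] on. As A - B lies in the coordinate plane, A and B
    agree outside its columns, which leaves A no room there. *)
Lemma opposite_rigid (D : 'M[K]_(p, N)) :
  (forall j : 'I_p, tangent H (pid_mx (last_col m w j).+1) D) ->
  (forall j : 'I_p, tangent H (flag_space (rev_mx K N) (last_col m v j).+1) D) ->
  (D <= H)%MS.
Proof.
move=> tw tv; have /submxP[Y EY] : (E <= H)%MS by rewrite opposite_plane.
have fY : row_free Y.
  by rewrite /row_free eqn_leq rank_leq_row -{1}(eqP E_free) EY mxrankM_maxl.
have uY : Y \in unitmx by rewrite -row_free_unit.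
have fullY : row_full Y by rewrite row_full_unit.
rewrite -(eqmxMfull D fullY); apply/row_subP => j; rewrite row_mul.
have yE : row j Y *m H = delta_mx 0 (x j) by rewrite -row_mul -EY rowE.
have : (row j Y *m D <= (pid_mx (last_col m w j).+1 : 'M_N) + H)%MS.
  apply: tw; rewrite yE; apply/sub_pid_mxP => i q lq; rewrite mxE ord1 eqxx /=.
  by case: eqP lq => [->|//]; rewrite ltnn.
have : (row j Y *m D <= flag_space (rev_mx K N) (last_col m v (rev_ord j)).+1 + H)%MS.
  apply: tv; rewrite yE; apply/sub_pid_revP; first exact: last_col_lt.
  move=> i q lq; rewrite mxE ord1 eqxx /=; case: eqP lq => [->|//] /=.
  by have := opposite_eq j; rewrite /last_col /=; have := ltn_ord j; lia.
move=> /sub_addsmxP[[b h2] /= eb] /sub_addsmxP[[c h1] /= ec].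
set B := b *m _ in eb; set A := c *m _ in ec.
have /sub_pid_revP B0 : (B <= flag_space (rev_mx K N) (last_col m v (rev_ord j)).+1)%MS.
  exact: submxMl.
have /sub_pid_mxP A0 : (A <= (pid_mx (last_col m w j).+1 : 'M_N))%MS by apply: submxMl.
clearbody A B.
have /submxP[z Az] : (A - B <= E)%MS.
  have -> : A - B = h2 *m H - h1 *m H.
    by apply/eqP; rewrite subr_eq addrAC eq_sym subr_eq addrC -ec eb addrC.
  by rewrite -opposite_plane addmx_sub ?eqmx_opp ?submxMl.
have ABx q : q \notin codom x -> (A - B) 0 q = 0.
  move=> nq; rewrite Az mxE big1 // => k _; rewrite mxE.
  by case: eqP => [e|_]; rewrite ?mulr0 //; case/negP: nq; rewrite e codom_f.
have AE : (A <= E)%MS.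
  have -> : A = (\row_k A 0 (x k)) *m E; last exact: submxMl.
  apply/matrixP=> i q; rewrite ord1 [RHS]mxE.
  have [/codomP[k ->]|nq] := boolP (q \in codom x).
    rewrite (bigD1 k) //= big1 ?addr0 => [|l lk]; rewrite !mxE ?eqxx ?mulr1 //.
    by rewrite (inj_eq x_inj) eq_sym (negPf lk) mulr0.
  rewrite big1 => [|k _]; last first.
    rewrite !mxE; case: eqP => [e|_]; rewrite ?mulr0 //.
    by case/negP: nq; rewrite e codom_f.
  have [lq|ql] := leqP (last_col m w j).+1 q; first exact: A0.
  have := ABx q nq; rewrite !mxE B0 ?subr0 //; first exact: last_col_lt.
  have qx : (q < last_col m w j)%N.
    rewrite ltn_neqAle -ltnS ql andbT; apply: contraNneq nq => e.
    by rewrite (_ : q = x j) ?codom_f //; apply: val_inj.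
  by have := opposite_eq j; move: qx; rewrite /last_col /=; have := ltn_ord j; lia.
by rewrite ec addmx_sub ?submxMl // opposite_plane.
Qed.

End Pair.
End Base.

(** * Induction on the number of special cycles *)

Section Induction.
Variables (R : realType) (m p n : nat).
Local Notation N := (m + p)%N.
Local Notation C := R[i].
Hypothesis m_gt0 : (0 < m)%N.
Variables (a : 'I_n -> nat) (upper : 'I_n -> bool).
Hypothesis a_gt0 : forall i, (0 < a i)%N.

Definition space_at (b : 'I_n -> nat) (s : 'I_n -> R) i : 'M[C]_N :=
  special_space m p (upper i) (b i) (s i)%:C.

Definition remaining (v : 'I_p -> nat) (b : 'I_n -> nat) (k : nat) (s : 'I_n -> R)
    (c : nat) (V : 'M[C]_N) : Prop :=
  (exists j : 'I_p, c = j.+1 /\ V = flag_space (rev_mx C N) (last_col m v j).+1) \/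
  (exists i : 'I_n, [/\ (k <= i)%N, c = special_dim (upper i) (b i) & V = space_at b s i]).

Local Notation tail k b := (\sum_(i < n | k <= i) b i)%N.

(* Excess incidence with the special cycle of codimension a is incidence with the
   one of codimension a + 1, so exactness is the absence of planes for b. *)
Definition incremented (b : 'I_n -> nat) := forall i, b i = a i \/ b i = (a i).+1.

(** This is emptiness of intersections of negative expected dimension, stated as a bound on the
    codimensions of conditions shared by some plane. *)
Definition no_excess_at w v b k s := forall H : 'M[C]_(p, N), row_free H ->
  standard_schubert (last_col m w) H -> satisfies (remaining v b k s) H ->
  (\sum_j w j + \sum_j v j + tail k b <= m * p)%N.

Definition no_excess k s := forall w v b, schubert_condition m w -> schubert_condition m v ->
  incremented b -> no_excess_at w v b k s.

Definition rigid_real_at w v k s := (\sum_j w j + \sum_j v j + tail k a = m * p)%N ->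
  forall H : 'M[C]_(p, N), row_free H ->
  standard_schubert (last_col m w) H -> satisfies (remaining v a k s) H ->
  (forall D, (forall j : 'I_p, tangent H (pid_mx (last_col m w j).+1) D) ->
     (forall c V, remaining v a k s c V -> tangent H V D) -> (D <= H)%MS) /\
  (map_mx (@conjc R) H <= H)%MS.

Definition rigid_real k s := forall w v, schubert_condition m w -> schubert_condition m v ->
  rigid_real_at w v k s.

Lemma incremented_refl : incremented a. Proof. by left. Qed.

Lemma remaining_real v b k s c V : remaining v b k s c V ->
  (map_mx (@conjc R) V :=: V)%MS.
Proof.
case=> [[j [_ ->]]|[i [_ _ ->]]]; last exact: special_space_real.
rewrite /flag_space map_mxM map_pid_mx (_ : map_mx _ (rev_mx C N) = rev_mx C N).
  exact: eqmx_refl.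
by apply/matrixP=> x y; rewrite !mxE rmorph_nat.
Qed.

(** In the upper case the new space contains the old one. In the lower case it has codimension at
    most 1 in the old one, so an intersection of dimension at least 2 still meets it. *)
Lemma special_space_succ u b (x : C) (H : 'M[C]_(p, N)) :
  (special_dim u b < \rank (H :&: special_space m p u b x))%N ->
  (special_dim u b.+1 <= \rank (H :&: special_space m p u b.+1 x))%N.
Proof.
rewrite /special_dim /special_space; case: u => h.
  apply: (leq_trans h); apply: mxrankS; rewrite capmxS // !genmxE.
  apply/row_subP => i; have il : (i < m - 1 + b.+1)%N by have := ltn_ord i; lia.
  have -> : row i (osc_mx N (m - 1 + b) x) = row (Ordinal il) (osc_mx N (m - 1 + b.+1) x).
    by apply/rowP => q; rewrite !mxE.
  exact: row_sub.
set A := (<<_>>%MS : 'M_N) in h; set B := (<<_>>%MS : 'M_N).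
have rAB : (\rank A <= (\rank B).+1)%N.
  have [k0|] := posnP (m + 1 - b)%N.
    rewrite (leq_trans _ (leq0n _)) // /A mxrank_gen.
    by rewrite (leq_trans (rank_leq_row _)) // k0.
  move=> k0; have il : ((m + 1 - b).-1 < m + 1 - b)%N by lia.
  pose r := row (Ordinal il) (osc_mx N (m + 1 - b) x).
  have : (A <= B + r)%MS.
    rewrite genmxE; apply/row_subP => i.
    have [->|ne] := eqVneq i (Ordinal il); first exact: addsmxSr.
    have ib : (i < m + 1 - b.+1)%N.
      have := ltn_ord i; have : (i != (m + 1 - b).-1 :> nat) by apply: contra_neq ne => e; apply: val_inj.
      lia.
    have -> : row i (osc_mx N (m + 1 - b) x) = row (Ordinal ib) (osc_mx N (m + 1 - b.+1) x).
      by apply/rowP => q; rewrite !mxE.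
    by rewrite (submx_trans (row_sub _ _)) // (submx_trans _ (addsmxSl _ _)) ?genmxE.
  move=> /mxrankS/leq_trans; apply; apply: (leq_trans (mxrank_adds_leqif _ _)).
  by rewrite -[leqRHS]addn1 leq_add2l rank_leq_row.
have BA : (B <= A)%MS.
  rewrite !genmxE; apply/row_subP => i; have il : (i < m + 1 - b)%N by have := ltn_ord i; lia.
  have -> : row i (osc_mx N (m + 1 - b.+1) x) = row (Ordinal il) (osc_mx N (m + 1 - b) x).
    by apply/rowP => q; rewrite !mxE.
  exact: row_sub.
have e := mxrank_sum_cap (H :&: A)%MS B.
have le1 : (\rank ((H :&: A) + B)%MS <= \rank A)%N.
  by rewrite mxrankS // addsmx_sub capmxSr.
have le2 : (\rank ((H :&: A) :&: B)%MS <= \rank (H :&: B))%N.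
  by rewrite mxrankS // capmxS // capmxSl.
apply: leq_trans le2.
move: e le1 rAB h.
move: (\rank A) (\rank B) (\rank (H :&: A)) (\rank ((H :&: A) + B)%MS) (\rank ((H :&: A) :&: B)%MS).
move=> x1 x2 x3 x4 x5; lia.
Qed.

Section Exactness.
Variables (k : nat) (s : 'I_n -> R) (w v : 'I_p -> nat) (H : 'M[C]_(p, N)).
Hypotheses (ne : no_excess k s) (sw : schubert_condition m w) (sv : schubert_condition m v).
Hypothesis total : (\sum_j w j + \sum_j v j + tail k a = m * p)%N.
Hypotheses (fH : row_free H) (wH : standard_schubert (last_col m w) H).
Hypothesis LH : satisfies (remaining v a k s) H.

Lemma standard_position : exists2 d : 'I_p -> 'I_N, {homo d : i j / (i < j)%N} /\
  (forall j, d j = last_col m w j :> nat) &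
  (forall l, \rank (H :&: flag_space 1%:M l) = #|[set i | d i < l]%N|).
Proof.
apply: schubert_exact => //; first exact: unitmx1.
  by move=> j; rewrite /flag_space mulmx1; apply: wH.
move=> w' sw' w'H; have := ne sw' sv incremented_refl fH _ LH.
rewrite -total !leq_add2r; apply=> j; have := w'H j.
by rewrite /flag_space mulmx1.
Qed.

Lemma opposite_position : exists2 d : 'I_p -> 'I_N, {homo d : i j / (i < j)%N} /\
  (forall j, d j = last_col m v j :> nat) &
  (forall l, \rank (H :&: flag_space (rev_mx C N) l) = #|[set i | d i < l]%N|).
Proof.
apply: schubert_exact => //; first exact: rev_mx_unit.
  by move=> j; apply: LH; left; exists j.
move=> v' sv' v'H; have := ne sw sv' incremented_refl fH wH.
rewrite -total leq_add2r leq_add2l; apply=> c V; case=> [[j [-> ->]]|h]; first exact: v'H.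
by apply: LH; right.
Qed.

(** A larger intersection with special space i would put [H] in an intersection of total codimension
    m p + 1, obtained by raising [a i] by 1. For the flag at infinity the same is done with a larger
    partition. *)
Lemma remaining_exact : exactly (remaining v a k s) H.
Proof.
move=> c V; case=> [[j [-> ->]]|[i [ki -> ->]]].
  have [d [d_incr dE] rd] := opposite_position.
  by rewrite rd -(position_card d_incr j) dE.
apply/eqP; rewrite eqn_leq LH ?andbT; last by right; exists i.
rewrite leqNgt; apply/negP => lt.
pose b l := if l == i then (a i).+1 else a l.
have ib : incremented b by move=> l; rewrite /b; case: eqP => [->|_]; [right|left].
have := ne sw sv ib fH wH; rewrite -total leqNgt => /(_ _)/negP; apply.
  move=> c' V'; case=> [h|[l [kl -> ->]]]; first by apply: LH; left.
  rewrite /space_at /b; case: eqP => [->|_]; last by apply: LH; right; exists l.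
  exact: special_space_succ.
rewrite ltn_add2l (bigD1 i) //= [ltnRHS](bigD1 i) //= {1}/b eqxx.
suff -> : (\sum_(l < n | (k <= l) && (l != i)) b l = \sum_(l < n | (k <= l) && (l != i)) a l)%N by [].
by apply: eq_bigr => l /andP[_ li]; rewrite /b (negPf li).
Qed.

End Exactness.

Lemma tail_last (b : 'I_n -> nat) : tail n b = 0%N.
Proof. by apply: big_pred0 => i; apply/negbTE; rewrite -ltnNge ltn_ord. Qed.

Lemma no_excess_base s : no_excess n s.
Proof.
move=> w v b sw sv ib H fH wH LH; rewrite tail_last addn0.
by apply: (opposite_sum sw sv fH wH) => j; apply: LH; left; exists j.
Qed.

Lemma rigid_real_base s : rigid_real n s.
Proof.
move=> w v sw sv; rewrite /rigid_real_at tail_last addn0 => total H fH wH LH.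
have vH (j : 'I_p) : (j.+1 <= \rank (H :&: flag_space (rev_mx C N) (last_col m v j).+1))%N.
  by apply: LH; left; exists j.
split; last exact: (opposite_real sw sv fH wH vH total).
move=> D tw tL; apply: (opposite_rigid sw sv fH wH vH total tw) => j.
by apply: (tL j.+1); left; exists j.
Qed.

Lemma remaining_ext v b k s s' : (forall i : 'I_n, (k <= i)%N -> s i = s' i) ->
  remaining v b k s = remaining v b k s'.
Proof.
move=> e; apply: funext => c; apply: funext => V; rewrite /remaining.
congr (_ \/ _); apply: propext; split=> -[i [ki ec eV]]; exists i; split=> //;
  by rewrite eV /space_at e.
Qed.

Lemma no_excess_ext k s s' : (forall i : 'I_n, (k <= i)%N -> s i = s' i) ->
  no_excess k s -> no_excess k s'.
Proof.
move=> e h w v b sw sv ib H fH wH; rewrite -(remaining_ext v b e); exact: h.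
Qed.

Lemma rigid_real_ext k s s' : (forall i : 'I_n, (k <= i)%N -> s i = s' i) ->
  rigid_real k s -> rigid_real k s'.
Proof.
move=> e h w v sw sv total H fH wH; rewrite -(remaining_ext v a e); exact: h.
Qed.

Section InductionStep.
Variables (k : nat) (kn : (k < n)%N) (s : 'I_n -> R).
Hypotheses (IHe : no_excess k.+1 s) (IHr : rigid_real k.+1 s).
Let i0 := Ordinal kn.

Let tail_rec b : tail k b = (b i0 + tail k.+1 b)%N.
Proof.
rewrite (bigD1 i0) //=; congr (_ + _)%N; apply: eq_bigl => i.
by rewrite -val_eqE /= ltn_neqAle eq_sym andbC.
Qed.

Let updated x i := if i == i0 then x else s i.

Let updated_tail x (i : 'I_n) : (k.+1 <= i)%N -> s i = updated x i.
Proof. by rewrite /updated; case: eqP => [->|//]; rewrite ltnn. Qed.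

Let step_plane_of w v b x (H : 'M[C]_(p, N)) : row_free H ->
  standard_schubert (last_col m w) H -> satisfies (remaining v b k (updated x)) H ->
  step_plane (last_col m w) (b i0) (upper i0) (remaining v b k.+1 s) x%:C H.
Proof.
move=> fH wH LH; split=> //.
  apply: (LH _ _); right; exists i0; split=> //.
  by rewrite /space_at /updated eqxx.
rewrite (remaining_ext v b (@updated_tail x)) => c V.
case=> [h|[i [ki -> ->]]]; apply: LH; first by left.
by right; exists i; split=> //; apply: ltnW.
Qed.

(** Emptiness at stage k.+1 is applied to the partition of the limit plane. Against the lower bound
    b i0 for the excess, this is contradictory when the total codimension exceeds m p and forces
    equality when it is m p. *)
Let position_excess w v b (d : 'I_p -> 'I_N) (H0 : 'M[C]_(p, N)) :
  schubert_condition m w -> schubert_condition m v -> incremented b ->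
  {homo d : i j / (i < j)%N} -> (forall j, d j <= last_col m w j)%N ->
  row_free H0 -> standard_schubert (fun j => d j) H0 -> satisfies (remaining v b k.+1 s) H0 ->
  (\sum_j w j + \sum_j (last_col m w j - d j) + \sum_j v j + tail k.+1 b <= m * p)%N.
Proof.
move=> sw sv ib d_incr d_le fH0 cH0 LH0; rewrite -(position_sum d_le sw).
apply: (IHe (position_schubert d_incr) sv ib fH0 _ LH0) => j.
by rewrite last_col_position.
Qed.

Let b_gt0 b : incremented b -> (0 < b i0)%N.
Proof. by move=> ib; case: (ib i0) => -> //; apply: a_gt0. Qed.

Let step_no_excess w v b : schubert_condition m w -> schubert_condition m v ->
  incremented b ->
  exists2 e : R, 0 < e & forall x, 0 < x < e -> no_excess_at w v b k (updated x).
Proof.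
move=> sw sv ib; have [le|lt] := leqP (\sum_j w j + \sum_j v j + tail k b)%N (m * p)%N.
  by exists 1 => // x _ H.
have [d H0 d_incr d_le fH0 cH0 LH0 ae|e e0 he] := step_empty (L := remaining v b k.+1 s)
  m_gt0 (upper i0) (last_col_lt m w) (b_gt0 ib).
  have := position_excess sw sv ib d_incr d_le fH0 cH0 LH0.
  by move: lt ae; rewrite tail_rec; lia.
exists e => // x hx H fH wH LH; case: (he x hx H).
exact: step_plane_of.
Qed.

Let step_rigid_real w v : schubert_condition m w -> schubert_condition m v ->
  exists2 e : R, 0 < e & forall x, 0 < x < e -> rigid_real_at w v k (updated x).
Proof.
move=> sw sv; have [total|nt] := pselect (\sum_j w j + \sum_j v j + tail k a = m * p)%N; last first.
  by exists 1 => // x _ /nt.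
have IH (d : 'I_p -> 'I_N) H0 : {homo d : i j / (i < j)%N} ->
    (forall j, d j <= last_col m w j)%N ->
    row_free H0 -> standard_schubert (fun j => d j) H0 -> satisfies (remaining v a k.+1 s) H0 ->
    (a i0 <= \sum_j (last_col m w j - d j))%N ->
    [/\ (\sum_j (last_col m w j - d j) <= a i0)%N, exactly (remaining v a k.+1 s) H0,
      forall D, (forall j : 'I_p, tangent H0 (pid_mx (d j).+1) D) ->
        (forall k' V, remaining v a k.+1 s k' V -> tangent H0 V D) -> (D <= H0)%MS &
      (map_mx (@conjc R) H0 <= H0)%MS].
  move=> d_incr d_le fH0 cH0 LH0 ae.
  have ex := position_excess sw sv incremented_refl d_incr d_le fH0 cH0 LH0.
  have ea : (\sum_j (last_col m w j - d j) <= a i0)%N.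
    by move: ex total; rewrite tail_rec; lia.
  have sd := position_schubert d_incr.
  have dtotal : (\sum_j position_partition d j + \sum_j v j + tail k.+1 a = m * p)%N.
    by rewrite (position_sum d_le sw); move: total; rewrite tail_rec; lia.
  have dH0 : standard_schubert (last_col m (position_partition d)) H0.
    by move=> j; rewrite last_col_position.
  have [rig real] := IHr sd sv dtotal fH0 dH0 LH0.
  split=> //; first exact: remaining_exact IHe sd sv dtotal fH0 dH0 LH0.
  by move=> D hD; apply: rig => j; rewrite last_col_position.
have [e e0 he] := step_tangent m_gt0 (upper i0) (last_col_lt m w) (b_gt0 incremented_refl) IH.
have [e' e'0 he'] := step_real m_gt0 (upper i0) (last_col_lt m w) (b_gt0 incremented_refl) IH
  (@remaining_real v a k.+1 s).
exists (Num.min e e'); first by rewrite lt_min e0.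
move=> x /andP[x0]; rewrite lt_min => /andP[xe xe'] _ H fH wH LH.
have sH := step_plane_of fH wH LH.
split; last by apply: (he' x _ H sH); rewrite x0.
move=> D tw tL; apply: (he x _ H sH D tw); first by rewrite x0.
  apply: (tL (special_dim (upper i0) (a i0))); right; exists i0; split=> //.
  by rewrite /space_at /updated eqxx.
rewrite (remaining_ext v a (@updated_tail x)) => c V.
case=> [h|[i [ki ec eV]]]; apply: (tL c); first by left.
by right; exists i; split=> //; apply: ltnW.
Qed.

(** Partitions bounded by m and increments by 0 or 1 form a finite set, coded by finite functions,
    so one bound on the new parameter serves all of them and the point does not depend on [w],
    [v]. *)
Lemma induction_step : exists s' : 'I_n -> R,
  [/\ forall i : 'I_n, (k.+1 <= i)%N -> s i = s' i, no_excess k s' & rigid_real k s'].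
Proof.
pose fw (f : {ffun 'I_p -> 'I_m.+1}) j : nat := f j.
pose fb (f : {ffun 'I_n -> bool}) i := (a i + f i)%N.
have fwE w : schubert_condition m w -> exists f, w = fw f.
  move=> [wm _]; exists [ffun j => inord (w j)]; apply: funext => j.
  by rewrite /fw ffunE inordK // ltnS.
have fbE b : incremented b -> exists f, b = fb f.
  move=> ib; exists [ffun i => b i == (a i).+1]; apply: funext => i.
  by rewrite /fb ffunE; case: (ib i) => ->; case: eqP; lia.
have ifb f : incremented (fb f).
  by move=> i; rewrite /fb; case: (f i); [right; rewrite addn1|left; rewrite addn0].
have [e e0 he] : exists2 e : R, 0 < e & forall x, 0 < x < e ->
    forall f : {ffun 'I_p -> 'I_m.+1} * {ffun 'I_p -> 'I_m.+1} * {ffun 'I_n -> bool},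
    schubert_condition m (fw f.1.1) -> schubert_condition m (fw f.1.2) ->
    no_excess_at (fw f.1.1) (fw f.1.2) (fb f.2) k (updated x) /\
    rigid_real_at (fw f.1.1) (fw f.1.2) k (updated x).
  apply: finite_small => f.
  have [sw|nsw] := pselect (schubert_condition m (fw f.1.1)); last by exists 1 => // x _ /nsw.
  have [sv|nsv] := pselect (schubert_condition m (fw f.1.2)); last by exists 1 => // x _ _ /nsv.
  have [e e0 he] := step_no_excess sw sv (ifb f.2).
  have [e' e'0 he'] := step_rigid_real sw sv.
  exists (Num.min e e'); first by rewrite lt_min e0.
  move=> x /andP[x0]; rewrite lt_min => /andP[xe xe'] _ _.
  by split; [apply: he|apply: he']; rewrite x0.
have xe : 0 < e / 2 < e by apply/andP; split; lra.
exists (updated (e / 2)); split; first exact: updated_tail.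
- move=> w v b sw sv ib; have [f ef] := fwE _ sw; have [g eg] := fwE _ sv.
  have [h eh] := fbE _ ib; move: sw sv; rewrite ef eg eh => sw sv.
  exact: (he _ xe (f, g, h) sw sv).1.
- move=> w v sw sv; have [f ef] := fwE _ sw; have [g eg] := fwE _ sv.
  have [h _] := fbE _ incremented_refl; move: sw sv; rewrite ef eg => sw sv.
  exact: (he _ xe (f, g, h) sw sv).2.
Qed.

End InductionStep.

(** Parameters are fixed from the last index downwards. A stage k' depends only on those of index at
    least k', so later choices do not disturb it. *)
Lemma special_points_from k : (k <= n)%N -> exists s : 'I_n -> R, forall k', (n - k <= k' <= n)%N ->
  no_excess k' s /\ rigid_real k' s.
Proof.
elim: k => [|k IH] kn.
  exists (fun=> 0) => k'; rewrite subn0 => /anti_leq <-.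
  by split; [exact: no_excess_base|exact: rigid_real_base].
have [s hs] := IH (ltnW kn).
have k1n : (n - k.+1 < n)%N by lia.
have e1 : (n - k.+1).+1 = (n - k)%N by lia.
have [he hr] : no_excess (n - k.+1).+1 s /\ rigid_real (n - k.+1).+1 s.
  by rewrite e1; apply: hs; lia.
have [s' [ss' he' hr']] := induction_step k1n he hr.
exists s' => k'; rewrite leq_eqVlt => /andP[/orP[/eqP<-//|lt] le].
have [he1 hr1] : no_excess k' s /\ rigid_real k' s by apply: hs; lia.
have ss (i : 'I_n) : (k' <= i)%N -> s i = s' i by move=> ki; apply: ss'; apply: leq_trans ki.
by split; [exact: no_excess_ext he1|exact: rigid_real_ext hr1].
Qed.

Lemma special_points : exists s : 'I_n -> R, forall k, (k <= n)%N ->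
  no_excess k s /\ rigid_real k s.
Proof.
have [s hs] := special_points_from (leqnn n).
by exists s => k kn; apply: hs; rewrite subnn.
Qed.

End Induction.

(** * Tangent spaces in charts of the Grassmannian *)

Section PolynomialFunctions.
Variables (C : fieldType) (p m : nat).
Local Notation poly_fun := (mpoly.mpoly (p * m) C).
Implicit Types (f g : poly_fun) (X : 'M[C]_(p, m)) (xi : 'rV[C]_(p * m)).

Definition generic k : poly_fun := mpoly.mpolyX C (mpoly.mnm1 k).

Lemma mpoly_ring_ind (Q : poly_fun -> Prop) :
  (forall c, Q (mpoly.mpolyC _ c)) -> (forall k, Q (generic k)) ->
  (forall f g, Q f -> Q g -> Q (f + g)) -> (forall f g, Q f -> Q g -> Q (f * g)) ->
  forall f, Q f.
Proof.
move=> QC QX QD QM; apply: mpoly.mpolyind => [|c u f _ _ Qf].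
  by have := QC 0; rewrite rmorph0.
apply: (QD) Qf; rewrite -mpoly.mul_mpolyC; apply: (QM); first exact: QC.
rewrite mpoly.mpolyXE_id; apply: (big_ind Q) => [||i _]; [by have := QC 1; rewrite rmorph1|exact: QM|].
elim: (u i) => [|e IH]; first by rewrite expr0; have := QC 1; rewrite rmorph1.
by rewrite exprS; apply: (QM) => //; apply: QX.
Qed.

Lemma pevalD f g X : peval (f + g) X = peval f X + peval g X.
Proof. exact: rmorphD. Qed.
Lemma pevalM f g X : peval (f * g) X = peval f X * peval g X.
Proof. exact: rmorphM. Qed.
Lemma pevalC c X : peval (mpoly.mpolyC _ c) X = c.
Proof. exact: mpoly.mevalC. Qed.
Lemma peval_generic k X : peval (generic k) X = mxvec X 0 k.
Proof. exact: mpoly.mevalXU. Qed.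

Definition dir_deriv (xi : 'rV[C]_(p * m)) f : C := (gradient0 f *m xi^T) 0 0.

Lemma dir_derivE xi f : dir_deriv xi f = \sum_k peval (mpoly.mderiv k f) 0 * xi 0 k.
Proof. by rewrite /dir_deriv mxE; apply: eq_bigr => k _; rewrite !mxE. Qed.

Lemma dir_derivD xi f g : dir_deriv xi (f + g) = dir_deriv xi f + dir_deriv xi g.
Proof.
rewrite !dir_derivE -big_split; apply: eq_bigr => k _ /=.
by rewrite raddfD pevalD mulrDl.
Qed.

Lemma dir_derivM xi f g :
  dir_deriv xi (f * g) = dir_deriv xi f * peval g 0 + peval f 0 * dir_deriv xi g.
Proof.
rewrite !dir_derivE mulr_suml mulr_sumr -big_split; apply: eq_bigr => k _ /=.
by rewrite mpoly.mderivM pevalD !pevalM; ring.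
Qed.

Lemma dir_derivC xi c : dir_deriv xi (mpoly.mpolyC _ c) = 0.
Proof.
rewrite dir_derivE big1 // => k _.
by rewrite mpoly.mderivC /peval rmorph0 mul0r.
Qed.

Lemma dir_deriv_generic xi k : dir_deriv xi (generic k) = xi 0 k.
Proof.
rewrite dir_derivE (bigD1 k) //= big1 ?addr0 => [|l lk].
  rewrite mpoly.mderivX mpoly.mnm1E eqxx scale1r.
  rewrite /peval mpoly.mevalX big1 ?mul1r // => i _.
  by rewrite mpoly.mnmBE subnn expr0.
by rewrite mpoly.mderivX mpoly.mnm1E eq_sym (negPf lk) scale0r /peval rmorph0 mul0r.
Qed.

Lemma dir_deriv_sum xi (I : Type) (r : seq I) (f : I -> poly_fun) :
  dir_deriv xi (\sum_(i <- r) f i) = \sum_(i <- r) dir_deriv xi (f i).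
Proof.
elim: r => [|i r IH]; last by rewrite !big_cons dir_derivD IH.
by rewrite !big_nil -(mpoly.mpolyC0 (p * m) C) dir_derivC.
Qed.

Definition eval_mx a b X (A : 'M[poly_fun]_(a, b)) : 'M[C]_(a, b) :=
  map_mx (mpoly.meval (fun k => mxvec X 0 k)) A.
Definition deriv_mx a b xi (A : 'M[poly_fun]_(a, b)) : 'M[C]_(a, b) :=
  map_mx (dir_deriv xi) A.
Definition cst_mx a b (A : 'M[C]_(a, b)) : 'M[poly_fun]_(a, b) :=
  map_mx (@mpoly.mpolyC (p * m) C) A.
Definition generic_mx : 'M[poly_fun]_(p, m) := vec_mx (\row_k generic k).

Lemma deriv_mxM a b c xi (A : 'M_(a, b)) (B : 'M_(b, c)) :
  deriv_mx xi (A *m B) = deriv_mx xi A *m eval_mx 0 B + eval_mx 0 A *m deriv_mx xi B.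
Proof.
apply/matrixP=> i j; rewrite !mxE dir_deriv_sum -big_split; apply: eq_bigr => k _ /=.
by rewrite dir_derivM !mxE.
Qed.

Lemma eval_mx_cst a b X (A : 'M_(a, b)) : eval_mx X (cst_mx A) = A.
Proof. by apply/matrixP=> i j; rewrite !mxE mpoly.mevalC. Qed.

Lemma deriv_mx_cst a b xi (A : 'M_(a, b)) : deriv_mx xi (cst_mx A) = 0.
Proof. by apply/matrixP=> i j; rewrite !mxE dir_derivC. Qed.

Lemma eval_mx_generic X : eval_mx X generic_mx = X.
Proof.
apply/matrixP=> i j; rewrite !mxE -/(peval _ _) peval_generic.
by rewrite mxvecE.
Qed.

Lemma deriv_mx_generic xi : deriv_mx xi generic_mx = vec_mx xi.
Proof. by apply/matrixP=> i j; rewrite !mxE dir_deriv_generic. Qed.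

End PolynomialFunctions.

Lemma complementary_free (C : fieldType) p m (H : 'M[C]_(p, m + p)) N0 :
  complementary H N0 -> row_free (col_mx H N0).
Proof. by rewrite /complementary /row_full /row_free => /eqP->; rewrite addnC. Qed.

Section AdaptedChart.
Variables (C : fieldType) (p m : nat).
Hypothesis natC : injective (fun n : nat => n%:R : C).
Local Notation N := (m + p)%N.
Local Notation poly_fun := (mpoly.mpoly (p * m) C).

Lemma poly_eq0_of_vanish (f g : {poly C}) :
  g != 0 -> (forall t, g.[t] != 0 -> f.[t] = 0) -> f = 0.
Proof.
move=> g0 h; suff : f * g = 0 by move/eqP; rewrite mulf_eq0 (negPf g0) orbF => /eqP.
apply: (@roots_geq_poly_eq0 _ _ [seq n%:R | n <- iota 0 (size (f * g))]).
- apply/allP => t _; rewrite rootE hornerM mulf_eq0.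
  by case: (eqVneq g.[t] 0) => [/eqP gt|/h/eqP ft]; rewrite ?gt ?ft ?orbT.
- by rewrite map_inj_uniq ?iota_uniq.
- by rewrite size_map size_iota.
Qed.

(* First order expansion along the rational curve t Y(t) / delta(t). *)
Lemma curve_expansion (delta : {poly C}) (Y : 'M[{poly C}]_(p, m)) (xi : 'rV[C]_(p * m)) :
  (forall i j, (Y i j).[0] = delta.[0] * vec_mx xi i j) ->
  forall f : poly_fun, exists e (r : {poly C}), forall t, delta.[t] != 0 ->
    delta.[t] ^+ e * (peval f (\matrix_(i, j) (t * (Y i j).[t] / delta.[t]))
       - peval f 0 - t * dir_deriv xi f) = t ^+ 2 * r.[t].
Proof.
move=> Y0; apply: mpoly_ring_ind.
- by move=> c; exists 0%N, 0 => t _; rewrite !pevalC dir_derivC horner0; ring.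
- move=> k; have [i j] := mxvec_indexP k.
  have /factor_theorem[r er] : root (Y i j - delta * (vec_mx xi i j)%:P) 0.
    by rewrite rootE !hornerE Y0 subrr.
  exists 1%N, r => t dt; rewrite !peval_generic dir_deriv_generic !mxvecE !mxE.
  have := congr1 (horner^~ t) er; rewrite !hornerE !mxE subr0 => e'.
  have -> : (Y i j).[t] = r.[t] * t + delta.[t] * xi 0 (mxvec_index i j).
    by rewrite -e' subrK.
  by field.
- move=> f g [e1 [r1 h1]] [e2 [r2 h2]].
  exists (e1 + e2)%N, (delta ^+ e2 * r1 + delta ^+ e1 * r2) => t dt.
  have := h1 t dt; have := h2 t dt; rewrite !pevalD dir_derivD !hornerE exprD.
  set F := peval f _; set G := peval g _ => e2E e1E.
  transitivity (delta.[t] ^+ e2 * (delta.[t] ^+ e1 * (F - peval f 0 - t * dir_deriv xi f))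
    + delta.[t] ^+ e1 * (delta.[t] ^+ e2 * (G - peval g 0 - t * dir_deriv xi g))); first by ring.
  by rewrite e1E e2E; ring.
- move=> f g [e1 [r1 h1]] [e2 [r2 h2]].
  pose c x : {poly C} := x%:P.
  exists (e1 + e2)%N, (delta ^+ (e1 + e2) * c (dir_deriv xi f * dir_deriv xi g)
    + delta ^+ e2 * r1 * (c (peval g 0) + 'X * c (dir_deriv xi g))
    + delta ^+ e1 * r2 * (c (peval f 0) + 'X * c (dir_deriv xi f)) + 'X ^+ 2 * r1 * r2) => t dt.
  rewrite !pevalM dir_derivM.
  have := h1 t dt; have := h2 t dt; rewrite /c !(hornerD, hornerM, horner_exp, hornerC, hornerX).
  set F := peval f _; set G := peval g _; set F0 := peval f 0; set G0 := peval g 0.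
  set F1 := dir_deriv xi f; set G1 := dir_deriv xi g => e2E e1E.
  rewrite exprD.
  transitivity (delta.[t] ^+ e1 * delta.[t] ^+ e2 * t ^+ 2 * F1 * G1
    + delta.[t] ^+ e2 * (G0 + t * G1) * (delta.[t] ^+ e1 * (F - F0 - t * F1))
    + delta.[t] ^+ e1 * (F0 + t * F1) * (delta.[t] ^+ e2 * (G - G0 - t * G1))
    + (delta.[t] ^+ e1 * (F - F0 - t * F1)) * (delta.[t] ^+ e2 * (G - G0 - t * G1))); first by ring.
  by rewrite e1E e2E; ring.
Qed.

(** * From an adapted chart, where the cycle is a coordinate subspace, to any chart *)

Section LinearInChart.
Variables (Z : 'M[C]_(p, N) -> Prop) (H H1 : 'M[C]_(p, N)) (N0 N1 : 'M[C]_(m, N)).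
Variables (B : 'M[C]_p) (Lambda : {set 'I_p * 'I_m}).
Hypothesis Z_eqmx : forall A G, A \in unitmx -> (Z (A *m G) <-> Z G).
Hypotheses (uB : B \in unitmx) (H1E : H1 = B *m H).
Hypotheses (comp0 : complementary H N0) (comp1 : complementary H1 N1).
Hypothesis Z_linear : forall X, Z (H1 + X *m N1) <->
  forall x, x \in Lambda -> X x.1 x.2 = 0.

(* The two charts are related by (1 + B X P) X' = B X Q, where N0 = P H1 + Q N1. *)
Let PQ : {PQ : 'M[C]_(m, p) * 'M[C]_m | N0 = PQ.1 *m H1 + PQ.2 *m N1}.
Proof.
apply: cid; have : (N0 <= H1 + N1)%MS by rewrite addsmxE submx_full.
by move=> /sub_addsmxP[u ->]; exists u.
Qed.
Let P := (sval PQ).1.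
Let Q := (sval PQ).2.
Let N0E : N0 = P *m H1 + Q *m N1. Proof. exact: svalP PQ. Qed.

Let move_chart X : H + X *m N0 = invmx B *m ((1%:M + B *m X *m P) *m H1 + (B *m X *m Q) *m N1).
Proof.
rewrite mulmxDr -!mulmxA (mulmxDl 1%:M) mul1mx mulmxDr H1E mulKmx // -!mulmxA.
rewrite !mulKmx // -addrA; congr (_ + _).
by rewrite {1}N0E mulmxDr H1E !mulmxA.
Qed.

Let Q_unit : Q \in unitmx.
Proof.
rewrite -row_free_unit; apply: inj_row_free => v vQ.
have fr := complementary_free comp0.
have : row_mx (- (v *m P *m B)) v = 0.
  apply: (row_free_inj fr); rewrite mul0mx mul_row_col {1}N0E mulmxDr !mulmxA vQ mul0mx addr0.
  by rewrite mulNmx -!mulmxA -H1E addNr.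
by rewrite -row_mx0 => /eq_row_mx[].
Qed.

Let Z_chart X : 1%:M + B *m X *m P \in unitmx ->
  Z (H + X *m N0) <->
  forall x, x \in Lambda -> (invmx (1%:M + B *m X *m P) *m (B *m X *m Q)) x.1 x.2 = 0.
Proof.
set M := 1%:M + _ => uM; rewrite -Z_linear move_chart.
rewrite (Z_eqmx _ (_ : invmx B \in unitmx)) ?unitmx_inv //.
by rewrite -(Z_eqmx (H1 + _) uM) mulmxDr (mulmxA M) mulKVmx.
Qed.

(** The transition between charts is rational. The adjugate clears denominators: where the
    determinant of [Mx] is nonzero, [Fx] is that determinant times the coordinates in the adapted
    chart. *)
Let Mx : 'M[poly_fun]_p := 1%:M + cst_mx p m B *m generic_mx C p m *m cst_mx p m P.
Let Fx : 'M[poly_fun]_(p, m) := \adj Mx *m (cst_mx p m B *m generic_mx C p m *m cst_mx p m Q).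

Let eval_mxM a b c X (A : 'M[poly_fun]_(a, b)) (A' : 'M_(b, c)) :
  eval_mx X (A *m A') = eval_mx X A *m eval_mx X A'.
Proof. exact: map_mxM. Qed.

Let eval_Mx X : eval_mx X Mx = 1%:M + B *m X *m P.
Proof.
rewrite /Mx [LHS]map_mxD map_mx1; congr (_ + _).
by rewrite -/(eval_mx _ _) !eval_mxM !eval_mx_cst eval_mx_generic.
Qed.

Let eval_Fx X : eval_mx X Fx = \adj (1%:M + B *m X *m P) *m (B *m X *m Q).
Proof.
rewrite eval_mxM -eval_Mx; congr (_ *m _); first exact: map_mx_adj.
by rewrite !eval_mxM !eval_mx_cst eval_mx_generic.
Qed.

Let deriv_Fx xi : deriv_mx xi Fx = B *m vec_mx xi *m Q.
Proof.
have e0 : eval_mx 0 (cst_mx p m B *m generic_mx C p m *m cst_mx p m Q) = 0.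
  by rewrite !eval_mxM eval_mx_generic mulmx0 mul0mx.
have eA : eval_mx 0 (\adj Mx) = 1%:M.
  rewrite -[LHS]/(map_mx _ _) map_mx_adj -/(eval_mx _ _) eval_Mx mulmx0 mul0mx addr0.
  by rewrite -[\adj _]mulmx1 mul_adj_mx det1.
rewrite deriv_mxM e0 mulmx0 add0r eA mul1mx.
by rewrite !deriv_mxM !deriv_mx_cst deriv_mx_generic !eval_mx_cst !mul0mx !mulmx0 add0r addr0.
Qed.

Let det_peval X : peval (\det Mx) X = \det (1%:M + B *m X *m P).
Proof. by rewrite -eval_Mx det_map_mx. Qed.

Let Fx_peval X x : 1%:M + B *m X *m P \in unitmx ->
  peval (Fx x.1 x.2) X = \det (1%:M + B *m X *m P) *
    (invmx (1%:M + B *m X *m P) *m (B *m X *m Q)) x.1 x.2.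
Proof.
move=> uM; transitivity (eval_mx X Fx x.1 x.2); first by rewrite [RHS]mxE.
by rewrite eval_Fx /invmx uM -scalemxAl [in RHS]mxE mulVKf //; move: uM; rewrite unitmxE unitfE.
Qed.

Let equation (i : 'I_#|Lambda|) : poly_fun := Fx (enum_val i).1 (enum_val i).2.
Let gradients := \matrix_(i < #|Lambda|) gradient0 (equation i).

Let gradients_mul (xi : 'rV[C]_(p * m)) i :
  (gradients *m xi^T) i 0 = (B *m vec_mx xi *m Q) (enum_val i).1 (enum_val i).2.
Proof.
rewrite -deriv_Fx [RHS]mxE /dir_deriv [LHS]mxE [RHS]mxE.
by apply: eq_bigr => k _; rewrite [gradients _ _]mxE.
Qed.

Let gradients_free : row_free gradients.
Proof.
apply: inj_row_free => v vG; apply/matrixP=> k i; rewrite [RHS]mxE ord1.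
pose xi := mxvec (invmx B *m delta_mx (enum_val i).1 (enum_val i).2 *m invmx Q).
have : (v *m gradients *m xi^T) 0 0 = 0 by rewrite vG mul0mx mxE.
rewrite -mulmxA mxE (bigD1 i) //= big1 ?addr0 => [|l li]; rewrite gradients_mul mxvecK.
  by rewrite !mulmxA mulmxV // mul1mx mulmxKV // mxE !eqxx mulr1.
rewrite !mulmxA mulmxV // mul1mx mulmxKV // mxE -xpair_eqE -!surjective_pairing.
by rewrite (inj_eq enum_val_inj) (negPf li) mulr0.
Qed.

Let in_chart0 : Z H.
Proof.
have := @Z_chart 0; rewrite mulmx0 mul0mx addr0 unitmx1 mul0mx addr0 => /(_ isT)[_]; apply.
by move=> x _; rewrite mul0mx mulmx0 mxE.
Qed.

Let equationP X : 1%:M + B *m X *m P \in unitmx ->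
  (in_chart Z H N0 X <-> forall i, peval (equation i) X = 0).
Proof.
move=> uM; have dM : \det (1%:M + B *m X *m P) != 0 by move: uM; rewrite unitmxE unitfE.
rewrite /in_chart Z_chart //; split=> [h i|h x xL].
  by rewrite Fx_peval // h ?mulr0 //; apply: enum_valP.
have := h (enum_rank_in xL x); rewrite /equation enum_rankK_in // Fx_peval // => /eqP.
by rewrite mulf_eq0 (negPf dM) => /eqP.
Qed.

Let equation0 i : peval (equation i) 0 = 0.
Proof.
have u1 : 1%:M + B *m (0 : 'M_(p, m)) *m P \in unitmx by rewrite mulmx0 mul0mx addr0 unitmx1.
by move: i; apply/(equationP u1); rewrite /in_chart mul0mx addr0.
Qed.

Let det0 : peval (\det Mx) 0 = 1.
Proof. by rewrite det_peval mulmx0 mul0mx addr0 det1. Qed.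

Lemma linear_chart_smooth : smooth_at Z H N0.
Proof.
exists #|Lambda|, equation, (\det Mx); split=> //.
- by rewrite det0 oner_neq0.
- move=> X; rewrite det_peval => dM; apply: equationP.
  by rewrite unitmxE unitfE.
Qed.

(** In the adapted chart Z contains the line t xi1. Solving (1 + B X P) t xi1 = B X Q for X turns it
    into the curve with B X = t xi1 (Q - t P xi1)^-1 in the given chart; f vanishes along it, hence
    so does its derivative at 0 in the direction xi. *)
Let curve_vanish f (xi : 'rV[C]_(p * m)) :
  (forall x, x \in Lambda -> (B *m vec_mx xi *m Q) x.1 x.2 = 0) ->
  (forall X, in_chart Z H N0 X -> peval f X = 0) -> dir_deriv xi f = 0.
Proof.
move=> xiL fZ; pose xi1 := B *m vec_mx xi *m Q.
pose cm a b (A : 'M[C]_(a, b)) : 'M[{poly C}]_(a, b) := map_mx polyC A.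
pose Dt : 'M[{poly C}]_m := cm _ _ Q - 'X *: cm _ _ (P *m xi1).
pose Y : 'M[{poly C}]_(p, m) := cm _ _ (invmx B *m xi1) *m \adj Dt.
pose ev t a b (A : 'M[{poly C}]_(a, b)) : 'M[C]_(a, b) := map_mx (horner_eval t) A.
have evc t a b (A : 'M[C]_(a, b)) : ev t a b (cm a b A) = A.
  by apply/matrixP=> i j; rewrite !mxE /horner_eval hornerC.
have evD t : ev t _ _ Dt = Q - t *: (P *m xi1).
  by apply/matrixP=> i j; rewrite !mxE /horner_eval !hornerE.
have evY t : ev t _ _ Y = invmx B *m xi1 *m \adj (Q - t *: (P *m xi1)).
  have -> : ev t _ _ Y = ev t _ _ (cm _ _ (invmx B *m xi1)) *m \adj (ev t _ _ Dt).
    by rewrite /ev map_mxM map_mx_adj.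
  by rewrite evc evD.
have evd t : (\det Dt).[t] = \det (Q - t *: (P *m xi1)).
  by rewrite -evD det_map_mx.
have d0 : (\det Dt).[0] = \det Q by rewrite evd scale0r subr0.
have uQ : \det Q != 0 by move: Q_unit; rewrite unitmxE unitfE.
have Y0 i j : (Y i j).[0] = (\det Dt).[0] * vec_mx xi i j.
  have := evY 0; rewrite scale0r subr0 => /matrixP/(_ i j); rewrite [LHS]mxE d0 => e.
  rewrite -[LHS]/(horner_eval 0 (Y i j)) e /xi1 -!mulmxA mulKmx // mul_mx_adj.
  by rewrite mul_mx_scalar mxE.
have [e [r hr]] := curve_expansion Y0 f.
have f0 : peval f 0 = 0 by apply: fZ; rewrite /in_chart mul0mx addr0.
have dDt : \det Dt != 0 by apply: contraNneq uQ => dt; rewrite -d0 dt horner0.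
have key t : (\det Dt).[t] != 0 ->
    (\det Dt).[t] ^+ e * (t * dir_deriv xi f) + t ^+ 2 * r.[t] = 0.
  move=> dt; rewrite -hr // f0 subr0.
  suff -> : peval f (\matrix_(i, j) (t * (Y i j).[t] / (\det Dt).[t])) = 0 by ring.
  apply: fZ; set X := \matrix_(i, j) _.
  pose W := Q - t *: (P *m xi1).
  have uW : W \in unitmx by rewrite unitmxE unitfE /W -evd.
  have XE : B *m X = (t *: xi1) *m invmx W.
    rewrite /invmx uW; have -> : X = (t / \det W) *: (invmx B *m xi1 *m \adj W).
      rewrite -evY; apply/matrixP=> i j; rewrite [LHS]mxE -evd [RHS]mxE [ev _ _ _ _ _ _]mxE.
      by rewrite /horner_eval; ring.
    rewrite -[LHS]scalemxAr -!mulmxA mulKVmx // -scalemxAl -scalemxAr scalerA.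
    by rewrite /xi1 !mulmxA.
  have BXQ : (1%:M + B *m X *m P) *m (t *: xi1) = B *m X *m Q.
    have QE : Q = W + P *m (t *: xi1) by rewrite -scalemxAr subrK.
    have XW : B *m X *m W = t *: xi1 by rewrite XE mulmxKV.
    by rewrite mulmxDl mul1mx [in RHS]QE mulmxDr XW -!mulmxA.
  (* [H + X *m N0] has rank p, being a point of the chart, and it factors through this square
     matrix. *)
  have uM : 1%:M + B *m X *m P \in unitmx.
    have : row_free (H + X *m N0).
      have fr := complementary_free comp0.
      have -> : H + X *m N0 = row_mx 1%:M X *m col_mx H N0 by rewrite mul_row_col mul1mx.
      rewrite /row_free mxrankMfree //; apply/row_freeP.
      by exists (col_mx 1%:M 0); rewrite mul_row_col mul1mx mulmx0 addr0.
    rewrite move_chart -BXQ -(mulmxA _ _ N1) -mulmxDr mulmxA => /eqP fr.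
    have : (invmx B *m (1%:M + B *m X *m P)) \in unitmx.
      by rewrite -row_free_unit /row_free eqn_leq rank_leq_row -{1}fr mxrankM_maxl.
    by rewrite unitmx_mul unitmx_inv uB.
  apply/(Z_chart uM) => x xL; rewrite -BXQ mulKmx // mxE.
  by rewrite (xiL x xL) mulr0.
have : \det Dt ^+ e * (dir_deriv xi f)%:P + 'X * r = 0.
  apply: (poly_eq0_of_vanish (g := 'X * \det Dt)); first by rewrite mulf_neq0 ?polyX_eq0.
  move=> t; rewrite hornerM hornerX mulf_eq0 negb_or => /andP[t0 dt].
  apply: (mulfI t0); rewrite mulr0 -(key t dt) !(hornerD, hornerM, horner_exp, hornerC, hornerX).
  by ring.
move/(congr1 (horner^~ 0)); rewrite !(hornerD, hornerM, horner_exp, hornerC, hornerX) d0.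
rewrite mul0r addr0 => /eqP; rewrite mulf_eq0 expf_eq0 (negPf uQ) andbF => /eqP.
by [].
Qed.

Lemma linear_chart_tangent : exists T : 'M[C]_(p * m),
  [/\ is_tangent_space Z H N0 T, (p * m - \rank T = #|Lambda|)%N &
    forall xi : 'rV_(p * m), (xi <= T)%MS -> exists E W,
      B *m vec_mx xi *m N0 = E *m H1 + W *m N1 /\
      forall x, x \in Lambda -> W x.1 x.2 = 0].
Proof.
have TE (xi : 'rV[C]_(p * m)) : (xi <= kermx gradients^T)%MS <->
    forall x, x \in Lambda -> (B *m vec_mx xi *m Q) x.1 x.2 = 0.
  have -> : (xi <= kermx gradients^T)%MS = (gradients *m xi^T == 0).
    rewrite (sameP (sub_kermxP) eqP) -(inj_eq (@trmx_inj _ _ _)) trmx_mul trmxK trmx0.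
    by [].
  split=> [/eqP/matrixP h x xL|h].
    have := h (enum_rank_in xL x) 0; rewrite gradients_mul enum_rankK_in // => ->.
    by rewrite mxE.
  apply/eqP/matrixP=> i k; rewrite ord1 gradients_mul [RHS]mxE h //; exact: enum_valP.
exists (kermx gradients^T); split.
- move=> xi; split=> [/TE xiL f fZ|h].
    by apply/matrixP=> i j; rewrite !ord1 [RHS]mxE; apply: curve_vanish.
  apply/TE => x xL; have uM0 : peval (\det Mx) 0 = 1 := det0.
  set i := enum_rank_in xL x.
  have e : enum_val i = x by rewrite enum_rankK_in.
  (* The equation is known to vanish on Z only where the charts overlap. The factor [\det Mx] makes
     it vanish on all of Z and, being 1 at the origin, leaves the gradient there unchanged. *)
  have : gradient0 (\det Mx * equation i) *m xi^T = 0.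
    apply: h => X ZX; rewrite pevalM; have [->|dX] := eqVneq (peval (\det Mx) X) 0.
      by rewrite mul0r.
    have uM : 1%:M + B *m X *m P \in unitmx by rewrite unitmxE unitfE -det_peval.
    by rewrite ((equationP uM).1 ZX) mulr0.
  move/matrixP/(_ 0 0); rewrite -/(dir_deriv _ _) dir_derivM equation0 mulr0 add0r uM0 mul1r.
  rewrite [RHS]mxE => <-; rewrite -deriv_Fx mxE /equation e.
  by [].
- have := mxrank_ker gradients^T; rewrite mxrank_tr (eqP gradients_free) => ->.
  rewrite subKn // -[X in (X <= _)%N](eqP gradients_free).
  exact: rank_leq_col.
- move=> xi /TE xiL; exists (B *m vec_mx xi *m P), (B *m vec_mx xi *m Q); split=> //.
  by rewrite {1}N0E mulmxDr !mulmxA.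
Qed.

End LinearInChart.
End AdaptedChart.

(** * Codimensions of cycles as numbers of cells *)

Lemma sum_above k N : (\sum_(q < N) (k <= q) = N - k)%N.
Proof.
elim: N => [|N IH]; first by rewrite big_ord0.
by rewrite big_ord_recr /= IH; lia.
Qed.

Lemma card_sum_pred (T : finType) (A : pred T) : #|[set x | A x]| = (\sum_x A x)%N.
Proof. by rewrite -sum1_card big_mkcond; apply: eq_bigr => x _; rewrite inE; case: (A x). Qed.

Section Count.
Variables (m p : nat) (d : 'I_p -> 'I_(m + p)).
Local Notation N := (m + p)%N.
Hypothesis d_incr : {homo d : i j / (i < j)%N}.

Lemma count_above k : (k <= N)%N ->
  (#|[set q : 'I_N | (q \notin pivot d) && (k <= q)]| + #|[set i | k <= d i]| = N - k)%N.
Proof.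
move=> kN; have e : #|[set q : 'I_N | k <= q]%N| = (N - k)%N by rewrite card_sum_pred sum_above.
rewrite -e -(cardsID [set q | q \in pivot d] [set q : 'I_N | k <= q]%N) addnC; congr (_ + _)%N.
  rewrite -(card_imset _ (pivot_inj d_incr)); apply: eq_card => q; rewrite !inE.
  apply/imsetP/andP => [hq|hq].
    by case: hq => i; rewrite inE => ki ->; rewrite ki pivot_in.
  case: hq => kq /codomP[i ei].
  by exists i => //; rewrite inE -ei.
by apply: eq_card => q; rewrite !inE.
Qed.

(** The cells form a rectangle: j rows, and N - k columns from k on, of which p - j are pivots. *)
Lemma count_single k j : (k <= N)%N -> #|[set i | d i < k]%N| = j ->
  #|[set x : 'I_p * 'I_N | (x.2 \notin pivot d) && (d x.1 < k <= x.2)%N]| =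
  (j * (m + j - k))%N.
Proof.
move=> kN jE.
have -> : [set x : 'I_p * 'I_N | (x.2 \notin pivot d) && (d x.1 < k <= x.2)%N] =
    finset.setX [set i | d i < k]%N [set q : 'I_N | (q \notin pivot d) && (k <= q)%N].
  by apply/setP => x; rewrite !inE; case: (x.2 \notin _); case: (d x.1 < k)%N; case: (k <= x.2)%N.
rewrite cardsX jE; congr (_ * _)%N; have := count_above kN.
have : (#|[set i | d i < k]| + #|[set i | k <= d i]| = p)%N.
  rewrite -[RHS]card_ord -(cardsC [set i | d i < k]%N); congr (_ + _)%N.
  by apply: eq_card => i; rewrite !inE -leqNgt.
rewrite jE; move: #|_| #|_| => x y; lia.
Qed.

Lemma count_schubert :
  #|[set x : 'I_p * 'I_N | (x.2 \notin pivot d) && (d x.1 < x.2)%N]| =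
  (\sum_(i < p) (m + i - d i))%N.
Proof.
rewrite card_sum_pred.
rewrite -(pair_bigA _ (fun i (q : 'I_N) => ((q \notin pivot d) && (d i < q)%N : nat))) /=.
apply: eq_bigr => i _; rewrite -card_sum_pred.
have := count_above (ltn_ord (d i)).
have -> : #|[set l | d i < d l]%N| = (p - i.+1)%N.
  rewrite -sum_above -card_sum_pred; apply: eq_card => l; rewrite !inE.
  apply/idP/idP => [|/d_incr//]; rewrite ltnNge => h; rewrite ltnNge.
  by apply: contra h => /(pivot_leq d_incr).
have /andP[] := position_bounds d_incr i; have := ltn_ord i; have := ltn_ord (d i).
move: #|_| => x; lia.
Qed.

End Count.

Section FlagChart.
Variables (C : fieldType) (m p : nat).
Hypothesis natC : injective (fun n : nat => n%:R : C).
Local Notation N := (m + p)%N.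
Variables (E : 'M[C]_N) (S : seq (nat * nat)) (Z : 'M[C]_(p, N) -> Prop).
Hypothesis uE : E \in unitmx.
Hypothesis ZE : forall G, Z G <->
  forall x, x \in S -> (x.1 <= \rank (G :&: flag_space E x.2))%N.
Variables (H : 'M[C]_(p, N)) (N0 : 'M[C]_(m, N)).
Hypotheses (fH : row_free H) (comp0 : complementary H N0).
Hypothesis exactS : forall x, x \in S -> \rank (H :&: flag_space E x.2) = x.1.

(** In the chart spanned by the echelon basis and the nonpivot flag vectors, all planes remain
    normalized on the same pivots. A condition met by [H] in exact dimension then says that entries
    with pivot before the step and column from it on vanish, which is linear. *)
Lemma flag_chart : smooth_at Z H N0 /\ exists d : 'I_p -> 'I_N, exists T : 'M[C]_(p * m),
  [/\ {homo d : i j / (i < j)%N},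
      forall k, \rank (H :&: flag_space E k) = #|[set i | d i < k]%N|,
      is_tangent_space Z H N0 T,
      (p * m - \rank T)%N = #|[set x : 'I_p * 'I_N | (x.2 \notin pivot d) &&
         has (fun y : nat * nat => d x.1 < y.2 <= x.2)%N S]| &
      forall xi : 'rV_(p * m), (xi <= T)%MS -> forall x, x \in S ->
        tangent H (flag_space E x.2) (vec_mx xi *m N0)].
Proof.
have [B [d [uB d_incr dB eB rd]]] := flag_echelon uE fH.
set G := B *m (H *m invmx E) in dB eB.
have cJ : #|[set q | q \notin pivot d]| = m.
  have := cardC (pivot d); rewrite card_ord (card_codom (pivot_inj d_incr)) card_ord.
  rewrite addnC => /addIn e; rewrite -[RHS]e; apply: eq_card => q.
  by rewrite !inE.
pose ee (l : 'I_m) : 'I_N := enum_val (cast_ord (esym cJ) l).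
have ee_np l : ee l \notin pivot d by have := enum_valP (cast_ord (esym cJ) l); rewrite inE.
have ee_inj : injective ee by move=> x y /enum_val_inj/cast_ord_inj.
have ee_surj q : q \notin pivot d -> exists l, q = ee l.
  move=> nq; have qJ : q \in [set q | q \notin pivot d] by rewrite inE.
  exists (cast_ord cJ (enum_rank_in qJ q)).
  by rewrite /ee cast_ordK enum_rankK_in.
pose EN : 'M[C]_(m, N) := \matrix_(l, q) (q == ee l)%:R.
have mulEN (X : 'M[C]_(p, m)) i l : (X *m EN) i (ee l) = X i l.
  rewrite mxE (bigD1 l) //= big1 ?addr0 => [|k kl]; rewrite mxE ?eqxx ?mulr1 //.
  by rewrite (inj_eq ee_inj) eq_sym (negPf kl) mulr0.
have mulENd a (X : 'M[C]_(a, m)) i j : (X *m EN) i (d j) = 0.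
  rewrite mxE big1 // => k _; rewrite mxE; case: eqP => [e|_]; rewrite ?mulr0 //.
  by have := ee_np k; rewrite -e pivot_in.
pose H1 := B *m H; pose N1 := EN *m E.
have H1E : H1 = G *m E by rewrite /H1 /G !mulmxA mulmxKV.
have dGX X : colsub d (G + X *m EN) = 1%:M.
  apply/matrixP=> i j; rewrite mxE [LHS]mxE mulENd addr0.
  by have /matrixP/(_ i j) := dB; rewrite [LHS]mxE.
have comp1 : complementary H1 N1.
  rewrite /complementary H1E /N1 -mul_col_mx /row_full mxrankMfree ?row_free_unit //.
  rewrite [X in _ == X]addnC -/(row_free _); apply: inj_row_free => v.
  rewrite -[v]hsubmxK mul_row_col; set X := lsubmx v; set Y := rsubmx v => e.
  have X0 : X = 0.
    apply/matrixP=> k i; have /matrixP/(_ k (d i)) := e.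
    by rewrite mxE mulENd addr0 (colsub1_coef dB) !mxE.
  move: e; rewrite X0 mul0mx add0r => e; suff -> : Y = 0 by rewrite row_mx0.
  apply/matrixP=> k l; have /matrixP/(_ k (ee l)) := e.
  rewrite mxE (bigD1 l) //= big1 ?addr0 => [|j jl]; rewrite !mxE ?eqxx ?mulr1 //.
  by rewrite (inj_eq ee_inj) eq_sym (negPf jl) mulr0.
pose Lambda := [set x : 'I_p * 'I_m | has (fun y : nat * nat => d x.1 < y.2 <= ee x.2)%N S].
have Z_eqmx A G' : A \in unitmx -> (Z (A *m G') <-> Z G').
  move=> uA; have e := eqmx_unit G' uA.
  by rewrite !ZE; split=> h x /h; rewrite (cap_eqmx e (eqmx_refl _)).
have Z_linear X : Z (H1 + X *m N1) <-> forall x, x \in Lambda -> X x.1 x.2 = 0.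
  have -> : H1 + X *m N1 = (G + X *m EN) *m E by rewrite H1E mulmxA mulmxDl.
  rewrite ZE; have capE k : \rank ((G + X *m EN)%R *m E :&: flag_space E k) =
      \rank ((G + X *m EN)%R :&: (pid_mx k : 'M_N)).
    by rewrite (pid_cap_flag _ _ uE) (mulmxK uE).
  split=> [h [i l]|h y yS].
    rewrite inE /= => /hasP[y yS /andP[dy yl]].
    have := h y yS; rewrite capE => hy.
    have := pid_cap_vanish (dGX X) _ hy dy yl; rewrite -(exactS yS) rd => /(_ (leqnn _)).
    by rewrite mxE mulEN eB ?add0r //; apply: leq_trans yl.
  rewrite capE -(exactS yS) rd; apply: (pid_cap_rank_ge (dGX X)) => i q dy yq.
  rewrite mxE eB ?add0r; last exact: leq_trans yq.
  have [/codomP[j ->]|/ee_surj[l ql]] := boolP (q \in pivot d); first by rewrite mulENd.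
  rewrite ql mulEN; apply: (h (i, l)); rewrite inE; apply/hasP; exists y => //=.
  by rewrite dy -ql.
have H1B : H1 = B *m H by [].
split; first exact: (linear_chart_smooth Z_eqmx uB H1B comp0 comp1 Z_linear).
have [T [tT rT wT]] := linear_chart_tangent natC Z_eqmx uB H1B comp0 comp1 Z_linear.
exists d, T; split=> //.
  rewrite rT; have inj : injective (fun x : 'I_p * 'I_m => (x.1, ee x.2)).
    by move=> [i l] [i' l'] [-> /ee_inj ->].
  rewrite -(card_imset _ inj); apply: eq_card => -[i q]; rewrite !inE /=.
  apply/imsetP/andP => [h|h].
    by case: h => -[i' l]; rewrite inE /= => hl [-> ->]; rewrite ee_np.
  case: h => nq hq.
  have [l ql] := ee_surj q nq; exists (i, l); last by rewrite ql.
  by rewrite inE /= -ql.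
move=> xi /wT[A [W [eW WL]]] x xS y yV.
have [z yE] : exists z, y = z *m B by exists (y *m invmx B); rewrite mulmxKV.
have zG : (z *m G <= (pid_mx x.2 : 'M_N))%MS.
  have : (z *m G *m E <= flag_space E x.2)%MS by rewrite -mulmxA -H1E /H1 mulmxA -yE.
  by rewrite submxMfree // row_free_unit.
have z0 := pid_coef0 dB zG.
have -> : y *m (vec_mx xi *m N0) = z *m W *m EN *m E + z *m A *m H1.
  have -> : y *m (vec_mx xi *m N0) = z *m (B *m vec_mx xi *m N0) by rewrite yE !mulmxA.
  by rewrite eW mulmxDr addrC /N1 !mulmxA.
rewrite addmx_sub_adds //; last by rewrite /H1 mulmxA submxMl.
apply: submxMr; apply/sub_pid_mxP => i q xq.
have [/codomP[j ->]|/ee_surj[l ql]] := boolP (q \in pivot d); first by rewrite mulENd.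
rewrite mxE (bigD1 l) //= big1 ?addr0 => [|k kl]; rewrite [EN _ _]mxE; last first.
  by rewrite ql (inj_eq ee_inj) eq_sym (negPf kl) mulr0.
rewrite ql eqxx mulr1 mxE; apply: big1 => j _.
have [xd|dx] := leqP x.2 (d j); first by rewrite z0 // mul0r.
rewrite (WL (j, l)) ?mulr0 //= inE; apply/hasP; exists x => //=.
by rewrite dx -ql.
Qed.

End FlagChart.

Lemma osc_mx_unit (F : fieldType) N (s : F) : injective (fun n : nat => n%:R : F) ->
  osc_mx N N s \in unitmx.
Proof.
move=> natF; rewrite -unitmx_tr unitmxE det_trig.
  rewrite unitfE prodf_seq_neq0; apply/allP => i _ /=.
  rewrite mxE osc_mxE subnn mulr1 ffactnn.
  by apply/negP => /eqP /(natF _ 0); apply/eqP; rewrite -lt0n fact_gt0.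
by apply/is_trig_mxP => i j ij; rewrite mxE osc_mxE ffact_small // mul0r.
Qed.

Section FlagSpaces.
Variables (K : fieldType) (p N : nat).

Lemma row_pid_mx k (i : 'I_N) : row i (pid_mx k : 'M[K]_N) = if (i < k)%N then delta_mx 0 i else 0.
Proof.
apply/rowP => j; rewrite !mxE; case: ifP => ik; rewrite !mxE ?andbF //= andbT.
by rewrite -val_eqE eq_sym.
Qed.

Lemma flag_space_rows (E : 'M[K]_N) k (V : 'M[K]_(k, N)) : (k <= N)%N ->
  (forall (i : 'I_k) (j : 'I_N), i = j :> nat -> row i V = row j E) -> (flag_space E k :=: V)%MS.
Proof.
move=> kN VE; apply/eqmxP/andP; split; apply/row_subP => i.
  rewrite /flag_space row_mul row_pid_mx; case: ifP => ik; last by rewrite mul0mx sub0mx.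
  by rewrite -rowE -(VE (Ordinal ik)) ?row_sub.
have iN := leq_trans (ltn_ord i) kN.
rewrite (VE i (Ordinal iN)) // rowE.
have -> : delta_mx 0 (Ordinal iN) = row (Ordinal iN) (pid_mx k : 'M[K]_N).
  by rewrite row_pid_mx /= ltn_ord.
by rewrite -row_mul row_sub.
Qed.

Lemma flag_space_osc k (s : K) : (k <= N)%N ->
  (flag_space (osc_mx N N s) k :=: osc_mx N k s)%MS.
Proof.
move=> kN; apply: flag_space_rows => // i j ij.
by apply/rowP => q; rewrite !mxE ij.
Qed.

Lemma flag_space_osc0 k : (forall n, (n.+1%:R : K) != 0) ->
  (flag_space (osc_mx N N 0) k :=: (pid_mx k : 'M[K]_N))%MS.
Proof.
move=> nat0.
have oscE : osc_mx N N (0 : K) = diag_mx (\row_i (i`!)%:R).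
  apply/matrixP=> i j; rewrite osc_mxE !mxE.
  have [ij|ji|/val_inj->] := ltngtP i j.
  - by rewrite expr0n subn_eq0 leqNgt ij mulr0 -val_eqE /= ltn_eqF.
  - by rewrite ffact_small // mul0r -val_eqE /= gtn_eqF.
  - by rewrite subnn mulr1 ffactnn eqxx.
have -> : flag_space (osc_mx N N (0 : K)) k = osc_mx N N 0 *m pid_mx k.
  rewrite /flag_space oscE; apply/matrixP=> i j; rewrite mul_mx_diag mul_diag_mx !mxE.
  by case: eqP => [/val_inj->|]; rewrite ?mul0r ?mulr0 // mulrC.
apply: eqmxMfull; rewrite row_full_unit oscE unitmxE det_diag unitfE prodf_seq_neq0.
apply/allP => i _ /=; rewrite mxE.
by have := fact_gt0 i; case: (i`!).
Qed.

Lemma flag_space_rev k : (k <= N)%N -> (flag_space (rev_mx K N) k :=: (copid_mx (N - k) : 'M[K]_N))%MS.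
Proof.
move=> kN; apply/eqmxP/andP; split.
  set V := flag_space _ _.
  have hV i (q : 'I_N) : (q < N - k)%N -> V i q = 0 by move: i q; apply/(sub_pid_revP V kN).
  suff -> : V = V *m copid_mx (N - k) by apply: submxMl.
  rewrite mulmxBr mulmx1 (_ : V *m pid_mx _ = 0) ?subr0 //.
  apply/matrixP=> i j; rewrite mxE big1 ?mxE // => q _; rewrite [pid_mx _ _ _]mxE.
  by have [qk|_] := ltnP q (N - k); [rewrite hV // mul0r|rewrite andbF mulr0].
apply/(sub_pid_revP _ kN) => i q qk; rewrite !mxE -val_eqE.
by case: eqP => /= [->|]; rewrite ?qk ?subrr ?subr0.
Qed.

Lemma tangent_mulr (H V D A : _) : A \in unitmx ->
  tangent H (V *m A) D -> tangent (H *m invmx A : 'M[K]_(p, N)) V (D *m invmx A).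
Proof.
move=> uA h y yV; have /h : (y *m H <= V *m A)%MS.
  by rewrite -[y *m H](mulmxKV uA) submxMr // -mulmxA.
move=> /(submxMr (invmx A)); rewrite mulmxA => /submx_trans; apply.
by rewrite addsmxMr mulmxK.
Qed.

Lemma tangent_eqmx (H V V' D : _) : (V :=: V')%MS ->
  tangent (H : 'M[K]_(p, N)) V D -> tangent H V' D.
Proof. by move=> e h y; rewrite -e => /h; rewrite (adds_eqmx e (eqmx_refl H)). Qed.

Lemma complementary_eq0 m (H : 'M[K]_(p, m + p)) (N0 : 'M[K]_(m, m + p)) X :
  complementary H N0 -> (X *m N0 <= H)%MS -> X = 0 :> 'M[K]_(p, m).
Proof.
move=> comp /submxP[B eB].
have /(row_free_inj (complementary_free comp)) : row_mx B (- X) *m col_mx H N0 = 0 *m col_mx H N0.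
  by rewrite mul_row_col mulNmx eB subrr mul0mx.
by rewrite -row_mx0 => /eq_row_mx[_ /eqP]; rewrite oppr_eq0 => /eqP.
Qed.

End FlagSpaces.

Lemma card_position p N (d : 'I_p -> 'I_N) : {homo d : i j / (i < j)%N} ->
  forall i c, (d i < c)%N = (i < #|[set l | d l < c]|)%N.
Proof.
move=> d_incr i c; apply/idP/idP => [ic|].
  have ip := ltn_ord i.
  rewrite (_ : i.+1 = #|[set l : 'I_p | l <= i]%N|).
    by apply: subset_leq_card; apply/fintype.subsetP => l; rewrite !inE => /(pivot_leq d_incr)/leq_ltn_trans; apply.
  rewrite -[LHS](subKn ip) -(sum_above i.+1) -card_sum_pred.
  have := cardsC [set l : 'I_p | l <= i]%N; rewrite card_ord => e.
  rewrite -{1}e (_ : ~: _ = [set x : 'I_p | i < x]%N) ?addnK //.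
  by apply/setP => l; rewrite !inE ltnNge.
apply: contraLR; rewrite -!leqNgt => ci.
have e := sum_above i p; rewrite -card_sum_pred in e.
have := cardsC [set l : 'I_p | i <= l]%N; rewrite card_ord e => e'.
have -> : (i : nat) = #|~: [set l : 'I_p | i <= l]%N| by have := ltn_ord i; lia.
apply: subset_leq_card; apply/fintype.subsetP => l; rewrite !inE -ltnNge => lc.
rewrite ltnNge; apply/negP => /(pivot_leq d_incr) dil.
by have := leq_ltn_trans dil lc; rewrite ltnNge ci.
Qed.

Lemma position_uniq p N (d d' : 'I_p -> 'I_N) : {homo d : i j / (i < j)%N} ->
  {homo d' : i j / (i < j)%N} ->
  (forall k, #|[set l | d l < k]%N| = #|[set l | d' l < k]%N|) -> d =1 d'.
Proof.
move=> h h' e i; have key c : (d i < c)%N = (d' i < c)%N.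
  by rewrite (card_position h) e -card_position.
by apply/val_inj/eqP; rewrite eqn_leq; apply/andP; split; rewrite -ltnS ?key // -key.
Qed.

Section RealPlane.
Variables (R : realType) (p N : nat).

Lemma real_of_conj (x : R[i]) : conjc x = x -> x = (complex.Re x)%:C.
Proof.
case: x => x y [yy]; congr (_ +i* _); lra.
Qed.

(** Normalized on fixed columns, the basis of a plane is unique, so conjugation fixes it entrywise
    and its entries are real. *)
Lemma real_of_conj_sub (H : 'M[R[i]]_(p, N)) : row_free H ->
  (map_mx (@conjc R) H <= H)%MS -> exists H0 : 'M[R]_(p, N), (H :=: complexify H0)%MS.
Proof.
move=> /echelon[B [d [uB _ dB _]]] HH.
have eB := eqmx_unit H uB.
exists (map_mx (@complex.Re R) (B *m H)).
suff <- : B *m H = complexify (map_mx (@complex.Re R) (B *m H)) by apply: eqmx_sym.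
have conjG : map_mx (@conjc R) (B *m H) = B *m H.
  apply: (colsub1_sub_eq dB).
    by rewrite -[LHS]map_mxsub dB map_mx1.
  by rewrite eB map_mxM (submx_trans _ HH) // submxMl.
by apply/matrixP=> i j; rewrite [RHS]mxE [map_mx _ _ i j]mxE; apply: real_of_conj; rewrite -[in RHS]conjG [RHS]mxE.
Qed.

End RealPlane.

(** * Osculating flags of the curve and charts for their cycles *)

Section Osculation.
Variables (R : realType) (m p : nat).
Local Notation N := (m + p)%N.
Local Notation C := R[i].

Definition point_mx (x : curve_point R) : 'M[C]_N :=
  if x is Some s then osc_mx N N s%:C else rev_mx C N.

Definition special_index (u : bool) a := (if u then m - 1 + a else m + 1 - a)%N.

Lemma point_mx_unit x : point_mx x \in unitmx.
Proof.
by case: x => [s|]; [apply/osc_mx_unit/natr_complex_inj|exact: rev_mx_unit].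
Qed.

Lemma special_spaceE u a (s : R) : (special_index u a <= N)%N ->
  (special_space m p u a s%:C :=: flag_space (point_mx (Some s)) (special_index u a))%MS.
Proof.
move=> kN; apply: eqmx_trans (genmxE _) _; apply: eqmx_sym.
exact: flag_space_osc.
Qed.

Section Coordinates.
Variable g : 'M[R]_N.
Hypothesis g_unit : g \in unitmx.

Let gC : 'M[C]_N := complexify g.

Lemma complexify_unit : gC \in unitmx.
Proof. by rewrite map_unitmx. Qed.

Lemma osculatingE k x : (k <= N)%N ->
  (osculating g k x :=: flag_space (point_mx x *m gC) k)%MS.
Proof.
move=> kN; rewrite /osculating /complexify map_mxM /flag_space mulmxA.
apply: eqmxMr; case: x => [s|] /=; last first.
  by apply: eqmx_sym; rewrite map_copid_mx; apply: flag_space_rev.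
apply: eqmx_trans (map_genmx _ _) _; apply: eqmx_trans (genmxE _) _.
apply: eqmx_sym; rewrite (_ : map_mx _ _ = osc_mx N k s%:C); first exact: flag_space_osc.
apply/matrixP=> i j; rewrite osc_mxE !mxE derivnXn hornerMn hornerXn.
by rewrite rmorphMn rmorphXn /= mulr_natl.
Qed.

Lemma cap_osculating k x (H : 'M[C]_(p, N)) : (k <= N)%N ->
  \rank (H :&: osculating g k x) = \rank (H *m invmx gC :&: flag_space (point_mx x) k).
Proof.
by move=> kN; rewrite (cap_eqmx (eqmx_refl H) (osculatingE x kN)) flag_cap_mulr ?complexify_unit.
Qed.

Lemma tangent_osculating k x (H D : 'M[C]_(p, N)) :
  tangent H (flag_space (point_mx x *m gC) k) D ->
  tangent (H *m invmx gC) (flag_space (point_mx x) k) (D *m invmx gC).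
Proof.
by rewrite /flag_space mulmxA; apply/tangent_mulr/complexify_unit.
Qed.

Lemma schubert_cycleE w x (H : 'M[C]_(p, N)) : schubert_condition m w ->
  schubert_cycle g w x H <->
  forall j : 'I_p, (j.+1 <= \rank (H *m invmx gC :&: flag_space (point_mx x) (last_col m w j).+1))%N.
Proof.
move=> [wm _]; have kE (j : 'I_p) : (m + j.+1 - w j = (last_col m w j).+1)%N.
  by rewrite /last_col; have := wm j; lia.
by split=> h j; have := h j; rewrite kE cap_osculating ?last_col_lt.
Qed.

Definition special_cycle (u : bool) := if u then tau_upper (p := p) g else tau_lower g.

Lemma special_cycleE u a x (H : 'M[C]_(p, N)) : (0 < a)%N -> (special_index u a <= N)%N ->
  special_cycle u a x H <->
  (special_dim u a <= \rank (H *m invmx gC :&: flag_space (point_mx x) (special_index u a)))%N.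
Proof.
move=> a0 kN; rewrite -cap_osculating // /special_cycle /special_dim /special_index.
case: u {kN}; rewrite ?/tau_upper ?/tau_lower; last by rewrite lt0n mxrank_eq0.
by rewrite subn1 prednK.
Qed.

(** For the upper condition, membership of a plane forces a <= p, so the osculating space is a
    member of the complete flag. *)
Lemma special_index_le u a x (H : 'M[C]_(p, N)) : (0 < m)%N -> (0 < a)%N ->
  special_cycle u a x H -> (special_index u a <= N)%N.
Proof.
move=> m_gt0 a0; rewrite /special_cycle /special_index; case: u => [h|_]; last by move: a0; clear; lia.
have h' := leq_trans h (leq_trans (mxrankS (capmxSl _ _)) (rank_leq_row H)).
by move: h' m_gt0 a0; clear; lia.
Qed.

(** The rectangle of cells is a column of a for the upper condition and a row of a for the lower
    one. In the lower case truncated subtraction is harmless, since membership of a plane forces a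
    <= m. *)
Lemma special_codim u a x (H : 'M[C]_(p, N)) : (0 < m)%N -> (0 < a)%N ->
  special_cycle u a x H -> (special_dim u a * (m + special_dim u a - special_index u a) = a)%N.
Proof.
move=> m_gt0 a0 sH; have /(special_cycleE x H a0) := special_index_le m_gt0 a0 sH => /iffLR/(_ sH).
rewrite /special_dim /special_index; case: u {sH} => [_|h]; first by move: m_gt0 a0; nia.
have k0 : (0 < m + 1 - a)%N.
  rewrite lt0n; apply/eqP => k0; move: h; rewrite k0 lt0n mxrank_eq0 -submx0.
  by rewrite (submx_trans (capmxSr _ _)) // /flag_space pid_mx_0 mul0mx submx0.
by move: k0 a0 m_gt0; nia.
Qed.

Section Charts.
Variables (H : 'M[C]_(p, N)) (N0 : 'M[C]_(m, N)).
Hypotheses (fH : row_free H) (comp : complementary H N0).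
Local Notation H' := (H *m invmx gC).

Lemma cycle_chart (Z : 'M[C]_(p, N) -> Prop) (S : seq (nat * nat)) x :
  (forall G, Z G <-> forall y, y \in S ->
    (y.1 <= \rank (G *m invmx gC :&: flag_space (point_mx x) y.2))%N) ->
  (forall y, y \in S -> \rank (H' :&: flag_space (point_mx x) y.2) = y.1) ->
  smooth_at Z H N0 /\ exists d : 'I_p -> 'I_N, exists T : 'M[C]_(p * m),
  [/\ {homo d : i j / (i < j)%N},
      forall k, \rank (H' :&: flag_space (point_mx x) k) = #|[set i | d i < k]%N|,
      is_tangent_space Z H N0 T,
      (p * m - \rank T)%N = #|[set z : 'I_p * 'I_N | (z.2 \notin pivot d) &&
         has (fun y : nat * nat => d z.1 < y.2 <= z.2)%N S]| &
      forall xi : 'rV_(p * m), (xi <= T)%MS -> forall y, y \in S ->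
        tangent H' (flag_space (point_mx x) y.2) (vec_mx xi *m N0 *m invmx gC)].
Proof.
move=> ZE exS; have ug := complexify_unit.
have uE : point_mx x *m gC \in unitmx by rewrite unitmx_mul point_mx_unit.
have ZE' G : Z G <-> forall y, y \in S ->
    (y.1 <= \rank (G :&: flag_space (point_mx x *m gC) y.2))%N.
  by rewrite ZE; split=> h y yS; have := h y yS; rewrite flag_cap_mulr.
have exS' y : y \in S -> \rank (H :&: flag_space (point_mx x *m gC) y.2) = y.1.
  by rewrite flag_cap_mulr //; apply: exS.
have [sm [d [T [d_incr rd tT cT wT]]]] := flag_chart (@natr_complex_inj R) uE ZE' fH comp exS'.
split=> //; exists d, T; split=> // [k|xi /wT h y yS]; first by rewrite -rd flag_cap_mulr.
by apply/tangent_osculating/h.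
Qed.

Lemma schubert_chart w x (d : 'I_p -> 'I_N) : schubert_condition m w ->
  {homo d : i j / (i < j)%N} -> (forall j, d j = last_col m w j :> nat) ->
  (forall l, \rank (H' :&: flag_space (point_mx x) l) = #|[set i | d i < l]%N|) ->
  smooth_at (schubert_cycle g w x) H N0 /\ exists T : 'M[C]_(p * m),
  [/\ is_tangent_space (schubert_cycle g w x) H N0 T, (p * m - \rank T = \sum_j w j)%N &
      forall xi : 'rV_(p * m), (xi <= T)%MS -> forall j : 'I_p,
        tangent H' (flag_space (point_mx x) (last_col m w j).+1) (vec_mx xi *m N0 *m invmx gC)].
Proof.
move=> sw d_incr dE rd.
pose S := [seq (j.+1, (last_col m w j).+1) | j : 'I_p].
have Smem (j : 'I_p) : (j.+1, (last_col m w j).+1) \in S by apply/mapP; exists j; rewrite ?mem_enum.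
have ZE G : schubert_cycle g w x G <-> forall y, y \in S ->
    (y.1 <= \rank (G *m invmx gC :&: flag_space (point_mx x) y.2))%N.
  rewrite schubert_cycleE //; split=> h; first by move=> y /mapP[j _ ->]; apply: h.
  by move=> j; apply: h _ (Smem j).
have exS y : y \in S -> \rank (H' :&: flag_space (point_mx x) y.2) = y.1.
  by move=> /mapP[j _ ->] /=; rewrite rd -dE; apply: position_card.
have [sm [d' [T [d'_incr rd' tT cT wT]]]] := cycle_chart ZE exS.
split=> //; exists T; split=> //; last by move=> xi /wT h j; apply: h (Smem j).
have dd' : d' =1 d by apply: position_uniq => // l; rewrite -rd -rd'.
rewrite cT; transitivity (\sum_(i < p) (m + i - d' i))%N.
  rewrite -(count_schubert d'_incr); apply: eq_card => y; rewrite !inE; congr (_ && _).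
  apply/hasP/idP => [[z /mapP[j _ ->]] /= /andP[h1 h2]|h]; first exact: leq_trans h2.
  by exists (y.1.+1, (last_col m w y.1).+1); rewrite ?Smem //= dd' dE ltnSn -dE -dd'.
by apply: eq_bigr => i _; rewrite dd' dE; have [wm _] := sw; have := wm i; rewrite /last_col; lia.
Qed.

Lemma special_chart u a x : (0 < m)%N -> (0 < a)%N -> special_cycle u a x H ->
  \rank (H' :&: flag_space (point_mx x) (special_index u a)) = special_dim u a ->
  smooth_at (special_cycle u a x) H N0 /\ exists T : 'M[C]_(p * m),
  [/\ is_tangent_space (special_cycle u a x) H N0 T, (p * m - \rank T = a)%N &
      forall xi : 'rV_(p * m), (xi <= T)%MS ->
        tangent H' (flag_space (point_mx x) (special_index u a)) (vec_mx xi *m N0 *m invmx gC)].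
Proof.
move=> m_gt0 a0 sH rH; have kN := special_index_le m_gt0 a0 sH.
pose S := [:: (special_dim u a, special_index u a)].
have ZE G : special_cycle u a x G <-> forall y, y \in S ->
    (y.1 <= \rank (G *m invmx gC :&: flag_space (point_mx x) y.2))%N.
  rewrite special_cycleE //; split=> [h y|/(_ _ (mem_head _ _))//].
  by rewrite inE => /eqP->.
have exS y : y \in S -> \rank (H' :&: flag_space (point_mx x) y.2) = y.1.
  by rewrite inE => /eqP->.
have [sm [d [T [d_incr rd tT cT wT]]]] := cycle_chart ZE exS.
split=> //; exists T; split=> //; last by move=> xi /wT h; apply: h (mem_head _ _).
have rS := exS _ (mem_head _ _); rewrite rd in rS.
rewrite cT -[RHS](special_codim m_gt0 a0 sH) -(count_single d_incr kN rS).
by apply: eq_card => y; rewrite !inE /= orbF.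
Qed.

End Charts.
End Coordinates.
End Osculation.

Section Intersection.
Variables (R : realType) (m p n : nat).
Local Notation N := (m + p)%N.
Local Notation C := R[i].
Hypothesis m_gt0 : (0 < m)%N.
Variables (g : 'M[R]_N) (g_unit : g \in unitmx).
Variables (a : 'I_n -> nat) (upper : 'I_n -> bool) (s : 'I_n -> R).
Hypothesis a_gt0 : forall i, (0 < a i)%N.
Variables (w v : 'I_p -> nat) (k : 'I_n).
Hypotheses (sw : schubert_condition m w) (sv : schubert_condition m v).
Hypothesis total : (\sum_j w j + \sum_j v j + \sum_(i < n | k <= i) a i = m * p)%N.
Hypotheses (ne : no_excess m p a upper k s) (rr : rigid_real m p a upper k s).

Definition condition (c : bool + {i : 'I_n | (k <= i)%N}) : 'M[C]_(p, N) -> Prop :=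
  match c with
  | inl false => schubert_cycle g w (Some 0)
  | inl true => schubert_cycle g v None
  | inr i => special_cycle g (upper (val i)) (a (val i)) (Some (s (val i)))
  end.

Definition condition_codim (c : bool + {i : 'I_n | (k <= i)%N}) : nat :=
  match c with
  | inl false => \sum_j w j
  | inl true => \sum_j v j
  | inr i => a (val i)
  end.

Lemma condition_codim_sum : (\sum_c condition_codim c = m * p)%N.
Proof.
rewrite big_sumType big_bool /= -total; congr (_ + _)%N; first exact: addnC.
rewrite [RHS](reindex_omap (val : {i : 'I_n | (k <= i)%N} -> 'I_n) insub) => [|i ki]; last by rewrite insubT.
by apply: eq_bigl => -[i ki] /=; rewrite ki insubT eqxx.
Qed.

Section Plane.
Variable H : 'M[C]_(p, N).
Hypotheses (fH : row_free H) (cH : forall c, condition c H).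
Local Notation H' := (H *m invmx (complexify g)).

Let special_cycle_at (i : 'I_n) : (k <= i)%N ->
  special_cycle g (upper i) (a i) (Some (s i)) H.
Proof. by move=> ki; apply: (cH (inr (exist _ i ki))). Qed.

Let fH' : row_free H'.
Proof. by rewrite /row_free mxrankMfree // row_free_unit unitmx_inv complexify_unit. Qed.

Let osc0E l : (flag_space (point_mx m p (Some (0 : R))) l :=: (pid_mx l : 'M[C]_N))%MS.
Proof. by apply: flag_space_osc0 => j; rewrite pnatr_eq0. Qed.

Let wH' : standard_schubert (last_col m w) H'.
Proof.
move=> j; have /(schubert_cycleE g_unit (Some 0) H sw)/(_ j) := cH (inl false).
by rewrite (cap_eqmx (eqmx_refl _) (osc0E _)).
Qed.

Let LH' : satisfies (remaining upper v a k s) H'.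
Proof.
move=> c V; case=> [[j [-> ->]]|[i [ki -> ->]]].
  by have /(schubert_cycleE g_unit None H sv)/(_ j) := cH (inl true).
have sH := special_cycle_at ki; have kN := special_index_le m_gt0 (a_gt0 i) sH.
have /(special_cycleE g_unit (Some (s i)) H (a_gt0 i) kN) := sH.
by rewrite (cap_eqmx (eqmx_refl _) (special_spaceE _ kN)).
Qed.

Lemma condition_real : real_plane H.
Proof.
have [_ /(real_of_conj_sub fH')[H0 eH0]] := rr sw sv total fH' wH' LH'.
exists (H0 *m g); rewrite /complexify map_mxM.
by rewrite -[H](mulmxKV (complexify_unit g_unit)); apply: eqmxMr.
Qed.

Variables (N0 : 'M[C]_(m, N)) (comp : complementary H N0).

Definition condition_tangent (c : bool + {i : 'I_n | (k <= i)%N}) (D : 'M[C]_(p, N)) : Prop :=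
  match c with
  | inl false => forall j : 'I_p, tangent H' (pid_mx (last_col m w j).+1) D
  | inl true => forall j : 'I_p, tangent H' (flag_space (rev_mx C N) (last_col m v j).+1) D
  | inr i => tangent H' (space_at m p upper a s (val i)) D
  end.

Lemma condition_chart c : smooth_at (condition c) H N0 /\ exists T : 'M[C]_(p * m),
  [/\ is_tangent_space (condition c) H N0 T, (p * m - \rank T = condition_codim c)%N &
      forall xi : 'rV_(p * m), (xi <= T)%MS ->
        condition_tangent c (vec_mx xi *m N0 *m invmx (complexify g))].
Proof.
case: c => [[]|[i ki]] /=.
- have [d [d_incr dE] rd] := opposite_position ne sw sv total fH' wH' LH'.
  exact: (schubert_chart g_unit fH comp (x := None) sv d_incr dE rd).
- have [d [d_incr dE] rd] := standard_position ne sw sv total fH' wH' LH'.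
  have rd0 l : \rank (H' :&: flag_space (point_mx m p (Some 0)) l) = #|[set i | d i < l]%N|.
    by rewrite (cap_eqmx (eqmx_refl _) (osc0E _)) -rd /flag_space mulmx1.
  have [sm [T [tT cT wT]]] := schubert_chart g_unit fH comp sw d_incr dE rd0.
  split=> //; exists T; split=> // xi /wT h j.
  exact: tangent_eqmx (osc0E _) (h j).
- have sH := special_cycle_at ki; have kN := special_index_le m_gt0 (a_gt0 i) sH.
  have sE := special_spaceE (s i) kN.
  have rH : \rank (H' :&: flag_space (point_mx m p (Some (s i))) (special_index m (upper i) (a i)))
      = special_dim (upper i) (a i).
    rewrite -(cap_eqmx (eqmx_refl _) sE).
    by apply: (remaining_exact m_gt0 ne sw sv total fH' wH' LH'); right; exists i.
  have [sm [T [tT cT wT]]] := special_chart g_unit fH comp m_gt0 (a_gt0 i) sH rH.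
  split=> //; exists T; split=> // xi /wT h.
  by apply: tangent_eqmx h; apply: eqmx_sym.
Qed.

(** A vector in all the tangent spaces gives a direction tangent to every condition, which rigidity
    places inside the plane; the complement [N0] meets the plane only in 0, so the vector is 0. Both
    sides of the codimension equation are then m p. *)
Lemma condition_transverse : (forall c, smooth_at (condition c) H N0) /\
  exists T : bool + {i : 'I_n | (k <= i)%N} -> 'M[C]_(p * m),
    (forall c, is_tangent_space (condition c) H N0 (T c)) /\
    (p * m - \rank (\bigcap_c T c)%MS = \sum_c (p * m - \rank (T c)))%N.
Proof.
split=> [c|]; first by have [] := condition_chart c.
have [T hT] := choice (fun c => (condition_chart c).2).
exists T; split=> [c|]; first by have [] := hT c.
have -> : (\sum_c (p * m - \rank (T c)) = m * p)%N.
  by rewrite -condition_codim_sum; apply: eq_bigr => c _; have [] := hT c.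
suff -> : (\bigcap_c T c)%MS = 0 by rewrite mxrank0 subn0 mulnC.
apply/row_matrixP => r; rewrite row0; set xi := row r _.
have xiT c : (xi <= T c)%MS by apply: (submx_trans (row_sub _ _)); apply: (bigcapmx_inf c).
have tD c := let: And3 _ _ h := hT c in h xi (xiT c).
have [rig _] := rr sw sv total fH' wH' LH'.
have : (vec_mx xi *m N0 *m invmx (complexify g) <= H')%MS.
  apply: rig; first exact: (tD (inl false)).
  move=> c V; case=> [[j [_ ->]]|[i [ki _ ->]]]; first exact: (tD (inl true)).
  exact: (tD (inr (exist _ i ki))).
rewrite submxMfree ?row_free_unit ?unitmx_inv ?complexify_unit //.
by move=> /(complementary_eq0 comp) xi0; rewrite -[xi]vec_mxK xi0 linear0.
Qed.

End Plane.
End Intersection.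

Theorem theorem1 (R : realType) (m p : nat) (m_ge1 : (1 <= m)%N)
    (p_ge1 : (1 <= p)%N) (g : 'M[R]_(m + p)) (g_unit : g \in unitmx)
    (n : nat) (a : 'I_n -> nat) (a_gt0 : forall i, (0 < a i)%N)
    (a_sum : (\sum_i a i = m * p)%N) (upper : 'I_n -> bool) :
  let sigma (i : 'I_n) (x : curve_point R) : 'M[R[i]]_(p, m + p) -> Prop :=
    if upper i then tau_upper g (a i) x else tau_lower g (a i) x in
  exists (zero infty : curve_point R) (s : 'I_n -> curve_point R),
    zero <> infty /\
    forall (w v : 'I_p -> nat) (k : 'I_n),
      schubert_condition m w -> schubert_condition m v ->
      (\sum_j w j + \sum_j v j + \sum_(i < n | k <= i) a i = m * p)%N ->
      let Z (c : (bool + {i : 'I_n | (k <= i)%N})%type) :=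
        match c with
        | inl false => schubert_cycle g w zero
        | inl true => schubert_cycle g v infty
        | inr i => sigma (val i) (s (val i))
        end in
      transverse Z /\
      forall H : 'M[R[i]]_(p, m + p),
        row_free H -> (forall c, Z c H) -> real_plane H.
Proof.
move=> sigma; have [s hs] := special_points R p m_ge1 upper a_gt0.
(* The parameters are those of the standard curve; the coordinate change [g] is absorbed by
   replacing a plane [H] with [H *m invmx (complexify g)]. *)
exists (Some 0), None, (fun i => Some (s i)); split=> // w v k sw sv total Z.
have [ne rr] := hs k (ltnW (ltn_ord k)).
have -> : Z = condition g a upper s w v (k := k).
  by apply: funext => -[[]|i] //; rewrite /Z /sigma /= /special_cycle; case: (upper _).
split=> [H fH cH N0 comp|H fH cH].
  exact (condition_transverse m_ge1 g_unit a_gt0 sw sv total ne rr fH cH comp).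
exact (condition_real m_ge1 g_unit a_gt0 sw sv total rr fH cH).
Qed.
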